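(* Let $s \geq 2$ be an integer, let $\mathbf{s}:=(s,s)$, and let $\mathbf{t}:=(s,0)$ or $\mathbf{t}:=(3s,0)$, excluding the single case $\mathbf{s}=(2,2)$, $\mathbf{t}=(2,0)$. Then there are infinitely many (pairwise non-isomorphic) finite trivalent semisymmetric graphs, each of which is the medial layer graph of a finite regular abstract $4$-polytope whose facets are isomorphic to $\{3,6\}_{\mathbf{s}}$ and whose vertex-figures are isomorphic to $\{6,3\}_{\mathbf{t}}$.
   Context: An abstract $4$-polytope is a partially ordered set with a strictly monotone rank function onto $\{-1,\dots,4\}$, a unique least and greatest face, all maximal chains (flags) of length $6$, the diamond property (between faces of ranks $j-1$ and $j+1$ there are exactly two faces of rank $j$), and strong flag-connectivity. It is regular if its automorphism group (order-preserving bijections) is transitive on flags. Its facets are the sections $F/F_{-1}=\{H: H\le F\}$ for $3$-faces $F$ (with $F_{-1}$ the least face), and its vertex-figures are the sections $F_4/F=\{H: F\le H\}$ for $0$-faces $F$ (with $F_4$ the greatest face). The medial layer graph is the simple graph whose vertices are the $1$-faces and $2$-faces, adjacent when incident. For integers $(a,b)$ with $a^2+ab+b^2>1$, the toroidal map $\{3,6\}_{(a,b)}$ is the abstract polyhedron (face poset of the map) obtained from the regular tessellation of the Euclidean plane by equilateral triangles with vertex set the lattice $\{x e_1 + y e_2: x,y\in\mathbb{Z}\}$, $e_1=(1,0)$, $e_2=(1/2,\sqrt3/2)$, by factoring out the translation group generated by translations by $a e_1+b e_2$ and by $-b e_1+(a+b)e_2$; $\{6,3\}_{(a,b)}$ is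 its dual map (the poset with order reversed). A finite regular graph is semisymmetric if its automorphism group acts transitively on its edges but not on its vertices. *)

(* Defs.v *)
From HB Require Import structures.
From mathcomp Require Import all_boot all_order all_fingroup all_algebra.
From mathcomp Require Import boolp classical_sets functions.

Set Implicit Arguments.
Unset Strict Implicit.
Unset Printing Implicit Defensive.

Import Order.TTheory GRing.Theory Num.Theory.
Local Open Scope ring_scope.

Section Polytopes.
Context {d : Order.disp_t} {P : finPOrderType d}.
Implicit Types (C D : {set P}) (rk : P -> int).

Definition chain C : bool := [forall x in C, forall y in C, (x >=< y)%O].

Definition flags : {set {set P}} := [set C : {set P} | maxset chain C]%SET.

Definition flag_adjacent C D : bool :=
  (#|C :\: D| == 1%N) && (#|D :\: C| == 1%N).

(* [connect] yields a sequence from C to D; its first term C is a flag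
   containing C :&: D anyway, so constraining the later terms is enough. *)
Definition strongly_flag_connected : Prop :=
  {in flags &, forall C D,
     connect [rel A B | [&& B \in flags, C :&: D \subset B
                          & flag_adjacent A B]] C D}.

Record abstract_polytope (n : nat) (rk : P -> int) : Prop := AbstractPolytope {
  rank_mono : forall x y : P, (x < y)%O -> rk x < rk y;
  rank_bound : forall x : P, -1 <= rk x <= n%:Z;
  rank_onto : forall i : int, -1 <= i <= n%:Z -> exists x : P, rk x = i;
  least_face : exists! x : P, forall y : P, (x <= y)%O;
  greatest_face : exists! x : P, forall y : P, (y <= x)%O;
  card_flag : {in flags, forall C, #|C| = n.+2};
  diamond : forall x z : P, (x <= z)%O -> rk z = rk x + 2 ->
    #|[set y : P | (x <= y <= z)%O && (rk y == rk x + 1)]%SET| = 2%N;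
  flag_connected : strongly_flag_connected
}.

Definition poset_aut : {set {perm P}} :=
  [set g : {perm P} |
    [forall x, forall y, ((g x <= g y)%O == (x <= y)%O)]]%SET.

Definition regular_poset : bool :=
  [transitive poset_aut, on flags | ('P^*)%act].

End Polytopes.

Arguments poset_aut {d} P.
Arguments regular_poset {d} P.

Record sgraph := SGraph {
  vertex :> finType;
  edge : rel vertex;
  edge_sym : symmetric edge;
  edge_irrefl : irreflexive edge
}.

Definition sgraph_isomorphic (G H : sgraph) : Prop :=
  exists2 f : G -> H, bijective f & {mono f : x y / edge x y}.

Section Graphs.
Variable G : sgraph.

Definition valent (k : nat) : Prop :=
  forall x : G, #|[set y | edge x y]%SET| = k.

Definition edges : {set {set G}} :=
  [set [set p.1; p.2]%SET | p : G * G & edge p.1 p.2]%SET.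

Definition graph_aut : {set {perm G}} :=
  [set g : {perm G} | [forall x, forall y, edge (g x) (g y) == edge x y]]%SET.

Definition semisymmetric : Prop :=
  [/\ exists k, valent k,
      [transitive graph_aut, on edges | ('P^*)%act]
    & ~~ [transitive graph_aut, on [set: G]%SET | 'P%act]].

End Graphs.

Section MedialLayerGraph.
Context {d : Order.disp_t} {P : finPOrderType d} (rk : P -> int).

Definition medial_face : finType := {x : P | (rk x == 1) || (rk x == 2)}.

Definition incident (x y : medial_face) : bool :=
  (x != y) && (val x >=< val y)%O.

Lemma incident_sym : symmetric incident.
Proof. by move=> x y; rewrite /incident eq_sym comparable_sym. Qed.

Lemma incident_irrefl : irreflexive incident.
Proof. by move=> x; rewrite /incident eqxx. Qed.

Definition medial_layer_graph : sgraph := SGraph incident_sym incident_irrefl.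

End MedialLayerGraph.

Local Open Scope classical_set_scope.

Definition order_isomorphic {T U : Type} (A : set T) (leA : T -> T -> Prop)
    (B : set U) (leB : U -> U -> Prop) : Prop :=
  exists2 f : T -> U, set_bij A B f
    & forall x y, A x -> A y -> (leA x y <-> leB (f x) (f y)).

Section ToroidalMaps.

(* The lattice point x e_1 + y e_2 is represented by its coordinates (x, y),
   so its squared Euclidean length is x ^ 2 + x y + y ^ 2. *)
Definition point : Type := (int * int)%type.

Definition sqlength (p : point) : int := p.1 ^+ 2 + p.1 * p.2 + p.2 ^+ 2.

Definition unit_distance (p q : point) : Prop := sqlength (q - p) = 1.

(* Faces of the tessellation {3,6}, each encoded by the set of lattice points
   on it; incidence is inclusion. The improper faces of ranks -1 and 3 are the
   empty set and the whole lattice. *)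
Inductive tessellation_face : set point -> Prop :=
| LeastFace : tessellation_face set0
| VertexFace p : tessellation_face [set p]
| EdgeFace p q of unit_distance p q : tessellation_face [set p; q]
| TriangleFace p q r of unit_distance p q & unit_distance q r
    & unit_distance r p : tessellation_face [set p; q; r]
| GreatestFace : tessellation_face setT.

Variable ab : int * int.

Definition translation_lattice : set point :=
  [set v | exists m n : int,
     v = (ab.1, ab.2) *~ m + (- ab.2, ab.1 + ab.2) *~ n].

Definition translate (v : point) (F : set point) : set point :=
  [set p + v | p in F].

Definition translation_orbit (F : set point) : set (set point) :=
  [set translate v F | v in translation_lattice].

(* The faces of {3,6}_(a,b) are the orbits of tessellation faces; two orbits
   are incident when they have incident representatives. *)
Definition map36_face : set (set (set point)) :=
  [set translation_orbit F | F in tessellation_face].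

Definition map36_le (X Y : set (set point)) : Prop :=
  exists F G, [/\ X F, Y G & F `<=` G].

Definition map63_face : set (set (set point)) := map36_face.

Definition map63_le (X Y : set (set point)) : Prop := map36_le Y X.

End ToroidalMaps.

Section Sections.
Context {d : Order.disp_t} {P : finPOrderType d} (rk : P -> int).

Definition has_facets (ab : int * int) : Prop :=
  forall F : P, rk F = 3 ->
    order_isomorphic [set H : P | (H <= F)%O] (fun x y => (x <= y)%O)
      (map36_face ab) (@map36_le).

Definition has_vertex_figures (ab : int * int) : Prop :=
  forall F : P, rk F = 0 ->
    order_isomorphic [set H : P | (F <= H)%O] (fun x y => (x <= y)%O)
      (map63_face ab) (@map63_le).

End Sections.

(* Main.v *)
(* A rank 4 string group <r0, r1, r2, r3> with the intersection property is the
   flag-transitive group of the poset of right cosets of its subgroups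
   <r_i | i <> k>; the sections have the prescribed types when r0, r1, r2 and
   r3, r2, r1 generate the automorphism groups of the two toroidal maps.

   Such a group is obtained from a group Q generated by involutions s_0, s_1,
   s_2, t_0 by letting the symmetric group permute the s_i and fix t_0: r2 is
   s_0, r3 is t_0, and r0, r1 are the transpositions (1 2) and (0 1). The
   translations of the facets are then the products s_i s_j s_i s_k, those of
   the vertex-figures are the s_i s_j s_i t_0. For Q we take four block reflections of
   the 8-dimensional space over a finite field of characteristic p, with a
   generalized Cartan matrix whose entries are upper triangular 2 x 2 matrices;
   the order of s_i s_j s_i s_k is the multiplicative order of the holonomy of
   the triangle i j k. The entries do not commute, so the invariant
   4-dimensional subspace has no invariant complement, and averaging shows that
   p divides the order of Q. As p is arbitrary, the graphs are unbounded.

   The medial layer graph is trivalent and edge-transitive. If it were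
   vertex-transitive then, being too large to be 7-arc-transitive (its 12-cycle
   would bound the diameter), it would have a small pointwise stabilizer E of a
   3-arc; comparing the actions of the elements of order 3 in both vertex
   stabilizers gives E = 1, whence an involution exchanging r_i and r_(3-i). It
   would identify the two translation lattices, which are different. *)

Require Import Defs.
From HB Require Import structures.
From mathcomp Require Import all_boot all_order all_fingroup all_algebra all_solvable all_field.
From mathcomp Require Import zify ring boolp.

Set Implicit Arguments.
Unset Strict Implicit.
Unset Printing Implicit Defensive.

Import Order.TTheory GroupScope.

(** * Coset posets of string groups *)

(** The possible values of [t] come from the holonomies. A triangle containing [t_0] has holonomy
    with eigenvalues [eta] and [eta^-1], for a primitive [t]-th root of unity [eta]; the triangle of
    the [s_i] has eigenvalues [eta ^+ 2 * zeta] and its inverse, where [zeta] is [eta] or [eta^-1],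
    hence order [t / 3] or [t]. Distinct eigenvalues serve twice: a triangular block then has order
    [t] whatever its corner entry, and a diagonal block fails to commute with a nondiagonal one.
    This asks for [t > 2], which is the excluded case. The lattice [(s, s)] appears because
    [s_i s_j s_i s_k] is the facet translation by [(1, 1)], while [s_i s_j s_i t_0] is a unit
    translation of the vertex-figure. The intersection property becomes linear algebra: the
    reflections other than the [l]-th fix the columns dual to block [l], whereas a translation fixes
    them only if its exponents are divisible by the order of the holonomy. Finally, the reflection
    group need not admit the permutations of the [s_i] as automorphisms, so it enters through a
    subgroup of a wreath product with ['S_3]. *)

Record stringGroup (n : nat) := StringGroup {
  sg_sort :> finGroupType;
  sg_gen : 'I_n -> sg_sort;
  sg_invol : forall i, sg_gen i * sg_gen i = 1;
  sg_comm : forall i j : 'I_n, (i.+1 < j)%N -> commute (sg_gen i) (sg_gen j);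
  sg_generated : <<[set sg_gen i | i : 'I_n]>> = [set: sg_sort]
}.

Section CosetPoset.
Variables (n : nat) (S : stringGroup n).
Local Notation r := (@sg_gen n S).

Definition parab (I : pred 'I_n) : {set S} := <<[set r i | i in I]>>.
Canonical parab_group I := Eval hnf in [group of parab I].

(** Stabiliser of the base face of index [k]. Indices exceed ranks by one, so [fstab 0] and
    [fstab n.+1] omit no generator and belong to the two improper faces. *)
Definition fstab (k : nat) : {set S} := parab [pred i : 'I_n | i.+1 != k :> nat].
Canonical fstab_group k := Eval hnf in [group of fstab k].

Lemma parabS (I J : pred 'I_n) : {subset I <= J} -> parab I \subset parab J.
Proof.
move=> sIJ; apply: genS; apply/subsetP => x /imsetP [i iI ->].
by apply: imset_f; apply: sIJ.
Qed.

Lemma mem_parab (I : pred 'I_n) i : i \in I -> r i \in parab I.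
Proof. by move=> iI; apply: mem_gen; apply: imset_f. Qed.

Lemma parabT (I : pred 'I_n) : (forall i, i \in I) -> parab I = [set: S].
Proof.
move=> hI; rewrite -(sg_generated S) /parab; congr <<_>>.
by apply/setP => x; apply/imsetP/imsetP => -[i _ ->]; exists i.
Qed.

Definition below (j : nat) := parab [pred i : 'I_n | i.+1 < j]%N.
Definition above (j : nat) := parab [pred i : 'I_n | j < i.+1]%N.

(** Deleting one generator cuts the string diagram into two ends without a bond between them, so the
    stabiliser is their commuting product. This is what makes incidence of cosets transitive. *)
Lemma fstab_factor j x : x \in fstab j ->
  exists p q, [/\ p \in below j, q \in above j, x = p * q & commute p q].
Proof.
have cpq : above j \subset 'C(below j).
  rewrite gen_subG; apply/subsetP => _ /imsetP [i' i'j ->].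
  rewrite /below /parab /= cent_gen; apply/centP => _ /imsetP [i ij ->].
  apply: commute_sym; apply: sg_comm; rewrite !inE in i'j ij.
  exact: leq_trans ij i'j.
have -> : fstab j = below j * above j.
  rewrite -(cent_joinEr cpq) /fstab /parab joing_idl joing_idr; congr <<_>>.
  apply/setP => y; rewrite inE; apply/imsetP/orP.
    move=> [i]; rewrite !inE neq_ltn => /orP [] h ->; [left|right];
      by apply: imset_f.
  by case=> /imsetP [i]; rewrite !inE => h ->; exists i; rewrite // inE neq_ltn h ?orbT.
case/mulsgP => p q pb qa ->; exists p, q; split=> //.
by apply: commute_sym; apply: (centP (subsetP cpq _ qa)).
Qed.

Lemma below_fstab j k : (j <= k)%N -> below j \subset fstab k.
Proof.
move=> jk; apply: parabS => i; rewrite !inE => ij; rewrite neq_ltn.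
by rewrite (leq_trans ij jk).
Qed.

Lemma above_fstab j k : (k <= j)%N -> above j \subset fstab k.
Proof.
move=> jk; apply: parabS => i; rewrite !inE => ij; rewrite neq_ltn.
by rewrite (leq_ltn_trans jk ij) orbT.
Qed.

(* The face of rank [k - 1] containing [x] is the coset [fstab k :* x]; the index
   [k] is kept because the subgroups [fstab k] need not be distinct. *)
Definition face : Type :=
  {F : 'I_n.+2 * {set S} | F.2 \in rcosets (fstab F.1) [set: S]}.

HB.instance Definition _ := Finite.on face.

Definition face_idx (F : face) : 'I_n.+2 := (val F).1.
Definition face_set (F : face) : {set S} := (val F).2.

Lemma mkface_subproof (k : 'I_n.+2) x :
  fstab k :* x \in rcosets (fstab k) [set: S].
Proof. by rewrite mem_rcosets mulSGid ?subsetT ?inE. Qed.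

Definition mkface (k : 'I_n.+2) x : face := Sub (k, fstab k :* x) (mkface_subproof k x).

Lemma face_idx_mk k x : face_idx (mkface k x) = k. Proof. by []. Qed.

Lemma mem_mkface k x y : (y \in face_set (mkface k x)) = (y * x^-1 \in fstab k).
Proof. exact: mem_rcoset. Qed.

Lemma mem_mkface_id k x : x \in face_set (mkface k x).
Proof. by rewrite mem_mkface mulgV group1. Qed.

Lemma faceE F x : x \in face_set F -> F = mkface (face_idx F) x.
Proof.
case: F => -[k X] /= hX; rewrite /face_set /face_idx /= => xX.
apply: val_inj => /=; congr pair.
case/rcosetsP: (hX) xX => y _ -> xy.
by apply/esym/rcoset_eqP.
Qed.

Lemma face_ex F : exists x, x \in face_set F.
Proof.
case: F => -[k X] /= hX; rewrite /face_set /=.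
by case/rcosetsP: (hX) => y _ ->; exists y; rewrite rcoset_refl.
Qed.

Lemma mkface_eq k x y : (mkface k x == mkface k y) = (x * y^-1 \in fstab k).
Proof.
apply/eqP/idP => [e|h].
  by rewrite -mem_mkface -e mem_mkface_id.
rewrite -mem_mkface in h.
by rewrite (faceE h).
Qed.

Definition face_le (F F' : face) : bool :=
  (face_idx F <= face_idx F')%N && (face_set F :&: face_set F' != set0).

Lemma face_leP F F' :
  reflect ((face_idx F <= face_idx F')%N /\
           exists x, x \in face_set F /\ x \in face_set F') (face_le F F').
Proof.
apply: (iffP andP) => -[h].
  by case/set0Pn => x /setIP [? ?]; split=> //; exists x.
by case=> x [? ?]; split=> //; apply/set0Pn; exists x; rewrite inE; apply/andP.
Qed.

Lemma face_le_refl : reflexive face_le.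
Proof. by move=> F; apply/face_leP; split=> //; case: (face_ex F) => x; exists x. Qed.

Lemma face_idx_eq F F' x : face_idx F = face_idx F' ->
  x \in face_set F -> x \in face_set F' -> F = F'.
Proof. by move=> e /faceE -> /faceE ->; rewrite e. Qed.

Lemma face_le_anti : antisymmetric face_le.
Proof.
move=> F F' /andP [] /face_leP [h [x [xF xF']]] /face_leP [h' _].
by apply: (face_idx_eq _ xF xF'); apply/val_inj/anti_leq; rewrite h.
Qed.

Lemma face_set_mul F x y : x \in face_set F -> y \in face_set F ->
  y * x^-1 \in fstab (face_idx F).
Proof. by move=> /faceE xF; rewrite {1}xF mem_mkface. Qed.

Lemma face_set_mull F x y : x \in face_set F -> y \in fstab (face_idx F) ->
  y * x \in face_set F.
Proof. by move=> /faceE xF yF; rewrite xF mem_mkface mulgK. Qed.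

(* A base element can be slid along the commuting factor [above] of the middle
   stabiliser into the higher coset without leaving any lower one. *)
Lemma face_slide F F' x : x \in face_set F -> face_le F F' ->
  exists2 q, q \in above (face_idx F) & q * x \in face_set F'.
Proof.
move=> xF /face_leP [le [y [yF yF']]].
have /fstab_factor [p [q [hp hq e cpq]]] := face_set_mul xF yF.
exists q => //.
have -> : q * x = p^-1 * y by rewrite -(mulgKV x y) e !mulgA mulVg mul1g.
apply: face_set_mull => //; rewrite groupV.
by apply: (subsetP (below_fstab le)).
Qed.

Lemma face_le_trans : transitive face_le.
Proof.
move=> G F H FG GH.
have [le [x [xF xG]]] := face_leP _ _ FG.
have [le' _] := face_leP _ _ GH.
have [q hq qx] := face_slide xG GH.
apply/face_leP; split; first exact: leq_trans le le'.
exists (q * x); split=> //; apply: face_set_mull => //.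
exact: (subsetP (above_fstab le)).
Qed.

Fact face_display : Order.disp_t. Proof. exact: Order.Disp tt tt. Qed.

HB.instance Definition _ := Order.Le_isPOrder.Build face_display face
  face_le_refl face_le_anti face_le_trans.

Lemma leEface (F F' : face) : (F <= F')%O = face_le F F'. Proof. by []. Qed.

Definition face_rank (F : face) : int := ((face_idx F)%:Z - 1)%R.

End CosetPoset.

Lemma three_cases (a b : nat) :
  a.+1 <> b -> a <> b -> a <> b.+1 -> (a.+1 < b)%N \/ (b.+1 < a)%N.
Proof. by lia. Qed.

(** * Flags of the coset poset: regularity, connectivity and the diamond property *)

Section Flags.
Variables (n : nat) (S : stringGroup n).
Local Notation r := (@sg_gen n S).

Definition flag_of (x : S) : {set face S} := [set F | x \in face_set F].

Lemma flag_of_chain x : chain (flag_of x).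
Proof.
apply/forall_inP => F; rewrite inE => xF; apply/forall_inP => F'; rewrite inE => xF'.
rewrite /Order.comparable !leEface.
by case/orP: (leq_total (face_idx F) (face_idx F')) => h; apply/orP; [left|right];
  apply/face_leP; split=> //; exists x.
Qed.

Lemma comparable_le (F F' : face S) : (F >=< F')%O ->
  (face_idx F <= face_idx F')%N -> (F <= F')%O.
Proof.
move=> /orP [] // F'F le; move: (F'F); rewrite leEface => /face_leP [le' [x [xF' xF]]].
by rewrite (@face_idx_eq _ _ F F' x) //; apply/val_inj/anti_leq; rewrite le.
Qed.

(** Induction on the index: an element common to all faces of index below [k] is slid, from the
    highest of them, into the face of index [k]. The sliding factor lies in the stabilisers of all
    lower faces, so nothing is lost. Hence every flag is some [flag_of x]. *)
Lemma chain_common (C : {set face S}) : chain C -> exists x, C \subset flag_of x.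
Proof.
move=> /forall_inP chC.
have cmp F F' : F \in C -> F' \in C -> (F >=< F')%O.
  by move=> FC F'C; apply: (forall_inP (chC F FC)).
suff h k : exists x, forall F, F \in C -> (face_idx F < k)%N -> x \in face_set F.
  have [x hx] := h n.+2; exists x; apply/subsetP => F FC; rewrite inE.
  exact: hx.
elim: k => [|k [x IH]]; first by exists 1.
case: (pickP [pred F in C | face_idx F == k :> nat]) => [F0|none]; last first.
  exists x => F FC; rewrite ltnS leq_eqVlt => /orP [] h; last exact: IH.
  by have := none F; rewrite /= FC h.
rewrite inE => /andP [F0C /eqP F0k].
have uniqF0 F : F \in C -> face_idx F = k :> nat -> F = F0.
  move=> FC Fk; apply/eqP; rewrite eq_le.
  by rewrite !comparable_le ?cmp // Fk F0k.
case: (pickP [pred F in C | face_idx F < k]%N) => [F1 F1P|none]; last first.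
  have [y yF0] := face_ex F0; exists y => F FC.
  rewrite ltnS leq_eqVlt => /orP [/eqP Fk|h]; first by rewrite (uniqF0 F).
  by have := none F; rewrite /= FC h.
have [F' /andP [F'C F'k] F'max] := arg_maxnP (fun F : face S => nat_of_ord (face_idx F)) F1P.
have F'F0 : (F' <= F0)%O by apply: comparable_le; rewrite ?cmp // F0k ltnW.
have xF' := IH _ F'C F'k.
have [q hq qx] := face_slide xF' F'F0.
exists (q * x) => F FC; rewrite ltnS leq_eqVlt => /orP [/eqP Fk|Fk].
  by rewrite (uniqF0 F).
apply: face_set_mull; first exact: IH.
apply: (subsetP (above_fstab S _)) hq.
by apply: F'max; rewrite inE FC Fk.
Qed.

Lemma flag_ofE x : flag_of x = [set mkface k x | k : 'I_n.+2].
Proof.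
apply/setP => F; rewrite inE; apply/idP/imsetP => [xF|[k _ ->]].
  by exists (face_idx F) => //; apply: faceE.
exact: mem_mkface_id.
Qed.

Lemma card_flag_of x : #|flag_of x| = n.+2.
Proof.
rewrite flag_ofE card_imset ?card_ord // => k k' e.
by rewrite -(face_idx_mk k x) e.
Qed.

Lemma flagsP (C : {set face S}) : reflect (exists x, C = flag_of x) (C \in flags).
Proof.
rewrite inE; apply: (iffP maxsetP) => [[chC maxC]|[x ->]].
  have [x Cx] := chain_common chC; exists x; apply/esym/maxC => //.
  exact: flag_of_chain.
split=> [|B chB xB]; first exact: flag_of_chain.
have [y By] := chain_common chB.
apply/eqP; rewrite eq_sym eqEcard xB /=.
by rewrite (leq_trans (subset_leq_card By)) // !card_flag_of.
Qed.

Definition face_mul_subproof (g : S) (F : face S) :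
  face_set F :* g \in rcosets (fstab S (face_idx F)) [set: S].
Proof.
have [x /faceE ->] := face_ex F.
by rewrite /face_set /= -rcosetM mem_rcosets mulSGid ?subsetT ?inE.
Qed.

Definition face_mul (g : S) (F : face S) : face S :=
  Sub (face_idx F, face_set F :* g) (face_mul_subproof g F).

Lemma face_mul_mk g k x : face_mul g (mkface k x) = mkface k (x * g).
Proof. by apply: val_inj; rewrite /= /face_set /= -rcosetM. Qed.

Lemma mem_face_mul g F x : (x \in face_set (face_mul g F)) = (x * g^-1 \in face_set F).
Proof. exact: mem_rcoset. Qed.

Lemma face_mulM g h F : face_mul h (face_mul g F) = face_mul (g * h) F.
Proof. by apply: val_inj; rewrite /= /face_set /= -rcosetM. Qed.

Lemma face_mul1 F : face_mul 1 F = F.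
Proof. by have [x /faceE ->] := face_ex F; rewrite face_mul_mk mulg1. Qed.

Lemma face_mul_inj g : injective (face_mul g).
Proof.
move=> F F' /(congr1 (face_mul g^-1)).
by rewrite !face_mulM mulgV !face_mul1.
Qed.

Lemma face_mul_le g F F' : (face_mul g F <= face_mul g F')%O = (F <= F')%O.
Proof.
have sub h G G' : (G <= G')%O -> (face_mul h G <= face_mul h G')%O.
  rewrite !leEface => /face_leP [le [x [xG xG']]]; apply/face_leP; split=> //.
  by exists (x * h); rewrite !mem_face_mul !mulgK.
apply/idP/idP; last exact: sub.
by move/(sub g^-1); rewrite !face_mulM mulgV !face_mul1.
Qed.

Definition face_perm g : {perm face S} := perm (@face_mul_inj g).

Lemma face_permE g F : face_perm g F = face_mul g F. Proof. exact: permE. Qed.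

Lemma face_perm_aut g : face_perm g \in poset_aut (face S).
Proof.
rewrite inE; apply/forallP => F; apply/forallP => F'.
by rewrite !face_permE face_mul_le.
Qed.

Lemma coset_poset_regular : regular_poset (face S).
Proof.
apply/imsetP; exists (flag_of 1); first by apply/flagsP; exists 1.
apply/setP => C; apply/flagsP/imsetP => [[x ->]|[g gA ->]].
  exists (face_perm x); first exact: face_perm_aut.
  rewrite !flag_ofE /= /setact -imset_comp; apply: eq_imset => k /=.
  by rewrite /aperm face_permE face_mul_mk mul1g.
(* The orbit has to equal [flags], so the image of a flag under an arbitrary automorphism must again
   be a flag: it is a chain of full size inside some [flag_of x]. *)
apply/flagsP; rewrite /setact.
have gle F F' : (g F <= g F')%O = (F <= F')%O.
  by move: gA; rewrite inE => /forallP /(_ F) /forallP /(_ F') /eqP.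
have : chain [set aperm F g | F in flag_of 1].
  apply/forall_inP => _ /imsetP [F FC ->]; apply/forall_inP => _ /imsetP [F' F'C ->].
  have := forall_inP (forall_inP (flag_of_chain 1) F FC) F' F'C.
  by rewrite /aperm /Order.comparable !gle.
case/chain_common => x sx; apply/flagsP; exists x; apply/eqP.
rewrite eqEcard sx card_flag_of card_imset ?card_flag_of ?leqnn //.
exact: perm_inj.
Qed.

(** The intersection property of string C-groups, on which connectivity and the diamond property
    rest. *)
Hypothesis fstab_inter : forall (J : {set 'I_n}) x,
  (forall j, j \in J -> x \in fstab S j.+1) -> x \in parab S [pred i | i \notin J].
Hypothesis gen_notin_fstab : forall i, r i \notin fstab S i.+1.

Lemma gen_fstab (i : 'I_n) (k : nat) : i.+1 != k -> r i \in fstab S k.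
Proof. by move=> h; apply: mem_parab. Qed.

Lemma fstab0 : fstab S 0 = [set: S]. Proof. by apply: parabT. Qed.
Lemma fstabn : fstab S n.+1 = [set: S].
Proof. by apply: parabT => i; rewrite inE eqSS neq_ltn ltn_ord. Qed.

Lemma flag_of_adjacent x i : flag_adjacent (flag_of x) (flag_of (r i * x)).
Proof.
suff D y z : z * y^-1 = r i \/ y * z^-1 = r i -> #|flag_of y :\: flag_of z| = 1%N.
  by rewrite /flag_adjacent !D ?mulgK //; [right|left].
move=> yz.
have lt : (i.+1 < n.+2)%N by rewrite !ltnS ltnW.
have -> : flag_of y :\: flag_of z = [set mkface (Ordinal lt) y].
  apply/setP => F; rewrite !inE andbC; apply/andP/eqP => [[/faceE ->]|->].
    rewrite mem_mkface => zF; congr mkface; apply: val_inj => /=.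
    apply/eqP; rewrite eq_sym; apply: contraR zF => iF.
    case: yz => [->|e]; first exact: gen_fstab.
    by rewrite -groupV invMg invgK e gen_fstab.
  rewrite mem_mkface_id mem_mkface; split=> //.
  case: yz => [->|e]; first exact: gen_notin_fstab.
  by rewrite -groupV invMg invgK e gen_notin_fstab.
by rewrite cards1.
Qed.

Lemma invol_inv i : (r i)^-1 = r i.
Proof. by apply/eqP; rewrite eq_invg_mul sg_invol. Qed.

(** By the intersection property [y * x^-1] is a word in the generators outside the set [J] of
    shared proper faces. The suffixes of this word, multiplied by [x], give successively adjacent
    flags that all keep the shared faces. *)
Lemma coset_poset_connected : @strongly_flag_connected _ (face S).
Proof.
move=> C D /flagsP [x ->] /flagsP [y ->].
pose J := [set j : 'I_n | y * x^-1 \in fstab S j.+1].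
have yx : y * x^-1 \in parab S [pred i | i \notin J].
  by apply: fstab_inter => j; rewrite inE.
have sub z : z * x^-1 \in parab S [pred i | i \notin J] ->
    flag_of x :&: flag_of y \subset flag_of z.
  move=> zx; apply/subsetP => F; rewrite !inE => /andP [/faceE ->].
  rewrite !mem_mkface => yF; case: (posnP (face_idx F)) => [->|k0].
    by rewrite fstab0 inE.
  apply: subsetP zx; apply: parabS => i; rewrite !inE.
  by apply: contra => /eqP ->.
move: (flag_of x :&: flag_of y) sub yx => K sub yx.
case/gen_prodgP: yx => m [c cJ e].
have {e}-> : y = (\prod_(i < m) c i) * x by rewrite -e mulgKV.
have mem z : z \in parab S [pred i | i \notin J] -> K \subset flag_of (z * x).
  by move=> zJ; apply: sub; rewrite mulgK.
elim: m c cJ => [|m IH] c cJ; first by rewrite big_ord0 mul1g connect0.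
rewrite big_ord_recl -mulgA.
have cJ' i : c (lift ord0 i) \in [set r i | i in [pred i | i \notin J]] by [].
apply: connect_trans (IH _ cJ') (connect1 _).
have [i iJ ci] := imsetP (cJ ord0); rewrite ci /=.
apply/and3P; split; last exact: flag_of_adjacent.
  by apply/flagsP; eexists.
rewrite mulgA; apply: mem; apply: groupM; first exact: mem_parab.
by apply: group_prod => k _; apply: mem_gen.
Qed.

(** Once the two neighbours of [i] in the string are removed, every remaining generator other than
    [r i] commutes with [r i] and fixes the middle face. So an element common to [x], [y], [z]
    differs from [g] by such a factor and at most one [r i], which leaves two values for [y]. *)
Lemma coset_poset_diamond (x z : face S) : (x <= z)%O ->
  face_rank z = (face_rank x + 2)%R ->
  #|[set y : face S | (x <= y <= z)%O && (face_rank y == face_rank x + 1)%R]| = 2.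
Proof.
rewrite leEface => /face_leP [_ [g [xg zg]]].
rewrite /face_rank => rk.
have idz : face_idx z = (face_idx x).+2 :> nat by lia.
have ltn : (face_idx x < n)%N by have := ltn_ord (face_idx z); rewrite idz.
pose i := Ordinal ltn.
have lt : (i.+1 < n.+2)%N by rewrite !ltnS ltnW.
have -> : [set y : face S | (x <= y <= z)%O &&
    (((face_idx y)%:Z - 1)%R == ((face_idx x)%:Z - 1 + 1)%R)] =
  [set mkface (Ordinal lt) g; mkface (Ordinal lt) (r i * g)].
  have rix : r i * g \in face_set x.
    by apply: face_set_mull => //; apply: gen_fstab; rewrite /= neq_ltn ltnSn orbT.
  have riz : r i * g \in face_set z.
    by apply: face_set_mull => //; apply: gen_fstab; rewrite idz /= neq_ltn ltnSn.
  have bet y : y \in face_set x -> y \in face_set z ->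
      (x <= mkface (Ordinal lt) y <= z)%O.
    move=> yx yz; rewrite !leEface; apply/andP; split; apply/face_leP.
      by split; [rewrite /= leqnSn | exists y; rewrite mem_mkface_id].
    by split; [rewrite /= idz leqnSn | exists y; rewrite mem_mkface_id].
  apply/setP => y; rewrite !inE; apply/andP/orP; last first.
    by case=> /eqP ->; rewrite bet //; split=> //; apply/eqP;
    change (((face_idx x).+1%:Z - 1 = (face_idx x)%:Z - 1 + 1)%R); lia.
  case=> /andP [xy yz] /eqP rky.
  have idy : face_idx y = Ordinal lt by apply: val_inj => /=; lia.
  have [h hC] : exists h, [set x; y; z] \subset flag_of h.
    apply: chain_common; apply/forall_inP => F FC; apply/forall_inP => F' F'C.
    move: FC F'C; rewrite !inE -!orbA.
    have xz := le_trans xy yz.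
    case/or3P => /eqP ->; case/or3P => /eqP ->;
      by rewrite /Order.comparable ?lexx ?xy ?yz ?xz ?orbT.
  have [xh [yh zh]] : h \in face_set x /\ h \in face_set y /\ h \in face_set z.
    have sub := subsetP hC.
    by have := sub x; have := sub y; have := sub z; rewrite !inE !eqxx ?orbT /=; intuition.
  have hg : h * g^-1 \in parab S [pred j : 'I_n | j \notin [set j : 'I_n | (j.+1 == face_idx x) || (j.+1 == face_idx z)]].
    apply: fstab_inter => j; rewrite inE => /orP [] /eqP ->; exact: face_set_mul.
  have : exists2 w, w \in fstab S i.+1 & h * g^-1 = w \/ h * g^-1 = w * r i.
    have cent : <<[set r i]>> \subset 'C(parab S [pred j : 'I_n | (j.+1 != i) && (j != i) && (j != i.+1 :> nat)]).
      rewrite gen_subG sub1set /parab /= cent_gen; apply/centP => _ /imsetP [j jP ->].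
      move: jP; rewrite !inE => /andP [/andP [j1 j2] j3].
      have : (j.+1 < i)%N \/ (i.+1 < j)%N.
        move/eqP: j1; move/eqP: j2; move/eqP: j3 => j3 j2 j1.
        have ji : (j : nat) <> i by move=> e; apply: j2; apply: val_inj.
        exact: (three_cases j1 ji j3).
      case=> h'; last exact: sg_comm.
      by apply: commute_sym; apply: sg_comm.
    have sub : parab S [pred j : 'I_n | j \notin [set j : 'I_n | (j.+1 == face_idx x) || (j.+1 == face_idx z)]] \subset
      parab S [pred j : 'I_n | (j.+1 != i) && (j != i) && (j != i.+1 :> nat)] * <<[set r i]>>.
      rewrite -(cent_joinEr cent) /parab joing_idl joing_idr; apply: genS.
      apply/subsetP => _ /imsetP [j jP ->]; move: jP; rewrite !inE idz eqSS negb_or => /andP [j1 j3].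
      case: (j =P i) => [->|/eqP ji]; first by rewrite eqxx orbT.
      by apply/orP; left; apply: imset_f; rewrite inE j1 ji j3.
    have /mulsgP [w ri wP /cycleP [k ->] ->] := subsetP sub _ hg.
    have wi : w \in fstab S i.+1.
      apply: subsetP wP; apply: parabS => j; rewrite !inE eqSS => /andP [/andP [_ j2] _].
      by apply: contra j2 => /eqP e; apply/eqP/val_inj.
    exists w => //.
    have -> : (r i) ^+ k = (r i) ^+ odd k.
      rewrite -{1}(odd_double_half k) expgD -mul2n expgM.
      by rewrite expgS expg1 sg_invol expg1n mulg1.
    by case: (odd k); [right|left; rewrite mulg1].
  case=> w wi [] e.
    left; rewrite (faceE yh) idy mkface_eq; rewrite e; exact: wi.
  right; rewrite (faceE yh) idy mkface_eq invMg mulgA e invol_inv -mulgA sg_invol mulg1.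
  exact: wi.
rewrite cards2 mkface_eq invMg mulgA mulgV mul1g invol_inv.
by rewrite (negbTE (gen_notin_fstab i)).
Qed.

Theorem coset_poset_polytope : abstract_polytope n (@face_rank n S).
Proof.
split.
- move=> x y; rewrite lt_neqAle => /andP [neq].
  rewrite leEface => /face_leP [le [g [xg yg]]].
  have : face_idx x != face_idx y :> nat.
    apply: contra neq => /eqP /val_inj e; apply/eqP; exact: face_idx_eq e xg yg.
  rewrite /face_rank; lia.
- by move=> x; have := ltn_ord (face_idx x); rewrite /face_rank; lia.
- move=> i hi; have lt : (absz (i + 1)%R < n.+2)%N by lia.
  exists (mkface (Ordinal lt) 1); rewrite /face_rank /face_idx /=; lia.
- have mem x : x \in face_set (@mkface n S ord0 1).
    by rewrite mem_mkface [fstab _ _]fstab0 inE.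
  have le y : (@mkface n S ord0 1 <= y)%O.
    by rewrite leEface; apply/face_leP; split=> //; have [x yx] := face_ex y; exists x.
  exists (mkface ord0 1); split=> // y yle; apply/eqP; rewrite eq_le le; exact: yle.
- have mem x : x \in face_set (@mkface n S ord_max 1).
    by rewrite mem_mkface [fstab _ _]fstabn inE.
  have le y : (y <= @mkface n S ord_max 1)%O.
    rewrite leEface; apply/face_leP; split; first by rewrite /= -ltnS.
    by have [x yx] := face_ex y; exists x.
  exists (mkface ord_max 1); split=> // y yle; apply/eqP; rewrite eq_le le andbT; exact: yle.
- by move=> C /flagsP [x ->]; rewrite card_flag_of.
- exact: coset_poset_diamond.
- exact: coset_poset_connected.
Qed.

End Flags.

(** * Transitivity on arcs of cubic graphs *)

Lemma invg_invol (gT : finGroupType) (x : gT) : (x * x = 1 -> x^-1 = x)%g.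
Proof. by move=> xx; apply/eqP; rewrite eq_invg_mul xx. Qed.

Lemma invol_mulV (gT : finGroupType) (x y : gT) :
  (x * x = 1 -> y * y = 1 -> (x * y)^-1 = y * x)%g.
Proof. by move=> xx yy; rewrite invMg !invg_invol. Qed.

Lemma invol_expgC (gT : finGroupType) (x y : gT) k :
  (x * x = 1 -> y * y = 1 -> (x * y) ^+ k = 1 -> (y * x) ^+ k = 1)%g.
Proof. by move=> xx yy e; rewrite -(invol_mulV xx yy) expgVn e invg1. Qed.

Lemma gen_ind (gT : finGroupType) (A : {set gT}) (P : gT -> Prop) :
  P 1 -> (forall a x, a \in A -> P x -> P (a * x)) ->
  forall x, x \in <<A>> -> P x.
Proof.
move=> P1 PM x /gen_prodgP [n [f fA ->]].
elim: n f fA => [|n IH] f fA; first by rewrite big_ord0.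
by rewrite big_ord_recl; apply: PM => //; apply: IH => i.
Qed.

(** Here [r] is the order of a 2-group, [b] that of its centre, [b0] and [c0] count the points of
    the centre and of the group fixed by an element of cube 1; the congruences come from its orbits.
    The finite check leaves a centre of index at most 2, or one configuration of order 16. *)
Lemma cube_action_orders (r b b0 c0 : nat) : r \in [:: 2; 4; 8; 16]%N ->
  b %| r -> b0 %| b -> (b0 < b)%N -> b = b0 %[mod 3] ->
  c0 %| r -> (1 < c0)%N -> r = c0 %[mod 3] ->
  (r %/ b <= 2)%N || [&& r == 16, b == 4, b0 == 1%N & (4 <= c0)%N].
Proof.
move=> hr hb hb0 hlt /eqP hm hc hc1 /eqP hm'.
have r0 : (0 < r <= 16)%N by move: hr; rewrite !inE => /or4P [] /eqP ->.
have [r1 r2] := andP r0.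
have hb16 := leq_trans (dvdn_leq r1 hb) r2.
have hc16 := leq_trans (dvdn_leq r1 hc) r2.
have chk : all (fun r => all (fun b => all (fun b0 => all (fun c0 =>
   [&& b %| r, b0 %| b, (b0 < b)%N, b == b0 %[mod 3], c0 %| r, (1 < c0)%N & r == c0 %[mod 3]] ==>
   ((r %/ b <= 2)%N || [&& r == 16, b == 4, b0 == 1%N & (4 <= c0)%N]))
   (iota 0 17)) (iota 0 17)) (iota 0 17)) [:: 2; 4; 8; 16]%N by vm_compute.
have b0_16 : (b0 <= 16)%N by rewrite ltnW // (leq_trans hlt).
have := allP (allP (allP (allP chk r hr) b _) b0 _) c0 _.
rewrite !mem_iota !add0n !ltnS hb16 hc16 b0_16 => /(_ isT isT isT).
by rewrite hb hb0 hlt hm hc hc1 hm'.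
Qed.

(** * Pairs of small 2-groups normalised by elements of order 3 *)

Section Amalgam.
Variable gT : finGroupType.
Implicit Types (R E : {group gT}) (c z : gT).

Lemma cube_fix_mod R c : c \in 'N(R) -> c ^+ 3 = 1 ->
  #|R| = #|'C_R[c]| %[mod 3].
Proof.
move=> cN c3.
have c3g : 3.-group <[c]>.
  by apply: (@pnat_dvd _ 3) => //; rewrite -orderE order_dvdn c3.
have acts : [acts <[c]>, on R | 'J] by rewrite astabsJ cycle_subG.
rewrite (pgroup_fix_mod c3g acts); congr (_ %% 3).
by apply: eq_card => x; rewrite afixJ cent_cycle !inE.
Qed.

(** A centre of index at most 2 has cyclic quotient, which forces [R] to be abelian. In the
    exceptional configuration the centre and ['C_R[c]] meet trivially and have orders with product
    16, so [R] is the product of its centre and an abelian group of order 4. *)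
Lemma abelian_of_cube_action R c z : c \in 'N(R) -> c ^+ 3 = 1 ->
    z \in R -> z != 1 -> commute c z -> #|R| \in [:: 2; 4; 8; 16] ->
    ~~ ('Z(R) \subset 'C[c]) -> abelian R.
Proof.
move=> cN c3 zR z1 cz cardR ncZ.
have cZN : c \in 'N('Z(R)) by apply: (subsetP (gFnorms _ _)).
have := cube_fix_mod cN c3; have := cube_fix_mod cZN c3.
set B := #|'Z(R)|; set B0 := #|'C_('Z(R))[c]|; set C0 := #|'C_R[c]|.
have B0B : (B0 < B)%N.
  rewrite /B /B0; apply: proper_card; rewrite properEneq subsetIl andbT.
  apply: contra ncZ => /eqP e; rewrite -e; exact: subsetIr.
have C0_gt1 : (1 < C0)%N.
  rewrite /C0 cardG_gt1; apply/trivgPn; exists z => //.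
  by apply/setIP; split=> //; apply/cent1P.
have BR : B %| #|R| by apply: cardSg; apply: center_sub.
have B0dB : B0 %| B by apply: cardSg; apply: subsetIl.
have C0dR : C0 %| #|R| by apply: cardSg; apply: subsetIl.
move=> modB modC.
case/orP: (cube_action_orders cardR BR B0dB B0B modB C0dR C0_gt1 modC).
  move=> le2; apply: cyclic_center_factor_abelian.
  have q : #|R / 'Z(R)| = (#|R| %/ B)%N.
    by rewrite card_quotient ?gFnorm // divgS // center_sub.
  have [q1|q1] := leqP #|R / 'Z(R)| 1.
    by rewrite (card_le1_trivg q1) cyclic1.
  by apply: prime_cyclic; rewrite (_ : #|_| = 2) //; apply/eqP; rewrite eqn_leq q1 andbT q.
case/and4P => /eqP r16 /eqP b4 /eqP b1 c4.
have BC : 'Z(R) :&: 'C_R[c] = 1.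
  apply/trivgP; rewrite -[in X in _ \subset X](card1_trivg (G := 'C_('Z(R))[c]) b1).
  by apply/subsetP => x; rewrite !inE => /andP [-> /andP [_ ->]].
have RE : 'Z(R) * 'C_R[c] = R.
  apply/eqP; rewrite eqEcard mul_subG ?center_sub ?subsetIl //=.
  by rewrite TI_cardMg // -/B b4 r16; apply: (leq_mul (leqnn 4) c4).
have cC : abelian 'C_R[c].
  have : #|'C_R[c]| = 4.
    have := TI_cardMg BC; rewrite RE -/B b4 r16 => /eqP.
    by rewrite -[16]/(4 * 4)%N eqn_pmul2l // => /eqP.
  exact: (@card_p2group_abelian _ 2 _ isT).
rewrite -RE abelianM center_abelian cC /=.
by rewrite (subset_trans (subsetIl R 'C[c])) // centsC subsetIr.
Qed.

(* [chi x := x \notin E] is a homomorphism onto [Z/2]; comparing its values on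
   the three conjugates of [x] forces [E] to be stable under [c]. *)
Lemma index2_cube_norm R E c z :
  c \in 'N(R) -> c ^+ 3 = 1 -> E \subset R -> #|R| = (2 * #|E|)%N ->
  z \in R -> z \notin E -> commute c z ->
  (forall x, x \in E -> x \in E :^ c -> commute c x) -> c \in 'N(E).
Proof.
move=> cN c3 ER cardR zR zE cz fixE.
have oneE u v : u \in R -> v \in R -> (u * v \in E) = ((u \in E) == (v \in E)).
  move=> uR vR.
  case: (boolP (u \in E)) => uE; first by rewrite groupMl.
  case: (boolP (v \in E)) => vE; first by rewrite groupMr // (negbTE uE).
  have dis : E :&: v *: E = set0.
    apply/setP => x; rewrite !inE mem_lcoset; apply/negP => /andP [xE].
    by rewrite groupMr // groupV (negbTE vE).
  have RE : E :|: v *: E = R.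
    apply/eqP; rewrite eqEcard cardsU dis cards0 subn0 card_lcoset cardR mul2n -addnn leqnn andbT.
    rewrite subUset ER; apply/subsetP => x; rewrite mem_lcoset => xE.
    by rewrite -[x](mulKVg v) groupM // (subsetP ER).
  have : u^-1 \in E :|: v *: E by rewrite RE groupV.
  by rewrite inE groupV (negbTE uE) mem_lcoset -invMg groupV /= => ->.
have cJ x : x \in R -> x ^ c \in R by move=> xR; rewrite memJ_norm.
have zc : z ^ c = z by apply/conjg_fixP/commgP/commute_sym.
have c3J x : ((x ^ c) ^ c) ^ c = x.
  by rewrite -!conjgM -[c * _]/(c ^+ 3) c3 conjg1.
rewrite inE; apply/subsetP => _ /imsetP [y yE ->].
have yR := subsetP ER _ yE.
apply: contraT => ycE.
have fix' x : x \in E -> x ^ c \in E -> (x ^ c) ^ c = x ^ c.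
  move=> xE xcE; apply/conjg_fixP/commgP/commute_sym/fixE => //.
  by rewrite memJ_conjg.
case: (boolP ((y ^ c) ^ c \in E)) => yccE.
  have := fix' _ yccE; rewrite c3J => /(_ yE) e.
  by rewrite e yE in ycE.
have zy1 : z * y ^ c \in E by rewrite oneE ?cJ // (negbTE zE) (negbTE ycE).
have zy2 : (z * y ^ c) ^ c \in E.
  by rewrite conjMg zc oneE ?cJ // (negbTE zE) (negbTE yccE).
have := fix' _ zy1 zy2; rewrite (conjMg z) zc conjMg zc c3J => /mulgI e.
by rewrite -e yE in yccE.
Qed.

Section Trivial.
Variables (R0 R1 E : {group gT}) (z0 z1 c d g : gT).
Hypotheses (E0 : E \subset R0) (E1 : E \subset R1).
Hypotheses (card0 : #|R0| = (2 * #|E|)%N) (card1 : #|R1| = (2 * #|E|)%N).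
Hypothesis capE : R0 :&: R1 = E.
Hypothesis cardE : #|E| \in [:: 1; 2; 4; 8]%N.
Hypotheses (z0R : z0 \in R0) (z0E : z0 \notin E) (z1R : z1 \in R1) (z1E : z1 \notin E).
Hypotheses (cN : c \in 'N(R0)) (c3 : c ^+ 3 = 1) (cz : commute c z0).
Hypotheses (dN : d \in 'N(R1)) (d3 : d ^+ 3 = 1) (dz : commute d z1).
Hypotheses (R01 : R0 \subset 'N(R1)) (Rg : R0 :^ g = R1).
Hypotheses (cE : c = (z1 * z1 ^ c) ^+ 2) (dE : d = (z0 * z0 ^ d) ^+ 2).
Hypothesis normal_trivial : forall N : {group gT}, N \subset E ->
  [/\ z0 \in 'N(N), z1 \in 'N(N), c \in 'N(N) & d \in 'N(N)] -> N :=: 1.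

(** If [E] is nontrivial it meets the centre of the 2-group generated by [R0] and [R1]. When [c]
    centralises ['Z(R0)] and [d] centralises ['Z(R1)], this intersection is normalised by all four
    elements, which is impossible. Otherwise one of the conjugate groups [R0], [R1] is abelian,
    hence both are, and then [E] itself is normalised by [c] and [d]. *)
Lemma amalgam_trivial : E :=: 1.
Proof.
apply/eqP; apply: contraT => E_nt.
have idx2 (R : {group gT}) : E \subset R -> #|R| = (2 * #|E|)%N -> E <| R.
  move=> ER cR; apply: index2_normal => //; apply/eqP.
  by rewrite -(eqn_pmul2l (cardG_gt0 E)) Lagrange // cR mulnC.
have nE0 := idx2 _ E0 card0; have nE1 := idx2 _ E1 card1.
have z0NE : z0 \in 'N(E) by apply: (subsetP (normal_norm nE0)).
have z1NE : z1 \in 'N(E) by apply: (subsetP (normal_norm nE1)).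
have E2 : 2.-group E.
  by rewrite /pgroup; move: cardE; rewrite !inE => /or4P [] /eqP ->.
pose P := (R0 <*> R1)%G.
have P2 : 2.-group P.
  rewrite /pgroup /= (norm_joinEl R01).
  have := mul_cardG R0 R1; rewrite capE card0 card1 => e.
  apply: (@pnat_dvd _ (2 * #|E| * (2 * #|E|))%N); first by rewrite e dvdn_mulr.
  have E2' : 2.-nat #|E| := E2.
  by rewrite !pnatM E2'.
have nEP : E <| P.
  rewrite /normal /= (subset_trans E0 (joing_subl _ _)) join_subG.
  by rewrite !normal_norm.
have W_nt : E :&: 'Z(P) != 1 by apply: meet_center_nil => //; apply: pgroup_nil P2.
have WZ (R : {group gT}) : E \subset R -> R \subset P -> E :&: 'Z(P) \subset 'Z(R).
  move=> ER RP; apply/subsetP => x /setIP [xE /centerP [_ xP]].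
  apply/centerP; split; first exact: (subsetP ER).
  by move=> y yR; apply: xP; apply: (subsetP RP).
have WZ0 := WZ _ E0 (joing_subl _ _); have WZ1 := WZ _ E1 (joing_subr _ _).
have sub_norm (A : {set gT}) x : A \subset 'C[x] -> x \in 'N(A).
  move=> AC; apply: (subsetP (cent_sub A)); apply/centP => y yA.
  by apply/commute_sym/cent1P; apply: (subsetP AC).
have Zx x : x \in P -> E :&: 'Z(P) \subset 'C[x].
  move=> xP; apply/subsetP => y /setIP [_ /centerP [_ yP]].
  by apply/cent1P; apply: yP.
have z0P : z0 \in P by apply: (subsetP (joing_subl R0 R1)).
have z1P : z1 \in P by apply: (subsetP (joing_subr R0 R1)).
have z0_1 : z0 != 1 by apply: contraNneq z0E => ->.
have z1_1 : z1 != 1 by apply: contraNneq z1E => ->.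
have abg : abelian R0 = abelian R1 by rewrite -Rg abelianJ.
have cR4 : (2 * #|E|)%N \in [:: 2; 4; 8; 16]%N.
  by move: cardE; rewrite !inE => /or4P [] /eqP ->.
have [ab0 ab1] : abelian R0 /\ abelian R1.
  case: (boolP ('Z(R0) \subset 'C[c])) => [c0|nc]; last first.
    have ab : abelian R0.
      by apply: (abelian_of_cube_action cN c3 z0R z0_1 cz _ nc); rewrite card0.
    by rewrite -abg.
  case: (boolP ('Z(R1) \subset 'C[d])) => [d1|nd]; last first.
    have ab : abelian R1.
      by apply: (abelian_of_cube_action dN d3 z1R z1_1 dz _ nd); rewrite card1.
    by rewrite abg.
  case/eqP: W_nt; apply: (@normal_trivial (E :&: 'Z(P))%G); first exact: subsetIl.
  split; apply: sub_norm; try exact: Zx.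
  - exact: subset_trans WZ0 c0.
  - exact: subset_trans WZ1 d1.
(* Since [R'] is abelian, [z] centralises [E] and [z ^ x] centralises [E :^ x]; as [x] is a word in
   these two elements, it centralises the intersection. *)
have side (R' : {group gT}) z x : E \subset R' -> abelian R' -> z \in R' ->
    x = (z * z ^ x) ^+ 2 -> forall y, y \in E -> y \in E :^ x -> commute x y.
  move=> ER ab zR xE y yE yEx; apply: commute_sym; rewrite xE.
  have yz w : w \in E -> commute w z.
    by move=> wE; apply: (centsP ab) => //; apply: (subsetP ER).
  apply: commuteX; apply: commuteM; first exact: yz.
  have /imsetP [w wE ->] := yEx.
  by rewrite /commute -!conjMg yz.
case/eqP: E_nt; apply: (normal_trivial (subxx E)); split=> //.
- apply: (index2_cube_norm cN c3 E0 card0 z0R z0E cz).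
  exact: (side _ _ _ E1 ab1 z1R cE).
- apply: (index2_cube_norm dN d3 E1 card1 z1R z1E dz).
  exact: (side _ _ _ E0 ab0 z0R dE).
Qed.

End Trivial.
End Amalgam.

Lemma graph_autP (G : sgraph) (x : {perm G}) :
  reflect (forall u v, edge (x u) (x v) = edge u v) (x \in graph_aut G).
Proof.
rewrite inE; apply: (iffP forallP) => h u; first by move=> v; exact/eqP/(forallP (h u)).
by apply/forallP => v; rewrite h.
Qed.

Lemma graph_aut_group_set (G : sgraph) : group_set (graph_aut G).
Proof.
apply/group_setP; split; first by apply/graph_autP => u v; rewrite !perm1.
by move=> x y /graph_autP hx /graph_autP hy; apply/graph_autP => u v; rewrite !permM hy hx.
Qed.
Canonical graph_aut_group G := Group (graph_aut_group_set G).

(** * Arc stabilisers and arc-transitivity in a connected cubic graph *)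

Section Arcs.
Variable G : sgraph.
Implicit Types (f g h : nat -> G) (x y z : {perm G}) (p q s t u v w b : G).
Local Notation X := (graph_aut G).

Hypothesis cubic : valent G 3.
Hypothesis connectedG : forall S : G -> Prop, (exists v, S v) ->
  (forall u w, S u -> edge u w -> S w) -> forall w, S w.

(** Only the values up to [k] count; functions on all of [nat] let one periodic sequence serve as an
    arc of every length. *)
Definition is_arc k f : Prop :=
  (forall i, (i < k)%N -> edge (f i) (f i.+1)) /\
  (forall i, (i.+2 <= k)%N -> f i <> f i.+2).

Definition arc_fix k f : {set {perm G}} :=
  [set x in X | [forall i : 'I_k.+1, x (f i) == f i]].

Lemma arc_fixP k f x :
  reflect (x \in X /\ forall i, (i <= k)%N -> x (f i) = f i) (x \in arc_fix k f).
Proof.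
rewrite [_ \in arc_fix _ _]in_set; apply: (iffP andP) => -[xX h]; split=> //.
  by move=> i ik; apply/eqP; exact: (forallP h (Ordinal (ik : (i < k.+1)%N))).
by apply/forallP => i; rewrite h // -ltnS.
Qed.

Lemma arc_fix_group_set k f : group_set (arc_fix k f).
Proof.
apply/group_setP; split; first by apply/arc_fixP; split=> [|i _]; rewrite ?group1 ?perm1.
move=> x y /arc_fixP [xX hx] /arc_fixP [yX hy]; apply/arc_fixP; split.
  exact: groupM.
by move=> i ik; rewrite permM hx ?hy.
Qed.
Canonical arc_fix_group k f := Group (arc_fix_group_set k f).

Definition arc_transitive k : Prop := forall f g, is_arc k f -> is_arc k g ->
  exists2 x, x \in X & forall i, (i <= k)%N -> x (f i) = g i.

Lemma neighbor3 v p q s t : edge v p -> edge v q -> edge v s -> edge v t ->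
  p <> q -> p <> s -> q <> s -> [\/ t = p, t = q | t = s].
Proof.
move=> vp vq vs vt /eqP pq /eqP ps /eqP qs.
have sub : [set p; q; s] \subset [set w | edge v w].
  by apply/subsetP => w; rewrite !inE => /orP [/orP []|] /eqP ->.
have c3 : #|[set p; q; s]| = 3.
  by rewrite setUC cardsU1 cards2 pq !inE negb_or ![s == _]eq_sym ps qs.
have e : [set p; q; s] = [set w | edge v w].
  by apply/eqP; rewrite eqEcard sub cubic c3.
have : t \in [set w | edge v w] by rewrite inE.
by rewrite -e !inE => /orP [/orP []|] /eqP; [constructor 1|constructor 2|constructor 3].
Qed.

Lemma neighbor_other v u : edge v u -> exists w w',
  [/\ edge v w, edge v w' & [/\ w <> u, w' <> u & w <> w']].
Proof.
move=> vu.
have c2 : #|[set w | edge v w] :\ u| = 2.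
  by have := cardsD1 u [set w | edge v w]; rewrite cubic inE vu => -[].
have /cards2P [w [w' [ww' e]]] : #|[set w | edge v w] :\ u| == 2 by rewrite c2.
have : w \in [set w; w'] by rewrite !inE eqxx.
have : w' \in [set w; w'] by rewrite !inE eqxx orbT.
rewrite -e !inE => /andP [/eqP w'u vw'] /andP [/eqP wu vw].
by exists w, w'; split=> //; split=> //; apply/eqP.
Qed.

Definition arc_extend k f v : nat -> G := fun i => if (i <= k)%N then f i else v.

Lemma arc_shift k f v : is_arc k f -> edge (f k) v -> f k.-1 <> v ->
  (0 < k)%N -> is_arc k (fun i => arc_extend k f v i.+1).
Proof.
move=> [ef nf] ev nv k0; rewrite /arc_extend; split=> i ik.
  rewrite ik; case: ltnP => [lt|ge]; first exact: ef.
  by have -> : i.+1 = k by apply/eqP; rewrite eqn_leq ik.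
rewrite (ltnW ik); case: ltnP => [lt|ge]; first exact: nf.
by have <- : k.-1 = i.+1 by apply/eqP; rewrite -eqSS prednK // eqn_leq ge ik.
Qed.

Lemma arc_rev k f : is_arc k f -> is_arc k (fun i => f (k - i)%N).
Proof.
move=> [ef nf]; split=> i ik.
  have -> : (k - i = (k - i.+1).+1)%N by lia.
  by rewrite edge_sym; apply: ef; lia.
have -> : (k - i = (k - i.+2).+2)%N by lia.
by move=> e; apply: (nf (k - i.+2)%N); [lia | rewrite e].
Qed.

Lemma arc_sub k l f : (l <= k)%N -> is_arc k f -> is_arc l f.
Proof.
move=> lk [ef nf]; split=> i il; [apply: ef|apply: nf]; exact: leq_trans il lk.
Qed.

Lemma arc_fixS k l f : (l <= k)%N -> arc_fix k f \subset arc_fix l f.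
Proof.
move=> lk; apply/subsetP => x /arc_fixP [xX hx]; apply/arc_fixP; split=> // i il.
exact: hx (leq_trans il lk).
Qed.

(** Suppose an element fixes some [k]-arc but moves a continuation of it. Then the two continuations
    are exchanged, and every [k.+1]-arc can be carried to either of them. Otherwise an element
    fixing one [k]-arc fixes every [k]-arc obtained by sliding it along edges, hence all vertices by
    connectedness. *)
Lemma arc_transitive_step k f : (0 < k)%N -> arc_transitive k -> is_arc k f ->
  arc_fix k f != 1 -> arc_transitive k.+1.
Proof.
move=> k0 trk arcf fixf.
have [[f' [x [b [arcf' xfix ebk xb]]]]|none] := pselect (exists f' x b,
    [/\ is_arc k f', x \in arc_fix k f', edge (f' k) b & x b <> b]).
  have /arc_fixP [xX xf] := xfix.
  have pk : (k.-1 < k)%N by rewrite prednK.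
  have to_f' g : is_arc k.+1 g -> exists y, [/\ y \in X,
      forall i, (i <= k)%N -> y (g i) = f' i & y (g k.+1) = b \/ y (g k.+1) = x b].
    move=> [eg ng]; have arcg : is_arc k g by apply: (arc_sub (leqnSn k)).
    have [y yX yg] := trk _ _ arcg arcf'.
    have /graph_autP ye := yX; have /graph_autP xe := xX.
    exists y; split=> //.
    have ek1 : edge (f' k) (f' k.-1).
      by rewrite edge_sym -{2}(prednK k0); apply: (proj1 arcf').
    have fb : f' k.-1 <> b by move=> e; apply: xb; rewrite -e xf // ltnW.
    have [|||e|e|e] := @neighbor3 (f' k) (f' k.-1) b (x b) (y (g k.+1)) ek1 ebk _ _ fb _ (nesym xb);
      try by [left|right].
    - by rewrite -(xf _ (leqnn k)) xe.
    - by rewrite -(yg _ (leqnn k)) ye eg.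
    - by rewrite -(xf _ (ltnW pk)) => /perm_inj.
    - move: e; rewrite -(yg _ (ltnW pk)) => /perm_inj e.
      by case: (ng k.-1); rewrite prednK.
  move=> g h arcg arch.
  have [y [yX yg yb]] := to_f' g arcg; have [z [zX zh zb]] := to_f' h arch.
  have [w [wX wf we]] : exists w : {perm G}, [/\ w \in X, forall i, (i <= k)%N -> w (f' i) = f' i
      & w (y (g k.+1)) = z (h k.+1)].
    case: yb zb => -> [] ->.
    - by exists 1; split=> [|i _|]; rewrite ?group1 ?perm1.
    - by exists x.
    - exists x^-1; split=> [|i ik|]; rewrite ?groupV ?permK //.
      by rewrite -{1}(xf i ik) permK.
    - by exists 1; split=> [|i _|]; rewrite ?group1 ?perm1.
  exists (y * w * z^-1); first by rewrite !groupM ?groupV.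
  move=> i; rewrite !permM leq_eqVlt => /orP [/eqP ->|ik]; first by rewrite we permK.
  by rewrite yg // wf // -zh // permK.
case/eqP: fixf; apply/trivgP/subsetP => x xf; rewrite inE.
apply/eqP/permP => v; rewrite perm1.
have xX : x \in X by case/arc_fixP: xf.
pose S v := exists g, [/\ is_arc k g, x \in arc_fix k g & g k = v].
suff [g [_ /arc_fixP [_ xg] <-]] : S v by apply: xg.
have fixN g w : is_arc k g -> x \in arc_fix k g -> edge (g k) w -> x w = w.
  move=> arcg xg ew; apply/eqP; case: (eqVneq (x w) w) => // /eqP xw.
  by case: none; exists g, x, w.
have shift g w : is_arc k g -> x \in arc_fix k g -> edge (g k) w -> g k.-1 <> w ->
    x \in arc_fix k (fun i => arc_extend k g w i.+1).
  move=> arcg xg ew nw; apply/arc_fixP; split=> // i ik; rewrite /arc_extend.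
  by case: ltnP => lt; [case/arc_fixP: xg => _; apply | apply: fixN xg ew].
apply: connectedG; first by exists (f k), f.
move=> u w [g [arcg xg <-]] ew.
have [wk|wk] := pselect (g k.-1 = w); last first.
  exists (fun i => arc_extend k g w i.+1); split.
  - exact: arc_shift.
  - exact: shift.
  - by rewrite /arc_extend ltnn.
(* Stepping backwards: the arc is reversed, extended beyond its old starting point and reversed
   again, so that it ends at [g k.-1]. *)
have arcr := arc_rev arcg.
have xr : x \in arc_fix k (fun i => g (k - i)%N).
  case/arc_fixP: xg => _ xg; apply/arc_fixP; split=> // i ik.
  by apply: xg; apply: leq_subr.
have er : edge (g (k - k)) (g (k - k.-1)).
  rewrite subnn (_ : k - k.-1 = 1)%N; last by lia.
  exact: (proj1 arcg).
have [b [_ [eb _ [nb _ _]]]] := neighbor_other er.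
exists (fun i => (fun j => arc_extend k (fun i => g (k - i)%N) b j.+1) (k - i)%N); split.
- exact: (arc_rev (arc_shift arcr eb (nesym nb) k0)).
- have xs := shift _ _ arcr xr eb (nesym nb).
  case/arc_fixP: xs => _ xs; apply/arc_fixP; split=> // i ik.
  by apply: xs; apply: leq_subr.
- by rewrite subnn /arc_extend k0 -wk subn1.
Qed.

(** The stabiliser of the [k]-arc moves the next vertex within the two neighbours of [f k] other
    than [f k.-1], so the orbit formula gives index 1 or 2. *)
Lemma arc_fix_index k f : (0 < k)%N -> is_arc k.+1 f ->
  #|arc_fix k f| = #|arc_fix k.+1 f| \/ #|arc_fix k f| = (2 * #|arc_fix k.+1 f|)%N.
Proof.
move=> k0 [ef nf].
have orb : (#|orbit 'P (arc_fix k f) (f k.+1)| <= 2)%N.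
  have ek : edge (f k) (f k.-1) by rewrite edge_sym -{2}(prednK k0) ef // prednK.
  have c2 : #|[set w | edge (f k) w] :\ f k.-1| = 2.
    by have := cardsD1 (f k.-1) [set w | edge (f k) w]; rewrite cubic inE ek => -[].
  rewrite -c2; apply: subset_leq_card; apply/subsetP => _ /imsetP [x /arc_fixP [xX xf] ->].
  have /graph_autP xe := xX.
  rewrite !inE /= /aperm -(xf k) // xe ef // andbT -(xf k.-1) ?leq_pred //.
  by apply/eqP => /perm_inj e; case: (nf k.-1); rewrite prednK.
have stab : 'C_(arc_fix k f)[f k.+1 | 'P] = arc_fix k.+1 f.
  apply/setP => x; rewrite !inE; apply/andP/andP.
    case=> /andP [xX /forallP h]; rewrite sub1set inE /= /aperm => /eqP h'; split=> //.
    apply/forallP => i; case: (ltngtP i k.+1) => [lt|gt|->]; last exact/eqP.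
      exact: (h (Ordinal lt)).
    by have := ltn_ord i; rewrite ltnNge gt.
  case=> xX /forallP h; split.
    rewrite xX; apply/forallP => i; exact: (h (widen_ord (leqnSn _) i)).
  rewrite sub1set inE /= /aperm; exact: (h ord_max).
have := card_orbit_stab 'P (arc_fix_group k f) (f k.+1); rewrite /= stab => <-.
have : (0 < #|orbit 'P (arc_fix k f) (f k.+1)|)%N.
  by apply/card_gt0P; exists (f k.+1); apply: orbit_refl.
move: orb; case: #|orbit _ _ _| => [|[|[|//]]] // _ _; [left|right]; by rewrite ?mul1n.
Qed.

Fixpoint gball v n : {set G} :=
  if n is n'.+1 then gball v n' :|: \bigcup_(u in gball v n') [set w | edge u w]
  else [set v].

Lemma gball_edge v n u w : u \in gball v n -> edge u w -> w \in gball v n.+1.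
Proof. by move=> un e; rewrite /= inE; apply/orP; right; apply/bigcupP; exists u; rewrite ?inE. Qed.

Lemma gballS v n m : (n <= m)%N -> gball v n \subset gball v m.
Proof.
elim: m => [|m IH]; first by rewrite leqn0 => /eqP ->.
rewrite leq_eqVlt => /orP [/eqP ->|nm] //.
exact: subset_trans (IH nm) (subsetUl _ _).
Qed.

Lemma card_gball v n : (#|gball v n| <= 4 ^ n)%N.
Proof.
elim: n => [|n IH] /=; first by rewrite cards1.
have h (A : {set G}) : (#|\bigcup_(u in A) [set w | edge u w]| <= 3 * #|A|)%N.
  rewrite mulnC -sum_nat_const.
  elim/big_rec2: _ => [|i m B iA mB]; first by rewrite cards0.
  by apply: leq_trans (leq_card_setU _ _) _; apply: leq_add; rewrite // cubic.
apply: leq_trans (leq_card_setU _ _) _; rewrite expnS.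
have := h (gball v n); lia.
Qed.

Lemma geodesic v n w : w \in gball v n.+1 -> w \notin gball v n ->
  exists h : nat -> G, [/\ h 0%N = v, h n.+1 = w,
    forall i, (i <= n)%N -> edge (h i) (h i.+1) &
    forall i, (i <= n.+1)%N -> h i \in gball v i /\ ((0 < i)%N -> h i \notin gball v i.-1)].
Proof.
elim: n w => [|n IH] w wn1 wn.
  move: (wn1); rewrite /= inE (negbTE wn) /= => /bigcupP [u].
  rewrite inE => /eqP ->; rewrite inE => vw.
  exists (fun i => if i is 0 then v else w); split=> //; first by case.
  by case=> [|[|//]] _; split=> //; rewrite inE.
move: (wn1); rewrite /= inE (negbTE wn) /= => /bigcupP [u un1]; rewrite inE => uw.
have un : u \notin gball v n.
  by apply: contra wn => un; apply: gball_edge un uw.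
have [h [h0 hn he hb]] := IH u un1 un.
exists (fun i => if (i <= n.+1)%N then h i else w); split=> //.
- by rewrite ltnn.
- move=> i; case: (eqVneq i n.+1) => [-> _|ne ik] /=; first by rewrite leqnn ltnn hn.
  have i1 : (i < n.+1)%N by rewrite ltn_neqAle ne.
  by rewrite ik i1; apply: he.
- move=> i; case: (eqVneq i n.+2) => [-> _|ne ik] /=; first by rewrite ltnn.
  have i1 : (i < n.+2)%N by rewrite ltn_neqAle ne.
  by rewrite -ltnS i1; apply: hb.
Qed.

(* A 12-cycle and 7-arc-transitivity put every 7-arc on a 12-cycle, so that no
   two vertices are at distance 7. *)
Lemma arc7_card f : (forall k, is_arc k f) -> (forall i, f (i + 12)%N = f i) ->
  arc_transitive 7 -> (#|G| <= 4 ^ 6)%N.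
Proof.
move=> arcf per tr7; pose v := f 0%N.
have sub w : w \in gball v 7 -> w \in gball v 6.
  move=> w7; apply: contraT => w6.
  have [h [h0 h7 he hb]] := geodesic w7 w6.
  have arch : is_arc 7 h.
    split=> i ik; first exact: he.
    move=> e; have [hi _] := hb i (leq_trans (leqW (leqnSn _)) ik).
    have [_ /(_ isT)] := hb _ ik; rewrite -e => /negP; apply.
    exact: (subsetP (gballS _ (leqnSn i))).
  have [x /graph_autP xe xf] := tr7 _ _ (arcf 7) arch.
  have fb j : (j <= 5)%N -> x (f (12 - j)%N) \in gball v j.
    elim: j => [|j IH] j5; first by rewrite subn0 (per 0%N) xf // h0 inE.
    apply: gball_edge (IH (ltnW j5)) _; rewrite xe edge_sym.
    have -> : (12 - j = (12 - j.+1).+1)%N by lia.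
    by case: (arcf 12) => ef _; apply: ef; lia.
  have f7 : x (f 7) = w by rewrite (xf 7 isT) h7.
  have w5 : w \in gball v 5 by rewrite -f7; apply: (fb 5 isT).
  by case/negP: w6; move: (subsetP (gballS v (leqnSn 5)) _ w5).
have all6 w : w \in gball v 6.
  apply: (connectedG (S := fun w => w \in gball v 6)).
    by exists v; apply: (subsetP (gballS v (leq0n 6))); rewrite inE.
  by move=> u w' u6 e; apply: sub; apply: gball_edge u6 e.
apply: leq_trans (card_gball v 6); rewrite -cardsT; apply: subset_leq_card.
by apply/subsetP => w _; apply: all6.
Qed.

(** A nontrivial stabiliser of the 6-arc makes those of the 3-, 4- and 5-arcs nontrivial as well, so
    transitivity climbs from 3 to 7 and the graph is too small. Hence the 6-arc has trivial
    stabiliser, and the order at most doubles in each of the three steps down to the 3-arc. *)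
Lemma card_arc_fix3 f : (forall k, is_arc k f) -> (forall i, f (i + 12)%N = f i) ->
  (4 ^ 6 < #|G|)%N -> arc_transitive 3 -> #|arc_fix 3 f| \in [:: 1; 2; 4; 8]%N.
Proof.
move=> arcf per big tr3.
have fix6 : #|arc_fix 6 f| = 1%N.
  apply/eqP; rewrite -trivg_card1; apply: contraLR big => nt; rewrite -leqNgt.
  have ntk k : (k <= 6)%N -> arc_fix k f != 1.
    by move=> k6; apply: contra nt => /eqP e; rewrite -subG1 -e arc_fixS.
  apply: (arc7_card arcf per).
  by do 4!(apply: (arc_transitive_step _ _ (arcf _) (ntk _ _)) => //).
have [] := arc_fix_index (isT : 0 < 3)%N (arcf 4);
have [] := arc_fix_index (isT : 0 < 4)%N (arcf 5);
have [] := arc_fix_index (isT : 0 < 5)%N (arcf 6); rewrite fix6 => -> -> ->; by [].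
Qed.

End Arcs.

(** * Semisymmetry from a group action with two types of vertices *)

Section Semisymmetric.
Variables (G : sgraph) (gT : finGroupType) (a : gT -> {perm G}).
Variables (r0 r1 r2 r3 : gT) (v0 v1 : G).
Local Notation X := (graph_aut G).

Hypothesis aM : forall x y, a (x * y) = a x * a y.
Hypothesis aE : forall x, a x \in X.
Hypothesis gens : <<[set r0; r1; r2; r3]>> = [set: gT].
Hypotheses (i0 : r0 * r0 = 1) (i1 : r1 * r1 = 1) (i2 : r2 * r2 = 1) (i3 : r3 * r3 = 1).
Hypotheses (c02 : commute r0 r2) (c03 : commute r0 r3) (c13 : commute r1 r3).
Hypotheses (o01 : (r0 * r1) ^+ 3 = 1) (o12 : (r1 * r2) ^+ 6 = 1) (o23 : (r2 * r3) ^+ 3 = 1).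
Hypothesis orb : forall v, exists x, v = a x v0 \/ v = a x v1.
Hypothesis types : forall x, a x v0 <> v1.
Hypotheses (r0v0 : a r0 v0 = v0) (r2v0 : a r2 v0 = v0) (r3v0 : a r3 v0 = v0).
Hypotheses (r0v1 : a r0 v1 = v1) (r1v1 : a r1 v1 = v1) (r3v1 : a r3 v1 = v1).
Hypothesis nbr0 : [set w | edge v0 w] = [set v1; a r2 v1; a (r2 * r3) v1].
Hypothesis nbr1 : [set w | edge v1 w] = [set v0; a r1 v0; a (r1 * r0) v0].
Hypotheses (n0 : #|[set v1; a r2 v1; a (r2 * r3) v1]| = 3) (n1 : #|[set v0; a r1 v0; a (r1 * r0) v0]| = 3).
Hypothesis big : (4 ^ 6 < #|G|)%N.
Hypothesis no_duality : forall g : {perm G},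
  ~ [/\ a r0 ^ g = a r3, a r1 ^ g = a r2, a r2 ^ g = a r1 & a r3 ^ g = a r0].

Let a1 : a 1 = 1.
Proof. by apply: (mulgI (a 1)); rewrite -aM !mulg1. Qed.
Let aV x : a x^-1 = (a x)^-1.
Proof. by apply: (mulgI (a x)); rewrite -aM !mulgV a1. Qed.
Let aP x y v : a (x * y) v = a y (a x v).
Proof. by rewrite aM permM. Qed.
Let aK x v : a x^-1 (a x v) = v.
Proof. by rewrite aV permK. Qed.
Let aKV x v : a x (a x^-1 v) = v.
Proof. by rewrite aV permKV. Qed.
Let ae x u v : edge (a x u) (a x v) = edge u v.
Proof. exact: graph_autP (aE x) u v. Qed.

Let T0 v := exists x, v = a x v0.
Let T1 v := exists x, v = a x v1.

Let T01 v : T0 v -> T1 v -> False.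
Proof.
move=> [x ->] [y e]; apply: (@types (x * y^-1)).
by rewrite aP e aK.
Qed.

Let e01 : edge v0 v1.
Proof.
have : v1 \in [set w | edge v0 w] by rewrite nbr0 !inE eqxx.
by rewrite inE.
Qed.

Let nbr0P w : edge v0 w -> exists2 x, a x v0 = v0 & w = a x v1.
Proof.
move=> e; have : w \in [set w | edge v0 w] by rewrite inE.
rewrite nbr0 !inE -orbA => /or3P [] /eqP ->.
- by exists 1; rewrite a1 perm1.
- by exists r2.
- by exists (r2 * r3); rewrite // aP r2v0.
Qed.

Let nbr1P w : edge v1 w -> exists2 x, a x v1 = v1 & w = a x v0.
Proof.
move=> e; have : w \in [set w | edge v1 w] by rewrite inE.
rewrite nbr1 !inE -orbA => /or3P [] /eqP ->.
- by exists 1; rewrite a1 perm1.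
- by exists r1.
- by exists (r1 * r0); rewrite // aP r1v1.
Qed.

Lemma action_edge u w : edge u w -> T0 u -> exists x, u = a x v0 /\ w = a x v1.
Proof.
move=> e [x ux]; have : edge v0 (a x^-1 w) by rewrite -(ae x) aKV -ux.
case/nbr0P => y yv0 yw; exists (y * x); rewrite !aP yv0 -yw aKV; split=> //.
Qed.

Let T0_edge u w : edge u w -> T0 u -> T1 w.
Proof. by move=> e Tu; have [x [_ ->]] := action_edge e Tu; exists x. Qed.

Let T1_edge u w : edge u w -> T1 u -> T0 w.
Proof.
move=> e [x ux]; have : edge v1 (a x^-1 w) by rewrite -(ae x) aKV -ux.
by case/nbr1P => y yv1 yw; exists (y * x); rewrite aP -yw aKV.
Qed.

Let T_dec v : T0 v \/ T1 v.
Proof. by have [x [->|->]] := orb v; [left|right]; exists x. Qed.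

Lemma action_valent : valent G 3.
Proof.
have [N0 N1] : #|[set w | edge v0 w]| = 3 /\ #|[set w | edge v1 w]| = 3.
  by rewrite nbr0 nbr1.
have img x v : #|[set w | edge (a x v) w]| = #|[set w | edge v w]|.
  rewrite -[RHS](card_imset _ (@perm_inj _ (a x))); apply: eq_card => w.
  rewrite inE; apply/idP/imsetP => [e|[w']]; last by rewrite inE => e ->; rewrite ae.
  by exists (a x^-1 w); rewrite ?aKV // inE -(ae x) aKV.
by move=> v; have [x [->|->]] := orb v; rewrite img.
Qed.

(** Each generator fixes [v0] or [v1], and these are adjacent: [r1] is the only one that may move
    [v0], and then [v1] serves as the bridge. *)
Lemma action_connected (S : G -> Prop) : (exists v, S v) ->
  (forall u w, S u -> edge u w -> S w) -> forall w, S w.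
Proof.
move=> [v Sv] cl.
have Se u w : edge u w -> S u <-> S w.
  by move=> e; split=> h; apply: cl h _; rewrite // edge_sym.
have pair x : S (a x v0) <-> S (a x v1) by apply: Se; rewrite ae.
have step x y : S (a y v0) -> S (a (x * y) v0).
  have : x \in <<[set r0; r1; r2; r3]>> by rewrite gens inE.
  elim/gen_ind: x / => [|r x rA IH] Sy; first by rewrite mul1g.
  have := IH Sy; rewrite -mulgA; move: (x * y) => z Sz.
  move: rA; rewrite !inE -!orbA => /or4P [] /eqP ->; rewrite ?aP ?r0v0 ?r2v0 ?r3v0 //.
  by rewrite -aP; apply/pair; rewrite aP r1v1; apply/pair.
have [y Sy] : exists y, S (a y v0).
  by have [y [e|e]] := orb v; exists y; [rewrite -e|apply/pair; rewrite -e].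
move=> w; have [x [->|->]] := orb w; last apply/pair;
  by rewrite -(mulgKV y x); apply: step.
Qed.

Lemma action_edge_transitive : [transitive X, on edges G | ('P^*)%act].
Proof.
have edgeE E : E \in edges G -> exists x, E = [set a x v0; a x v1].
  case/imsetP => -[u w]; rewrite inE /= => e ->.
  have [Tu|Tu] := T_dec u.
    by have [x [-> ->]] := action_edge e Tu; exists x.
  have Tw := T1_edge e Tu; rewrite edge_sym in e.
  by have [x [-> ->]] := action_edge e Tw; exists x; rewrite setUC.
apply/imsetP; exists [set v0; v1].
  by apply/imsetP; exists (v0, v1); rewrite ?inE.
apply/setP => E; apply/idP/imsetP => [/edgeE [x ->]|[x xX ->]].
  by exists (a x) => //; rewrite /= /setact imsetU1 imset_set1.
apply/imsetP; exists (x v0, x v1); last by rewrite /= /setact imsetU1 imset_set1.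
by rewrite inE /= (graph_autP _ xX).
Qed.

Section VertexTransitive.
Hypothesis vertex_transitive : forall u w, exists2 x, x \in X & x u = w.

Let cubic := action_valent.
Let connectedG := action_connected.

Let c := r2 * r1.
Let c6 : c ^+ 6 = 1.
Proof.
have -> : c = (r1 * r2)^-1.
  apply/esym/eqP; rewrite eq_invg_mul /c -mulgA (mulgA r2) i2 mul1g; exact/eqP.
by rewrite expgVn o12 invg1.
Qed.

(** The section between a vertex and a facet is a hexagon, because [r1 * r2] has order dividing 6;
    its edges and 2-faces alternate along this closed walk of length 12. The exponent 5, that is -1
    modulo 6, makes the walk start with [a r2 v1], [v0], [v1], [a r1 v0]. *)
Definition hexagon (i : nat) : G :=
  a (c ^+ (i./2 + (if odd i then 0 else 5))) (if odd i then v0 else v1).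
Local Notation f := hexagon.

Let f_odd k : f k.*2.+1 = a (c ^+ k) v0.
Proof. by rewrite /f /= odd_double uphalf_double addn0. Qed.
Let f_even k : f k.*2 = a (c ^+ k) (a r2 v1).
Proof.
have c5 : c ^+ 5 = r1 * r2.
  have -> : c ^+ 5 = c^-1 by apply/esym/eqP; rewrite eq_invg_mul -expgS c6.
  apply/eqP; rewrite eq_invg_mul /c -mulgA (mulgA r1) i1 mul1g; exact/eqP.
by rewrite /f odd_double doubleK addnC expgD c5 !aP r1v1.
Qed.
Let f_evenS k : f k.+1.*2 = a (c ^+ k) v1.
Proof. by rewrite f_even expgS aP -aP /c aP aP -(aP r2 r2) i2 a1 perm1 r1v1. Qed.
Let f_oddS k : f k.+1.*2.+1 = a (c ^+ k) (a r1 v0).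
Proof. by rewrite f_odd expgS aP /c aP r2v0. Qed.

Let r2v1 : a r2 v1 <> v1.
Proof. by move=> e; move: n0; rewrite aP e r3v1 setUid setUid cards1. Qed.
Let r1v0 : a r1 v0 <> v0.
Proof. by move=> e; move: n1; rewrite aP e r0v0 setUid setUid cards1. Qed.
Let e_r2 : edge v0 (a r2 v1).
Proof. by rewrite -{1}r2v0 ae. Qed.
Let e_r1 : edge v1 (a r1 v0).
Proof. by rewrite -{1}r1v1 ae edge_sym. Qed.

Let f_arc k : is_arc k f.
Proof.
split=> i _; rewrite -(odd_double_half i); case: (odd i);
  rewrite ?add0n ?add1n; move: (i./2) => m.
- by rewrite -doubleS f_odd f_evenS ae.
- by rewrite f_even f_odd ae edge_sym.
- by rewrite -doubleS f_odd f_oddS => /perm_inj /esym.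
- by rewrite -doubleS f_even f_evenS => /perm_inj.
Qed.

Let f_period i : f (i + 12) = f i.
Proof.
rewrite -(odd_double_half i); move: (i./2) => m.
have -> : (odd i + m.*2 + 12 = odd i + (m + 6).*2)%N by rewrite doubleD addnA.
by case: (odd i); rewrite ?add0n ?add1n ?f_odd ?f_even expgD c6 mulg1.
Qed.

(** After the middle edge is moved into place, the two ends are adjusted independently: [r3] can
    change the first vertex while fixing the neighbours of [v1] in play, and [r0] the last one while
    fixing all neighbours of [v0]. *)
Lemma action_arc g : is_arc 3 g -> T0 (g 1%N) ->
  exists x, forall i, (i <= 3)%N -> a x (f i) = g i.
Proof.
move=> [eg ng] T1g.
have [y [g1 g2]] := action_edge (eg 1%N isT) T1g.
have f0 : f 0 = a r2 v1 by rewrite (f_even 0) expg0 a1 perm1.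
have f1 : f 1%N = v0 by rewrite (f_odd 0) expg0 a1 perm1.
have f2 : f 2 = v1 by rewrite (f_evenS 0) expg0 a1 perm1.
have f3 : f 3 = a r1 v0 by rewrite (f_oddS 0) expg0 a1 perm1.
have [w0 g0w] : exists w, g 0 = a y w by exists (a y^-1 (g 0)); rewrite aKV.
have [w3 g3w] : exists w, g 3 = a y w by exists (a y^-1 (g 3)); rewrite aKV.
have ew0 : w0 \in [set w | edge v0 w].
  by rewrite inE -(ae y) -g1 -g0w edge_sym eg.
have ew3 : w3 \in [set w | edge v1 w].
  by rewrite inE -(ae y) -g2 -g3w eg.
have nw0 : w0 <> v1 by move=> e; apply: (ng 0 isT); rewrite g0w e g2.
have nw3 : w3 <> v0 by move=> e; apply: (ng 1%N isT); rewrite g3w e g1.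
have [p [pv0 pv1 pr1 pr2]] : exists p, [/\ a p v0 = v0, a p v1 = v1,
    a p (a r1 v0) = a r1 v0 & a p (a r2 v1) = w0].
  move: ew0; rewrite nbr0 !inE -orbA => /or3P [] /eqP e //.
    by exists 1; rewrite a1 !perm1.
  by exists r3; rewrite -!aP c13 e aP r3v0.
have [q [qv0 qv1 qr1 qw]] : exists q, [/\ a q v0 = v0, a q v1 = v1,
    a q (a r1 v0) = w3 & forall w, w \in [set w | edge v0 w] -> a q w = w].
  move: ew3; rewrite nbr1 !inE -orbA => /or3P [] /eqP e //.
    by exists 1; split=> [| | |w _]; rewrite a1 perm1.
  exists r0; split=> [| | |w] //; first by rewrite -aP e.
  rewrite nbr0 !inE -orbA => /or3P [] /eqP -> //; rewrite -aP.
    by rewrite -c02 aP r0v1.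
  have -> : r2 * r3 * r0 = r0 * (r2 * r3) by rewrite -mulgA -c03 mulgA -c02 mulgA.
  by rewrite aP r0v1.
exists (p * q * y) => i; rewrite !aP.
case: i => [|[|[|[|//]]]] _.
- by rewrite f0 pr2 qw // g0w.
- by rewrite f1 pv0 qv0 g1.
- by rewrite f2 pv1 qv1 g2.
- by rewrite f3 pr1 qr1 g3w.
Qed.

(** Types alternate along edges of a connected graph, so an automorphism taking [v0] to [v1]
    exchanges the two types everywhere. This upgrades [action_arc] to transitivity on all 3-arcs. *)
Let swap_type : exists2 s, s \in X & forall u, (T0 u -> T1 (s u)) /\ (T1 u -> T0 (s u)).
Proof.
have [s sX sv] := vertex_transitive v0 v1.
exists s => //; apply: connectedG.
  exists v0; rewrite sv; split=> [_|]; first by exists 1; rewrite a1 perm1.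
  by move=> h; case: (@T01 v0) => //; exists 1; rewrite a1 perm1.
have se u w : edge u w -> edge (s u) (s w) by rewrite (graph_autP _ sX).
move=> u w [h0 h1] e; split=> Tw.
  have Tu : T1 u by apply: T0_edge Tw; rewrite edge_sym.
  exact: T0_edge (se _ _ e) (h1 Tu).
have Tu : T0 u by apply: T1_edge Tw; rewrite edge_sym.
exact: T1_edge (se _ _ e) (h0 Tu).
Qed.

Let tr3 : arc_transitive G 3.
Proof.
have to_f g : is_arc 3 g -> exists2 x, x \in X & forall i, (i <= 3)%N -> x (f i) = g i.
  move=> arcg; have [T|T] := T_dec (g 1%N).
    by have [x hx] := action_arc arcg T; exists (a x).
  have [s sX sT] := swap_type; have /graph_autP se := sX.
  have arcs : is_arc 3 (fun i => s (g i)).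
    case: arcg => eg ng; split=> i ik; first by rewrite se eg.
    by move=> /perm_inj; apply: ng.
  have [x hx] := action_arc arcs (proj2 (sT _) T).
  exists (a x * s^-1); first by rewrite groupM ?groupV.
  by move=> i ik; rewrite permM hx // permK.
move=> g h /to_f [x xX xg] /to_f [y yX yh].
exists (x^-1 * y); first by rewrite groupM ?groupV.
by move=> i ik; rewrite permM -xg // permK yh.
Qed.

Let f0 : f 0 = a r2 v1. Proof. by rewrite (f_even 0) expg0 a1 perm1. Qed.
Let f1 : f 1%N = v0. Proof. by rewrite (f_odd 0) expg0 a1 perm1. Qed.
Let f2 : f 2 = v1. Proof. by rewrite (f_evenS 0) expg0 a1 perm1. Qed.
Let f3 : f 3 = a r1 v0. Proof. by rewrite (f_oddS 0) expg0 a1 perm1. Qed.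

(** In a cubic graph, fixing a 2-arc fixes all neighbours of its middle vertex. So [R0] and [R1] are
    the kernels of the actions of the stabilisers of [v0] and [v1] on the neighbours, and are
    normalised by these stabilisers. *)
Let R0 : {group {perm G}} := [group of arc_fix 2 f].
Let R1 : {group {perm G}} := [group of arc_fix 2 (fun i => f i.+1)].
Let E : {group {perm G}} := [group of arc_fix 3 f].

Let fix_nbrs v p q x : edge v p -> edge v q -> p <> q -> x \in X ->
  x v = v -> x p = p -> x q = q -> forall w, edge v w -> x w = w.
Proof.
move=> vp vq pq /graph_autP xe xv xp xq w vw.
have [->//|/eqP wp] := eqVneq w p; have [->//|/eqP wq] := eqVneq w q.
have vxw : edge v (x w) by rewrite -[v]xv xe.
have [e|e|//] := neighbor3 cubic vp vq vw vxw pq (nesym wp) (nesym wq).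
  by case: wp; apply: (@perm_inj _ x); rewrite e xp.
by case: wq; apply: (@perm_inj _ x); rewrite e xq.
Qed.

Let R0P x : reflect [/\ x \in X, x v0 = v0 & forall w, edge v0 w -> x w = w] (x \in R0).
Proof.
apply: (iffP (arc_fixP _ _ _)) => [[xX h]|[xX xv xw]].
  have h0 := h 0 isT; have h1 := h 1%N isT; have h2 := h 2 isT.
  rewrite f0 in h0; rewrite f1 in h1; rewrite f2 in h2; split=> //.
  exact: (fix_nbrs e01 e_r2 (nesym r2v1) xX h1 h2 h0).
split=> // -[|[|[|//]]] _; rewrite ?f0 ?f1 ?f2 //; exact: xw.
Qed.

Let R1P x : reflect [/\ x \in X, x v1 = v1 & forall w, edge v1 w -> x w = w] (x \in R1).
Proof.
have e10 : edge v1 v0 by rewrite edge_sym.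
apply: (iffP (arc_fixP _ _ _)) => [[xX h]|[xX xv xw]].
  have h0 := h 0 isT; have h1 := h 1%N isT; have h2 := h 2 isT.
  rewrite f1 in h0; rewrite f2 in h1; rewrite f3 in h2; split=> //.
  exact: (fix_nbrs e10 e_r1 (nesym r1v0) xX h1 h0 h2).
split=> // -[|[|[|//]]] _; rewrite ?f1 ?f2 ?f3 //; exact: xw.
Qed.

Let R0N y : y \in X -> y v0 = v0 -> y \in 'N(R0).
Proof.
move=> yX yv; rewrite inE; apply/subsetP => _ /imsetP [x /R0P [xX xv xw] ->].
have yv' : y^-1 v0 = v0 by rewrite -{1}yv permK.
apply/R0P; split; first by rewrite groupJ.
  by rewrite conjgE !permM yv' xv yv.
move=> w e; rewrite conjgE !permM xw ?permKV //.
by rewrite -(graph_autP _ yX) yv permKV.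
Qed.

Let R1N y : y \in X -> y v1 = v1 -> y \in 'N(R1).
Proof.
move=> yX yv; rewrite inE; apply/subsetP => _ /imsetP [x /R1P [xX xv xw] ->].
have yv' : y^-1 v1 = v1 by rewrite -{1}yv permK.
apply/R1P; split; first by rewrite groupJ.
  by rewrite conjgE !permM yv' xv yv.
move=> w e; rewrite conjgE !permM xw ?permKV //.
by rewrite -(graph_autP _ yX) yv permKV.
Qed.

Let ER0 : E \subset R0. Proof. exact: arc_fixS. Qed.
Let ER1 : E \subset R1.
Proof.
apply/subsetP => x /arc_fixP [xX h]; apply/arc_fixP; split=> // i i2'.
exact: (h i.+1).
Qed.
Let RE : R0 :&: R1 = E.
Proof.
apply/eqP; rewrite eqEsubset; apply/andP; split; last by rewrite subsetI ER0 ER1.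
apply/subsetP => x /setIP [/arc_fixP [xX h] /arc_fixP [_ h']]; apply/arc_fixP; split=> //.
by case=> [|i] lei; [apply: h | apply: (h' i)].
Qed.

Let z0R : a r0 \in R0.
Proof.
apply/arc_fixP; split=> // -[|[|[|//]]] _; rewrite ?f0 ?f1 ?f2 //.
by rewrite -aP -c02 aP r0v1.
Qed.
Let z1R : a r3 \in R1.
Proof.
apply/arc_fixP; split=> // -[|[|[|//]]] _; rewrite ?f1 ?f2 ?f3 //.
by rewrite -aP c13 aP r3v0.
Qed.
Let z0E : a r0 \notin E.
Proof.
apply/negP => /arc_fixP [_ /(_ 3 isT)]; rewrite f3 => e.
by move: n1; rewrite aP e -setUA setUid cards2; case: eqP.
Qed.
Let z1E : a r3 \notin E.
Proof.
apply/negP => /arc_fixP [_ /(_ 0 isT)]; rewrite f0 => e.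
by move: n0; rewrite aP e -setUA setUid cards2; case: eqP.
Qed.

Let card0 : #|R0| = (2 * #|E|)%N.
Proof.
have [e|//] := arc_fix_index cubic (isT : 0 < 2)%N (f_arc 3).
have RE' : E :=: R0 by apply/eqP; rewrite eqEcard ER0 /= e leqnn.
by case/negP: z0E; rewrite RE'.
Qed.

Let reversal : exists2 g, g \in X & forall i, (i <= 3)%N -> g (f i) = f (3 - i)%N.
Proof. exact: tr3 (f_arc 3) (arc_rev (f_arc 3)). Qed.

Let aX x n : a (x ^+ n) = a x ^+ n.
Proof. by elim: n => [|n IH]; rewrite ?expg0 // !expgS aM IH. Qed.

Let aJ x y : a (x ^ y) = a x ^ a y.
Proof. by rewrite !conjgE !aM aV. Qed.

Let aC x y : commute x y -> commute (a x) (a y).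
Proof. by move=> e; rewrite /commute -!aM e. Qed.

(** A rotation of order 3 recovered from one reflection and its conjugate by that rotation. It
    supplies the two word hypotheses of [amalgam_trivial], for [r2 * r3] in terms of [r3] and for
    [r1 * r0] in terms of [r0]. *)
Let dihedral3 (u v : gT) : u * u = 1 -> v * v = 1 -> (u * v) ^+ 3 = 1 ->
  u * v = (v * v ^ (u * v)) ^+ 2.
Proof.
move=> uu vv uv3.
have e : v * v ^ (u * v) = (u * v) ^+ 2.
  have uvV : (u * v)^-1 = v * u.
    by apply/eqP; rewrite eq_invg_mul -mulgA (mulgA v) vv mul1g; apply/eqP.
  by rewrite conjgE uvV !mulgA vv mul1g expgS expg1 !mulgA.
by rewrite e -expgM -[(2 * 2)%N]/(3 + 1)%N expgD uv3 mul1g expg1.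
Qed.

Let o10 : (r1 * r0) ^+ 3 = 1.
Proof. exact: invol_expgC i0 i1 o01. Qed.

Let E_trivial : E :=: 1.
Proof.
have [g gX gf] := reversal.
have g1 : g v0 = v1 by have := gf 1%N isT; rewrite f1 (_ : 3 - 1 = 2)%N // f2.
have Rg : R0 :^ g = R1.
  apply/setP => x; rewrite mem_conjg; apply/R0P/R1P => -[xX xv xw].
    rewrite groupJr ?groupV // in xX; split=> //.
      by move: xv; rewrite conjgE invgK !permM g1 => /(canRL (permKV g)) ->.
    move=> w e; have ew : edge v0 (g^-1 w).
      by rewrite -(graph_autP _ gX) g1 permKV.
    have := xw _ ew; rewrite conjgE invgK !permM permKV => e'.
    by rewrite -[RHS](permKV g) -e' permKV.
  split; first by rewrite groupJ ?groupV.
    by rewrite conjgE invgK !permM g1 xv -g1 permK.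
  move=> w e; rewrite conjgE invgK !permM xw ?permK //.
  by rewrite -g1 (graph_autP _ gX).
have card1 : #|R1| = (2 * #|E|)%N by rewrite -Rg cardJg card0.
apply: (@amalgam_trivial _ R0 R1 E (a r0) (a r3) (a (r2 * r3)) (a (r1 * r0)) g) => //.
- exact: (card_arc_fix3 cubic connectedG f_arc f_period big tr3).
- by apply: R0N; rewrite // aP r2v0.
- by rewrite -aX o23 a1.
- by apply: aC; apply: commute_sym; apply: commuteM.
- by apply: R1N; rewrite // aP r1v1.
- by rewrite -aX o10 a1.
- by apply: aC; apply: commute_sym; apply: commuteM; apply: commute_sym.
- apply/subsetP => x /R0P [xX xv xw]; apply: R1N => //; exact: xw.
- by rewrite -aJ -aM -aX -dihedral3.
- by rewrite -aJ -aM -aX -dihedral3.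
(* A subgroup of [E] normalised by all four generators fixes [v0], [v1] and all their images, hence
   every vertex. *)
move=> N NE [z0N z1N cN dN].
have r2N : a r2 \in 'N(N).
  by rewrite -(mulgK r3 r2) aM groupM // aV groupV.
have r1N : a r1 \in 'N(N).
  by rewrite -(mulgK r0 r1) aM groupM // aV groupV.
have allN x : a x \in 'N(N).
  have : x \in <<[set r0; r1; r2; r3]>> by rewrite gens inE.
  elim/gen_ind: x / => [|r x rA IH]; first by rewrite a1 group1.
  rewrite aM groupM //.
  by move: rA; rewrite !in_setU !in_set1 -!orbA => /or4P [] /eqP ->.
apply/trivgP/subsetP => n nN; rewrite inE; apply/eqP/permP => v; rewrite perm1.
have [x hx] := orb v.
have nxE : n ^ (a x^-1) \in E by rewrite (subsetP NE) // memJ_norm.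
have /arc_fixP [_ h] := nxE.
have h1 := h 1%N isT; have h2 := h 2 isT; rewrite f1 in h1; rewrite f2 in h2.
have nx u : (n ^ (a x^-1)) u = a x^-1 (n (a x u)) by rewrite conjgE aV invgK !permM.
rewrite nx in h1; rewrite nx in h2.
by case: hx => ->; rewrite -[LHS](aKV x) ?h1 ?h2.
Qed.

(** With [E] trivial, the automorphism [g] reversing the central 3-arc is an involution, and [R0],
    [R1] consist of 1 and [a r0], respectively 1 and [a r3]; so [g] exchanges these two. It remains
    to see that it takes [a r1] to [a r2], which holds up to a factor in [R0]. *)
Lemma vertex_transitive_duality : False.
Proof.
have [g gX gf] := reversal.
have g0 : g (a r2 v1) = a r1 v0 by have := gf 0 isT; rewrite f0 subn0 f3.
have g1 : g v0 = v1 by have := gf 1%N isT; rewrite f1 (_ : 3 - 1 = 2)%N // f2.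
have g2 : g v1 = v0 by have := gf 2 isT; rewrite f2 (_ : 3 - 2 = 1)%N // f1.
have g3 : g (a r1 v0) = a r2 v1 by have := gf 3 isT; rewrite f3 subnn f0.
have gg : g * g = 1.
  suff: g * g \in E by rewrite E_trivial => /set1gP.
  apply/arc_fixP; split; first exact: groupM.
  by case=> [|[|[|[|//]]]] _; rewrite ?f0 ?f1 ?f2 ?f3 permM ?g0 ?g1 ?g2 ?g3.
have gV : g^-1 = g := invg_invol gg.
have R0E x : x \in R0 -> x = 1 \/ x = a r0.
  move=> xR; have c2 : #|R0| = 2 by rewrite card0 E_trivial cards1.
  have z0_1 : 1 != a r0 by apply: contraNneq z0E => <-; rewrite group1.
  have e : [set 1; a r0] = R0 :> {set _}.
    apply/eqP; rewrite eqEcard c2 cards2 z0_1 andbT.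
    by apply/subsetP => y; rewrite in_set2 => /orP [] /eqP ->; [apply: group1|].
  by move: xR; rewrite -e in_set2 => /orP [] /eqP; [left|right].
have y0 : (a r3) ^ g = a r0.
  have : (a r3) ^ g \in R0.
    apply/R0P; rewrite conjgE gV; split; first by rewrite !groupM.
      by rewrite !permM g1 r3v1 g2.
    move=> w e; have /R1P [_ _ h] := z1R; rewrite !permM h; first by rewrite -permM gg perm1.
    by rewrite -g1 (graph_autP _ gX).
  case/R0E => // e; case/negP: z1E.
  by move/eqP: e; rewrite -(conj1g g) => /eqP /conjg_inj ->; rewrite group1.
have y3 : (a r0) ^ g = a r3 by rewrite -y0 -conjgM gg conjg1.
pose y := a r1 ^ g.
have y2 : y = a r2.
  have yv w : y w = g (a r1 (g w)) by rewrite /y conjgE gV !permM.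
  have /R0E [e|e] : a r2 * y \in R0.
  - apply/arc_fixP; split; first by rewrite groupM // groupJ.
    case=> [|[|[|//]]] _; rewrite ?f0 ?f1 ?f2 permM.
    + by rewrite -aP i2 a1 perm1 yv g2 g3.
    + by rewrite r2v0 yv g1 r1v1 g2.
    + by rewrite yv g0 -aP i1 a1 perm1 g1.
  - apply: (mulgI (a r2)); rewrite e -aM i2 a1 //.
  (* If [a r1 ^ g] were [a (r2 * r0)], conjugating the braid relation of [r0] and [r1] would give
     [r3 * r2 * r3 * r0] the same action as [r3 * r2 * r3]. *)
  - case/negP: z0E; suff -> : a r0 = 1 by rewrite group1.
    have ye : y = a (r2 * r0).
      by apply: (mulgI (a r2)); rewrite e -aM mulgA i2 mul1g.
    have braid (u v : gT) : u * u = 1 -> v * v = 1 -> (u * v) ^+ 3 = 1 ->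
        u * v * u = v * u * v.
      move=> uu vv; rewrite !expgS expg0 mulg1 => uv3.
      apply: (mulIg (v * u * v)); rewrite -[RHS]mulgA.
      by rewrite -!mulgA (mulgA v v) vv mul1g (mulgA u u) uu mul1g vv -uv3 !mulgA.
    have := congr1 (fun x => a x ^ g) (braid _ _ i0 i1 o01).
    rewrite !aM !conjMg y3 -/y ye -!aM.
    have -> : r3 * (r2 * r0) * r3 = r3 * r2 * r3 * r0 by rewrite -!mulgA c03.
    have -> : r2 * r0 * r3 * (r2 * r0) = r3 * r2 * r3.
      have e0 : r0 * (r3 * (r2 * r0)) = r3 * r2.
        by rewrite -c02 (mulgA r3) -c03 !mulgA i0 mul1g.
      by rewrite -(braid _ _ i2 i3 o23) -!mulgA e0.
    by rewrite aM -{2}[a (_ * r3)]mulg1 => /mulgI.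
apply: (@no_duality g); split=> //.
by rewrite -y2 /y -conjgM gg conjg1.
Qed.

End VertexTransitive.

Lemma action_semisymmetric : semisymmetric G.
Proof.
split; [by exists 3; apply: action_valent|exact: action_edge_transitive|].
apply/negP => /imsetP [v _ e]; apply: vertex_transitive_duality => u w.
have : u \in orbit 'P X v by rewrite -e inE.
have : w \in orbit 'P X v by rewrite -e inE.
case/imsetP => y yX -> /imsetP [x xX ->].
exists (x^-1 * y); first by rewrite groupM ?groupV.
by rewrite /= /aperm permM permK.
Qed.

End Semisymmetric.

From mathcomp Require Import classical_sets functions.
Import GroupScope.

(** * Triangle groups and toroidal maps *)

Section IntPower.
Variable gT : finGroupType.
Implicit Types x y : gT.

Definition zexpg x (m : int) : gT := x ^+ `|(m %% #[x])%Z|.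

Lemma zexpg_nat x (k : nat) : zexpg x k = x ^+ k.
Proof. by rewrite /zexpg modz_nat absz_nat expg_mod_order. Qed.

Lemma zexpgD x (m n : int) : zexpg x (m + n)%R = zexpg x m * zexpg x n.
Proof.
rewrite /zexpg -expgD -[in RHS]expg_mod_order; congr (x ^+ _).
have e (k : int) : ((`|(k %% #[x])%Z|%N : int) = (k %% #[x])%Z)%R.
  by rewrite gez0_abs // modz_ge0 // -lt0n.
apply/eqP; rewrite -eqz_nat -modz_nat PoszD !e.
by rewrite modzDml modzDmr.
Qed.

Lemma zexpg0 x : zexpg x 0 = 1. Proof. exact: (zexpg_nat x 0). Qed.
Lemma zexpg1 x : zexpg x 1 = x. Proof. exact: (zexpg_nat x 1). Qed.

Lemma zexpgN x (m : int) : zexpg x (- m)%R = (zexpg x m)^-1.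
Proof. by apply/eqP; rewrite eq_sym eq_invg_mul -zexpgD GRing.addrN zexpg0. Qed.

Lemma zexpgJ x y m : zexpg x m ^ y = zexpg (x ^ y) m.
Proof. by rewrite /zexpg conjXg orderJ. Qed.

Lemma zexpg_commute x y m : commute x y -> commute (zexpg x m) y.
Proof. by move=> cxy; apply/commute_sym/commuteX/commute_sym. Qed.

Lemma zexpgV x m : zexpg x^-1 m = (zexpg x m)^-1.
Proof. by rewrite /zexpg orderV expgVn. Qed.

Lemma zexpgMn x y m : commute x y -> zexpg (x * y) m = zexpg x m * zexpg y m.
Proof.
move=> cxy; have E k : zexpg (x * y) (Posz k) = zexpg x k * zexpg y k.
  by rewrite !zexpg_nat expgMn.
have c k l : commute (zexpg x k) (zexpg y l).
  by apply: zexpg_commute; apply: commute_sym; apply: zexpg_commute; exact: commute_sym.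
case: m => k //; rewrite NegzE !zexpgN E invMg.
by rewrite -!invMg c.
Qed.

Lemma zexpgM x (m n : int) : zexpg x (m * n)%R = zexpg (zexpg x m) n.
Proof.
have E k : zexpg x (m * Posz k)%R = zexpg (zexpg x m) k.
  rewrite zexpg_nat; elim: k => [|k IH]; first by rewrite GRing.mulr0 zexpg0.
  by rewrite intS GRing.mulrDr GRing.mulr1 zexpgD IH expgS.
by case: n => k //; rewrite NegzE GRing.mulrN !zexpgN E.
Qed.
End IntPower.

Definition pswap (p : Defs.point) : Defs.point := (p.2, p.1).
Definition prot (p : Defs.point) : Defs.point := (p.1 + p.2, - p.1)%R.
(* [plin] is the linear action of the dihedral group of order 12 on the triangular
   lattice: [prot] is the rotation by 60 degrees, [pswap] exchanges e_1 and e_2. *)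
Definition plin (d : bool * 'Z_6) (p : Defs.point) : Defs.point :=
  iter d.2 prot (if d.1 then pswap p else p).
Definition pact (w : (bool * 'Z_6) * Defs.point) (p : Defs.point) : Defs.point := (plin w.1 p + w.2)%R.

Section TriangleGroup.
Variables (gT : finGroupType) (a0 a1 a2 : gT).

(** The Coxeter relations of the full symmetry group of the tessellation by triangles; [a0], [a1],
    [a2] move only the vertex, the edge and the triangle of the base flag. *)
Record triangle_relations : Prop := TriangleRelations {
  tri_invol0 : a0 * a0 = 1;
  tri_invol1 : a1 * a1 = 1;
  tri_invol2 : a2 * a2 = 1;
  tri_comm02 : commute a0 a2;
  tri_ord01 : (a0 * a1) ^+ 3 = 1;
  tri_ord12 : (a1 * a2) ^+ 6 = 1
}.

Hypothesis rel : triangle_relations.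

Local Notation c := (a1 * a2).
(** [c ^+ 3] is the half-turn at the base vertex, so [a2 * c ^+ 3] is the reflection through that
    vertex in the line perpendicular to the base edge. Composed with the parallel mirror of [a0] it
    gives the translation by [e_1]. *)
Definition tr1 : gT := a2 * c ^+ 3 * a0.
Definition tr2 : gT := tr1 ^ a1.
Definition tri_trans (v : Defs.point) : gT := zexpg tr1 v.1 * zexpg tr2 v.2.
Definition tri_dih (d : bool * 'Z_6) : gT := a1 ^+ d.1 * c ^+ d.2.
Definition tri_elt (w : (bool * 'Z_6) * Defs.point) : gT := tri_dih w.1 * tri_trans w.2.

Let i0 := tri_invol0 rel.
Let i1 := tri_invol1 rel.
Let i2 := tri_invol2 rel.
Let k0 g : a0 * (a0 * g) = g. Proof. by rewrite mulgA i0 mul1g. Qed.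
Let k1 g : a1 * (a1 * g) = g. Proof. by rewrite mulgA i1 mul1g. Qed.
Let k2 g : a2 * (a2 * g) = g. Proof. by rewrite mulgA i2 mul1g. Qed.
Let v0 : a0^-1 = a0. Proof. exact: invg_invol i0. Qed.
Let v1 : a1^-1 = a1. Proof. exact: invg_invol i1. Qed.
Let v2 : a2^-1 = a2. Proof. exact: invg_invol i2. Qed.

Let c_a1 : c ^ a1 = c^-1. Proof. by rewrite conjgE invMg v1 v2 !mulgA i1 mul1g. Qed.
Let c_a2 : c ^ a2 = c^-1.
Proof. by rewrite conjgE invMg v1 v2 -!mulgA i2 mulg1. Qed.
Let c3V : (c ^+ 3)^-1 = c ^+ 3.
Proof. by apply/eqP; rewrite eq_invg_mul -expgD (tri_ord12 rel). Qed.
Let c3_a1 : c ^+ 3 * a1 = a1 * c ^+ 3.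
Proof. by apply/commgP/conjg_fixP; rewrite conjXg c_a1 expgVn c3V. Qed.
Let c3_a2 : c ^+ 3 * a2 = a2 * c ^+ 3.
Proof. by apply/commgP/conjg_fixP; rewrite conjXg c_a2 expgVn c3V. Qed.

Lemma tr1_a2 : tr1 ^ a2 = tr1.
Proof.
rewrite conjgE v2 /tr1; move: (c ^+ 3) c3_a2 => z za.
by rewrite -!mulgA k2 (tri_comm02 rel) !mulgA za.
Qed.

Lemma tr2_c : tr2 ^ c = tr1.
Proof. by rewrite /tr2 -conjgM mulgA i1 mul1g tr1_a2. Qed.

Let tr1_c3 : tr1 ^ (c ^+ 3) = tr1^-1.
Proof.
have c33 : c ^+ 3 * c ^+ 3 = 1 by rewrite -{1}c3V mulVg.
rewrite /tr1; move: (c ^+ 3) c3_a2 c33 c3V => z za zz zV.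
rewrite conjgE !invMg v0 v2 zV !mulgA za -!mulgA za (mulgA a0) !mulgA.
rewrite (tri_comm02 rel) -!mulgA; congr (_ * _).
by rewrite mulgA zz mul1g.
Qed.

(* The sum of three unit vectors at mutual angles of 120 degrees vanishes. *)
Let tr1_sum : tr1 * tr1 ^ (c ^+ 2) * tr1 ^ (c ^+ 4) = 1.
Proof.
have c2V : (c ^+ 4)^-1 = c ^+ 2.
  by apply/eqP; rewrite eq_invg_mul -expgD (tri_ord12 rel).
have c4V : (c ^+ 2)^-1 = c ^+ 4.
  by apply/eqP; rewrite eq_invg_mul -expgD (tri_ord12 rel).
have -> : tr1 * tr1 ^ (c ^+ 2) * tr1 ^ (c ^+ 4) = (tr1 * c ^+ 4) ^+ 3.
  have c22 : c ^+ 2 * c ^+ 2 = c ^+ 4 by rewrite -expgD.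
  rewrite !conjgE c2V c4V; move: tr1 (c ^+ 2) (c ^+ 4) c22 => t x y xx.
  by rewrite !expgS expg0 mulg1 -!mulgA; do 3!congr (_ * _); rewrite mulgA xx.
have -> : tr1 * c ^+ 4 = (a1 * a0) ^ (c ^+ 4).
  have e : c ^+ 2 * a1 = a2 * c ^+ 3.
    by rewrite conjgC conjXg c_a1 expgVn c4V [in RHS]expgS mulgA; congr (_ * _); rewrite k1.
  by rewrite conjgE c2V /tr1 -e; move: (c ^+ 2) (c ^+ 4) => x y; rewrite !mulgA.
rewrite -conjXg.
have -> : a1 * a0 = (a0 * a1)^-1 by rewrite invMg v0 v1.
by rewrite expgVn (tri_ord01 rel) invg1 conj1g.
Qed.

Let tr2E : tr2 = tr1 ^ a1. Proof. by []. Qed.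
#[local] Opaque tr1 tr2.

Lemma tr1_c : tr1 ^ c = tr2^-1 * tr1.
Proof.
have e := congr1 (conjg^~ c) tr1_sum.
rewrite 2!conjMg -!conjgM conj1g -!expgSr tr1_c3 in e.
have t2 : tr1 ^ (c ^+ 5) = tr2 by rewrite -tr2_c -conjgM -expgS (tri_ord12 rel) conjg1.
rewrite t2 in e.
apply: (mulIg (tr1^-1)); apply: (mulIg tr2); rewrite e.
by rewrite mulgK mulVg.
Qed.

(** The half-turn inverts each of the three translations whose product is 1. The relation
    [x * y^-1 * z = 1] therefore holds together with [x^-1 * y * z^-1 = 1], and eliminating [z]
    leaves the commutation of [x] and [y]. *)
Lemma tr_commute : commute tr1 tr2.
Proof.
have tb : tr1 ^ (c ^+ 2) = tr2^-1.
  have e2 : tr2 ^ (c ^+ 3) = tr1 ^ (c ^+ 2) by rewrite expgS conjgM tr2_c.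
  by rewrite -e2 tr2E -conjgM -c3_a1 conjgM tr1_c3 conjVg.
have h k : (tr1 ^ (c ^+ k)) ^ (c ^+ 3) = (tr1 ^ (c ^+ k))^-1.
  by rewrite -conjgM -expgD addnC expgD conjgM tr1_c3 conjVg.
have e := tr1_sum; have := congr1 (conjg^~ (c ^+ 3)) tr1_sum.
rewrite 2!conjMg conj1g tr1_c3 !h tb => {h}; rewrite tb in e.
move: tr1 tr2 (tr1 ^ (c ^+ 4)) e => x y z e.
rewrite invgK => e'.
have ez : z = y * x^-1 by rewrite -[LHS](mulKg (x * y^-1)) e mulg1 invMg invgK.
move: e'; rewrite ez invMg invgK => e'.
by apply: (mulgI x^-1); apply: (mulIg y^-1); rewrite mulKg mulgV -e' !mulgA.
Qed.

Lemma tr_zcommute m n : commute (zexpg tr1 m) (zexpg tr2 n).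
Proof.
apply: zexpg_commute; apply: commute_sym; apply: zexpg_commute.
by apply: commute_sym; apply: tr_commute.
Qed.

Lemma tri_transD u v : tri_trans (u + v)%R = tri_trans u * tri_trans v.
Proof.
by rewrite /tri_trans !zexpgD -!mulgA; congr (_ * _); rewrite !mulgA tr_zcommute.
Qed.

Lemma tri_trans0 : tri_trans 0%R = 1.
Proof. by rewrite /tri_trans !zexpg0 mulg1. Qed.

Lemma tri_transN v : tri_trans (- v)%R = (tri_trans v)^-1.
Proof. by apply/eqP; rewrite eq_sym eq_invg_mul -tri_transD GRing.addrN tri_trans0. Qed.

Lemma tri_trans_swap v : tri_trans v ^ a1 = tri_trans (pswap v).
Proof.
have t2 : tr2 ^ a1 = tr1 by rewrite tr2E -conjgM i1 conjg1.
rewrite /tri_trans conjMg !zexpgJ t2 -tr2E.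
by rewrite tr_zcommute.
Qed.

Lemma tri_trans_rot v : tri_trans v ^ c = tri_trans (prot v).
Proof.
rewrite {1}/tri_trans conjMg !zexpgJ tr2_c tr1_c /= zexpgMn; last first.
  by apply: commute_sym; apply: commuteV; apply: tr_commute.
rewrite -mulgA -zexpgD /tri_trans /= zexpgV -zexpgN.
by rewrite tr_zcommute.
Qed.

Lemma tri_trans_lin d v : tri_trans v ^ tri_dih d = tri_trans (plin d v).
Proof.
rewrite /tri_dih conjgM /plin.
have -> : tri_trans v ^ (a1 ^+ d.1) = tri_trans (if d.1 then pswap v else v).
  by case: d.1; rewrite ?expg1 ?expg0 ?conjg1 ?tri_trans_swap.
elim: (nat_of_ord d.2) (if d.1 then pswap v else v) => [|k IH] u.
  by rewrite expg0 conjg1.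
by rewrite iterSr expgS conjgM tri_trans_rot IH.
Qed.

Lemma tri_elt_lin d : tri_elt (d, 0%R) = tri_dih d.
Proof. by rewrite /tri_elt /= tri_trans0 mulg1. Qed.

Lemma tri_elt_trans v : tri_elt (false, 0%R, v) = tri_trans v.
Proof. by rewrite /tri_elt /tri_dih /= !expg0 !mul1g. Qed.

End TriangleGroup.

Lemma pointP (p q : Defs.point) : p.1 = q.1 -> p.2 = q.2 -> p = q.
Proof. by case: p q => [a b] [c d] /= -> ->. Qed.

Lemma prot6 p : iter 6 prot p = p.
Proof. by apply: pointP; rewrite /=; lia. Qed.

Lemma iter_prot_mod n p : iter (n %% 6) prot p = iter n prot p.
Proof.
rewrite {2}(divn_eq n 6) addnC iterD; congr (iter _ _ _).
by elim: (n %/ 6) => [|m IH] //; rewrite mulSn iterD -IH prot6.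
Qed.

Lemma pswap_iter n p : pswap (iter n prot p) = iter (5 * n)%N prot (pswap p).
Proof.
elim: n => [|n IH] //; rewrite mulnS iterD -IH iterS.
by apply: pointP; rewrite /=; lia.
Qed.

Definition dmul (d d' : bool * 'Z_6) : bool * 'Z_6 :=
  (d.1 (+) d'.1, inZp ((if d'.1 then 5 * d.2 else d.2) + d'.2)%N).
Definition dinv (d : bool * 'Z_6) : bool * 'Z_6 :=
  (d.1, if d.1 then d.2 else inZp (5 * d.2)%N).

Lemma dmulV d : dmul d (dinv d) = (false, 0%R).
Proof. by case: d => [[] [[|[|[|[|[|[|//]]]]]] i]]; apply/eqP. Qed.

Lemma dmulVr d : dmul (dinv d) d = (false, 0%R).
Proof. by case: d => [[] [[|[|[|[|[|[|//]]]]]] i]]; apply/eqP. Qed.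

Lemma plin_mul d d' p : plin (dmul d d') p = plin d' (plin d p).
Proof.
case: d d' => [b k] [b' k']; rewrite /plin /dmul /= iter_prot_mod addnC iterD.
by case: p b b' => [x y] [] [] //=; rewrite pswap_iter.
Qed.

Lemma plinD d p q : plin d (p + q)%R = (plin d p + plin d q)%R.
Proof.
case: d => [b k]; rewrite /plin /=.
elim: (nat_of_ord k) => [|m IH] /=; first by case: b.
by rewrite IH; apply: pointP; rewrite /=; lia.
Qed.

Lemma plin0 d : plin d 0%R = 0%R.
Proof.
by case: d => [b k]; rewrite /plin; elim: (nat_of_ord k) => [|m IH] /=; [case: b|rewrite IH].
Qed.

(** Product in the semidirect product of the lattice by the dihedral group of order 12, for right
    actions. It serves as a common cover: [pact] represents it on lattice points and [tri_elt] maps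
    it onto the finite group. *)
Definition wmul (x y : (bool * 'Z_6) * Defs.point) : (bool * 'Z_6) * Defs.point :=
  (dmul x.1 y.1, plin y.1 x.2 + y.2)%R.
Definition winv (x : (bool * 'Z_6) * Defs.point) : (bool * 'Z_6) * Defs.point :=
  (dinv x.1, - plin (dinv x.1) x.2)%R.

Lemma pact_mul x y p : pact (wmul x y) p = pact y (pact x p).
Proof. by rewrite /pact /= plin_mul plinD GRing.addrA. Qed.

Lemma pactK x : cancel (pact x) (pact (winv x)).
Proof.
move=> p; rewrite /pact /= plinD -plin_mul dmulV.
by rewrite GRing.addrK.
Qed.

Lemma pactKV x : cancel (pact (winv x)) (pact x).
Proof.
move=> p; rewrite -pact_mul /wmul /= dmulVr /pact /plin /=.
have e : (plin x.1 (- plin (dinv x.1) x.2) + x.2 = 0)%R.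
  have := plinD x.1 (plin (dinv x.1) x.2) (- plin (dinv x.1) x.2)%R.
  rewrite GRing.subrr plin0 -(plin_mul (dinv _)) dmulVr.
  by rewrite GRing.addrC => ->.
by rewrite e GRing.addr0.
Qed.

Lemma pact_inj x : injective (pact x).
Proof. exact: can_inj (pactK x). Qed.

Section Torus.
Variables (gT : finGroupType) (a0 a1 a2 : gT).
Hypothesis rel : triangle_relations a0 a1 a2.
Local Notation c := (a1 * a2).
Local Notation E := (tri_elt a0 a1 a2).
Local Notation T := (tri_trans a0 a1 a2).
Local Notation D := (tri_dih a1 a2).

Lemma tri_dih_mul d d' : D (dmul d d') = D d * D d'.
Proof.
have c6 := tri_ord12 rel; have i1 := tri_invol1 rel; have i2 := tri_invol2 rel.
have v1 : a1^-1 = a1 := invg_invol i1.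
have v2 : a2^-1 = a2 := invg_invol i2.
have cV : c ^ a1 = c ^+ 5.
  have -> : c ^+ 5 = c^-1 by apply/esym/eqP; rewrite eq_invg_mul -expgS c6.
  by rewrite conjgE invMg v1 v2 !mulgA i1 mul1g.
case: d d' => [b k] [b' k']; rewrite /tri_dih /dmul /= expg_mod // expgD.
case: b' => /=; last by rewrite addbF expg0 mul1g -mulgA.
rewrite expg1 addbT -[RHS]mulgA (mulgA (c ^+ k)) (conjgC (c ^+ k)) conjXg cV -expgM.
rewrite !mulgA; congr (_ * _ * _).
by case: b => /=; rewrite ?expg0 ?expg1 ?mul1g ?i1.
Qed.

Lemma tri_elt_mul x y : E (wmul x y) = E x * E y.
Proof.
rewrite /tri_elt /= tri_dih_mul (tri_transD rel) -(tri_trans_lin rel).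
move: (D x.1) (D y.1) (T x.2) (T y.2) => p q r s.
by rewrite conjgE !mulgA mulgK.
Qed.

Lemma tri_elt1 : E (false, 0%R, 0%R) = 1.
Proof. by rewrite tri_elt_trans tri_trans0. Qed.

Lemma tri_elt_inv x : E (winv x) = (E x)^-1.
Proof.
apply/eqP; rewrite eq_sym eq_invg_mul -tri_elt_mul /wmul /= dmulV.
by rewrite GRing.subrr tri_elt1.
Qed.

(** The lifts of [a0], [a1], [a2] to the cover: the mirrors of the base flag with vertices [orig],
    [e1], [e2]. *)
Definition w0 : (bool * 'Z_6) * Defs.point := (true, inZp 4, (1, 0)%R).
Definition w1 : (bool * 'Z_6) * Defs.point := (true, inZp 0, 0%R).
Definition w2 : (bool * 'Z_6) * Defs.point := (true, inZp 1, 0%R).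

Lemma tri_elt_w1 : E w1 = a1.
Proof. by rewrite /w1 tri_elt_lin /tri_dih /= expg1 expg0 mulg1. Qed.
Lemma tri_elt_w2 : E w2 = a2.
Proof. by rewrite /w2 tri_elt_lin /tri_dih /= !expg1 mulgA (tri_invol1 rel) mul1g. Qed.
Lemma tri_elt_w0 : E w0 = a0.
Proof.
rewrite /tri_elt /tri_trans /= zexpg1 zexpg0 mulg1 /tri_dih /tr1 /=.
have i1 := tri_invol1 rel; have i2 := tri_invol2 rel; have c6 := tri_ord12 rel.
rewrite expg1.
have e : a1 * c ^+ 4 = a2 * c ^+ 3 by rewrite expgS !mulgA i1 mul1g.
have v2 : a2^-1 = a2 := invg_invol i2.
have v1 : a1^-1 = a1 := invg_invol i1.
have c_a2 : c ^ a2 = c^-1.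
  by rewrite conjgE invMg v1 v2 -!mulgA i2 mulg1.
have za : c ^+ 3 * a2 = a2 * c ^+ 3.
  apply/commgP/conjg_fixP; rewrite conjXg c_a2 expgVn.
  by apply/eqP; rewrite eq_invg_mul -expgD c6.
have zz : c ^+ 3 * c ^+ 3 = 1 by rewrite -expgD c6.
rewrite e; move: (c ^+ 3) za zz => z za zz.
by rewrite !mulgA -(mulgA a2) za mulgA i2 mul1g zz mul1g.
Qed.

Lemma pact_w0 p : pact w0 p = (1 - p.1 - p.2, p.2)%R.
Proof. by apply: pointP; rewrite /=; lia. Qed.
Lemma pact_w1 p : pact w1 p = (p.2, p.1).
Proof. by apply: pointP; rewrite /=; lia. Qed.
Lemma pact_w2 p : pact w2 p = (p.1 + p.2, - p.2)%R.
Proof. by apply: pointP; rewrite /=; lia. Qed.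

Definition tri_group := <<[set a0; a1; a2]>>.
Canonical tri_group_group := Eval hnf in [group of tri_group].

Lemma tri_elt_mem x : E x \in tri_group.
Proof.
have m0 : a0 \in tri_group by apply: mem_gen; rewrite !inE eqxx.
have m1 : a1 \in tri_group by apply: mem_gen; rewrite !inE eqxx orbT.
have m2 : a2 \in tri_group by apply: mem_gen; rewrite !inE eqxx !orbT.
have mt1 : tr1 a0 a1 a2 \in tri_group by apply: groupM => //; apply: groupM => //; apply: groupX; apply: groupM.
have mt2 : tr2 a0 a1 a2 \in tri_group by rewrite groupJ //.
apply: groupM; apply: groupM; apply: groupX => //.
by apply: groupM.
Qed.

Lemma tri_group_elt g : g \in tri_group -> exists x, E x = g.
Proof.
move=> gG; have /gen_prodgP [n [f fP ->]] := gG.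
elim: n f fP {gG} => [|n IH] f fP; first by exists (false, 0%R, 0%R); rewrite big_ord0 tri_elt1.
rewrite big_ord_recl.
have [|y <-] := IH (fun i => f (lift ord0 i)); first by [].
have [x <-] : exists x, E x = f ord0.
  have := fP ord0; rewrite !inE => /orP [/orP []|] /eqP ->; [exists w0|exists w1|exists w2].
  - exact: tri_elt_w0.
  - exact: tri_elt_w1.
  - exact: tri_elt_w2.
by exists (wmul x y); rewrite tri_elt_mul.
Qed.

End Torus.

(** * Isomorphism of a coset geometry with the toroidal map *)

Section TorusIsomorphism.
Local Open Scope classical_set_scope.

Definition e1 : Defs.point := (1, 0)%R.
Definition e2 : Defs.point := (0, 1)%R.
Definition orig : Defs.point := (0, 0)%R.

Definition base_face (k : nat) : set Defs.point :=
  match k with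
  | 0 => set0 | 1 => [set orig] | 2 => [set orig; e1] | 3 => [set orig; e1; e2] | _ => setT
  end.

Lemma sqlength_plin d u : sqlength (plin d u) = sqlength u.
Proof.
case: d => [b k]; rewrite /plin /=.
elim: (nat_of_ord k) => [|m IH] /=.
  by case: b => //=; rewrite /sqlength /=; ring.
by rewrite -IH /sqlength /=; ring.
Qed.

Lemma small_square (y : int) : (y ^+ 2 <= 1)%R -> [\/ y = 0%R, y = 1%R | y = (-1)%R].
Proof.
move=> h; have : (-1 <= y <= 1)%R by nia.
move=> h'; have : [|| y == 0, y == 1 | y == -1]%R by lia.
by case/or3P => /eqP ->; [constructor 1|constructor 2|constructor 3].
Qed.

Lemma sqlength1 u : sqlength u = 1%R -> exists d, plin d e1 = u.
Proof.
case: u => x y; rewrite /sqlength /= => h.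
have /small_square hy : (y ^+ 2 <= 1)%R by nia.
have /small_square hx : (x ^+ 2 <= 1)%R by nia.
case: hx hy h => -> [] -> // _.
- by exists (false, inZp 5); apply: pointP.
- by exists (false, inZp 2); apply: pointP.
- by exists (false, inZp 0); apply: pointP.
- by exists (false, inZp 1); apply: pointP.
- by exists (false, inZp 3); apply: pointP.
- by exists (false, inZp 4); apply: pointP.
Qed.

(** When [u] is rotated to [e1], the other vector becomes one of the two unit vectors at unit
    distance from [e1]; the reflection fixing [e1] exchanges these. *)
Lemma sqlength_pair u v : sqlength u = 1%R -> sqlength v = 1%R ->
  sqlength (v - u)%R = 1%R -> exists d, plin d e1 = u /\ plin d e2 = v.
Proof.
move=> /sqlength1 [d du] hv huv.
have [v' vE] : exists v', v = plin d v'.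
  by exists (plin (dinv d) v); rewrite -plin_mul dmulVr.
have linN p : plin d (- p)%R = (- plin d p)%R.
  apply/eqP; rewrite -GRing.addr_eq0 -plinD GRing.addNr plin0; exact/eqP.
move: hv huv; rewrite vE -du -linN -plinD !sqlength_plin => hv huv.
have [->|->] : v' = e2 \/ v' = (1, -1)%R.
  have [d' d'v] := sqlength1 hv; move: huv; rewrite -{}d'v.
  by case: d' => [[] [[|[|[|[|[|[|//]]]]]] i]] //= _;
    try (by left; apply: pointP); right; apply: pointP.
- by exists d.
- by exists (dmul (true, inZp 1) d); rewrite !plin_mul.
Qed.

Lemma image_base2 (f : Defs.point -> Defs.point) p q :
  f @` [set p; q] = [set f p; f q].
Proof. by rewrite image_setU !image_set1. Qed.

Lemma image_base3 (f : Defs.point -> Defs.point) p q r :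
  f @` [set p; q; r] = [set f p; f q; f r].
Proof. by rewrite image_setU image_base2 image_set1. Qed.

Lemma pact_setT x : pact x @` setT = setT.
Proof. by apply/seteqP; split=> // p _; exists (pact (winv x) p); rewrite ?pactKV. Qed.

Lemma pact_orig x : pact x orig = x.2.
Proof. by rewrite /pact [plin _ _]plin0 GRing.add0r. Qed.

Lemma tessellation_faceP F : tessellation_face F <->
  exists k x, (k <= 4)%N /\ F = pact x @` base_face k.
Proof.
split; last first.
  case=> k [x [k4 ->]]; case: k k4 => [|[|[|[|[|//]]]]] _ /=.
  - by rewrite image_set0; constructor.
  - by rewrite image_set1; constructor.
  - rewrite image_base2; constructor.
    by rewrite /unit_distance pact_orig /pact GRing.addrK sqlength_plin.
  - rewrite image_base3; constructor; rewrite /unit_distance ?pact_orig /pact.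
    + by rewrite GRing.addrK sqlength_plin.
    + rewrite GRing.opprD GRing.addrACA GRing.subrr GRing.addr0.
      have -> : (- plin x.1 e1 = plin x.1 (- e1))%R.
        by apply/eqP; rewrite eq_sym -GRing.addr_eq0 -plinD GRing.addNr plin0.
      by rewrite -plinD sqlength_plin.
    + rewrite GRing.opprD GRing.addrCA GRing.subrr GRing.addr0.
      have -> : (- plin x.1 e2 = plin x.1 (- e2))%R.
        by apply/eqP; rewrite eq_sym -GRing.addr_eq0 -plinD GRing.addNr plin0.
      by rewrite sqlength_plin.
  - by rewrite pact_setT; constructor.
case=> [|p|p q pq|p q r pq qr rp|].
- by exists 0%N, (false, 0%R, 0%R); rewrite image_set0.
- exists 1%N, (false, 0%R, p); split=> //=.
  by rewrite image_set1 pact_orig.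
- have [d dq] := sqlength1 pq; exists 2%N, (d, p); split=> //=.
  by rewrite image_base2 pact_orig /pact /= dq GRing.subrK.
- have rp' : sqlength (r - p)%R = 1%R.
    by rewrite -rp /sqlength /=; ring.
  have [|d [dq dr]] := sqlength_pair pq rp'.
    by rewrite -qr; congr sqlength; rewrite GRing.opprB GRing.addrA GRing.subrK.
  exists 3%N, (d, p); split=> //=.
  by rewrite image_base3 pact_orig /pact /= dq dr !GRing.subrK.
- by exists 4%N, (false, 0%R, 0%R); rewrite pact_setT.
Qed.

Section TorusFaces.
Variables (gT : finGroupType) (a0 a1 a2 : gT).
Hypothesis rel : triangle_relations a0 a1 a2.
Local Notation E := (tri_elt a0 a1 a2).

Definition tri_stab (k : nat) : {set gT} :=
  match k with
  | 1 => <<[set a1; a2]%SET>> | 2 => <<[set a0; a2]%SET>> | 3 => <<[set a0; a1]%SET>>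
  | _ => tri_group a0 a1 a2
  end.

Lemma tri_stab_group_set k : group_set (tri_stab k).
Proof. by case: k => [|[|[|[|k]]]]; apply: groupP. Qed.
Canonical tri_stab_group k := Group (tri_stab_group_set k).

Lemma tri_stab_sub k : tri_stab k \subset tri_group a0 a1 a2.
Proof.
by case: k => [|[|[|[|k]]]] //=; apply: genS; apply/fintype.subsetP => g;
  rewrite !inE => /orP [] ->; rewrite ?orbT.
Qed.

Lemma gen_pact (A : {set gT}) F :
  {in A, forall g, exists2 z, E z = g & pact z @` F = F} ->
  {in <<A>>, forall g, exists2 z, E z = g & pact z @` F = F}.
Proof.
move=> hA g /gen_prodgP [n [f fP ->]].
elim: n f fP => [|n IH] f fP.
  exists (false, 0%R, 0%R); first by rewrite big_ord0 tri_elt1.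
  rewrite -[RHS]image_id; apply: eq_imagel => p _.
  by rewrite /pact /plin /= GRing.addr0.
rewrite big_ord_recl.
have [|y <- yF] := IH (fun i => f (lift ord0 i)); first by [].
have [x <- xF] := hA _ (fP ord0).
exists (wmul x y); first by rewrite (tri_elt_mul rel).
rewrite -[in RHS]yF -[in RHS]xF image_comp; apply: eq_imagel => p _.
by rewrite pact_mul.
Qed.

Lemma tri_stabP k g : g \in tri_stab k ->
  exists2 z, E z = g & pact z @` base_face k = base_face k.
Proof.
have s0 : pact w0 @` base_face 2 = base_face 2.
  by rewrite /= image_base2 !pact_w0 setUC.
have s0' : pact w0 @` base_face 3 = base_face 3.
  by rewrite /= image_base3 !pact_w0 [X in X `|` _]setUC.
have s1 : pact w1 @` base_face 1 = base_face 1.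
  by rewrite /= image_set1 pact_w1.
have s1' : pact w1 @` base_face 3 = base_face 3.
  by rewrite /= image_base3 !pact_w1 -!setUA; congr (_ `|` _); rewrite setUC.
have s2 : pact w2 @` base_face 1 = base_face 1.
  by rewrite /= image_set1 pact_w2.
have s2' : pact w2 @` base_face 2 = base_face 2.
  by rewrite /= image_base2 !pact_w2.
have W0 := tri_elt_w0 rel; have W1 := tri_elt_w1 a0 a1 a2; have W2 := tri_elt_w2 rel.
case: k => [|[|[|[|k]]]].
- by move=> /(tri_group_elt rel) [x <-]; exists x => //; rewrite image_set0.
- apply: gen_pact => a; rewrite !inE => /orP [] /eqP ->; [exists w1|exists w2] => //.
- apply: gen_pact => a; rewrite !inE => /orP [] /eqP ->; [exists w0|exists w2] => //.
- apply: gen_pact => a; rewrite !inE => /orP [] /eqP ->; [exists w0|exists w1] => //.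
- by move=> /(tri_group_elt rel) [x <-]; exists x => //; rewrite pact_setT.
Qed.

Lemma pact_fix1 x : pact x orig = orig -> E x \in tri_stab 1.
Proof.
case: x => d v; rewrite pact_orig /= => ->.
rewrite tri_elt_lin /tri_dih /=.
have m1 : a1 \in <<[set a1; a2]%SET>> by apply: mem_gen; rewrite !inE eqxx.
have m2 : a2 \in <<[set a1; a2]%SET>> by apply: mem_gen; rewrite !inE eqxx orbT.
by apply: groupM; apply: groupX => //; apply: groupM.
Qed.

Lemma pact_fix2 x : pact x orig = orig -> pact x e1 = e1 ->
  E x = 1 \/ (E x = a2 /\ pact x e2 = (1, -1)%R).
Proof.
case: x => d v; rewrite pact_orig /= => ->.
rewrite tri_elt_lin /pact /= GRing.addr0.
case: d => [[] [[|[|[|[|[|[|//]]]]]] i]] //= _.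
- right; split; last by apply: pointP.
  by rewrite /tri_dih /= expg1 mulgA (tri_invol1 rel) mul1g.
- by left; rewrite /tri_dih /= expg0 mulg1.
Qed.

Lemma base_face_move k' p q : base_face k' p -> base_face k' q -> p <> q ->
  (1 < k' <= 3)%N ->
  exists2 z, E z \in tri_stab k' &
    [/\ pact z orig = p, pact z e1 = q & base_face 3 (pact z e2)].
Proof.
have W0 := tri_elt_w0 rel; have W1 := tri_elt_w1 a0 a1 a2.
have b0 : base_face 3 orig by left; left.
have b1 : base_face 3 e1 by left; right.
have b2 : base_face 3 e2 by right.
case: k' => [|[|[|[|//]]]] //= hp hq pq _.
  have m0 : a0 \in <<[set a0; a2]%SET>> by apply: mem_gen; rewrite !inE eqxx.
  case: hp hq pq => -> [] -> // _.
  - by exists (false, 0%R, 0%R); rewrite ?tri_elt1 ?group1.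
  - by exists w0; rewrite ?W0 // !pact_w0.
have m0 : a0 \in <<[set a0; a1]%SET>> by apply: mem_gen; rewrite !inE eqxx.
have m1 : a1 \in <<[set a0; a1]%SET>> by apply: mem_gen; rewrite !inE eqxx orbT.
case: hp hq pq => [[]|] -> [[]|] -> // _.
- by exists (false, 0%R, 0%R); rewrite ?tri_elt1 ?group1.
- by exists w1; rewrite ?W1 // !pact_w1.
- by exists w0; rewrite ?W0 // !pact_w0.
- by exists (wmul w1 w0); rewrite ?(tri_elt_mul rel) ?W0 ?W1 ?groupM // !pact_mul !pact_w1 !pact_w0.
- by exists (wmul w0 w1); rewrite ?(tri_elt_mul rel) ?W0 ?W1 ?groupM // !pact_mul !pact_w0 !pact_w1.
- exists (wmul w0 (wmul w1 w0)).
    by rewrite !(tri_elt_mul rel) W0 W1 !groupM.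
  by rewrite !pact_mul !pact_w0 !pact_w1.
Qed.

Lemma base_face_move1 k' p : base_face k' p -> (0 < k' <= 3)%N ->
  exists2 z, E z \in tri_stab k' & pact z orig = p.
Proof.
case: k' => [|[|[|[|//]]]] // hp _.
- by exists (false, 0%R, 0%R); rewrite ?tri_elt1 ?group1.
- have [p0|p0] := pselect (p = orig).
    by exists (false, 0%R, 0%R); rewrite ?tri_elt1 ?group1.
  by have [||z hz [zp _ _]] := @base_face_move 2 p orig hp _ p0 _; [left| |exists z].
- have [p0|p0] := pselect (p = orig).
    by exists (false, 0%R, 0%R); rewrite ?tri_elt1 ?group1.
  by have [||z hz [zp _ _]] := @base_face_move 3 p orig hp _ p0 _; [left; left| |exists z].
Qed.

(** This turns inclusion of faces into intersection of cosets. An element of the stabiliser of the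
    larger face imitates [y] on the vertices of the smaller one; the quotient of the two fixes these
    vertices, so it stabilises the smaller face. *)
Lemma pact_incident k k' y : (k <= 4)%N -> (k' <= 4)%N ->
  pact y @` base_face k `<=` base_face k' ->
  (k <= k')%N /\ E y \in tri_stab k * tri_stab k'.
Proof.
move=> k4 k'4 sub.
have subp p : base_face k p -> base_face k' (pact y p) by move=> kp; apply: sub; exists p.
have inj p q : p <> q -> pact y p <> pact y q by move=> pq /pact_inj.
have [k0|kpos] := posnP k.
  split; first by rewrite k0.
  by rewrite k0 -[E y]mulg1 mem_mulg ?group1 // (tri_elt_mem a0 a1 a2).
have [k'4'|k'lt] := eqVneq k' 4%N.
  split; first by rewrite k'4'.
  by rewrite k'4' -[E y]mul1g mem_mulg ?group1 // (tri_elt_mem a0 a1 a2).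
have {k'lt}k'3 : (k' <= 3)%N by rewrite -ltnS ltn_neqAle k'lt.
have {k4}k3 : (k <= 3)%N.
  rewrite -ltnS ltn_neqAle k4 andbT; apply/eqP => kE.
  (* [(5, 5)] is a lattice point on no base face other than the whole lattice. *)
  have : base_face k' (5, 5)%R.
    rewrite -(pactKV y (5, 5)%R); apply: subp; by rewrite kE.
  by case: k' k'3 {k'4 sub subp} => [|[|[|[|//]]]] //= _ [] // [].
have b0 : base_face k orig.
  by case: k kpos k3 {sub subp} => [|[|[|[|//]]]] //= _ _; rewrite /setU /=; tauto.
have k'pos : (0 < k')%N by case: k' subp {sub k'3 k'4} => // /(_ _ b0).
have y0 := subp _ b0.
have k'3' : (0 < k' <= 3)%N by rewrite k'pos.
have fact z : E z \in tri_stab k' -> E (wmul y (winv z)) \in tri_stab k ->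
    E y \in tri_stab k * tri_stab k'.
  rewrite (tri_elt_mul rel) (tri_elt_inv rel) => zk' yz.
  by rewrite -(mulgKV (E z) (E y)) mem_mulg.
have fixp z p : pact y p = pact z p -> pact (wmul y (winv z)) p = p.
  by move=> e; rewrite pact_mul e pactK.
case: (ltnP 1 k) => k1; last first.
  have {kpos k1} kE : k = 1%N by apply/eqP; rewrite eqn_leq kpos k1.
  split; first by rewrite kE.
  have [z zk' zp] := base_face_move1 y0 k'3'.
  by apply: (fact z) => //; rewrite kE; apply: pact_fix1; apply: fixp.
have b1 : base_face k e1.
  by case: k k1 k3 {sub subp kpos b0 fact} => [|[|[|[|//]]]] //= _ _; rewrite /setU /=; tauto.
have y1 := subp _ b1.
have y01 := inj orig e1 (fun e => ltac:(discriminate)).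
have k'1 : (1 < k')%N.
  by case: k' y0 y1 {sub subp k'3 k'3' k'pos k'4 fact} => [|[|//]] //= e0 e1; case: y01; rewrite e0.
have [z zk' [z0 z1 z2]] := base_face_move y0 y1 y01 (introT andP (conj k'1 k'3)).
have x0 := fixp z orig (esym z0); have x1 := fixp z e1 (esym z1).
have [kE|k2] := eqVneq k 2%N.
  split; first by rewrite kE.
  apply: (fact z) => //; rewrite kE.
  have [->|[-> _]] := pact_fix2 x0 x1; first exact: group1.
  by apply: mem_gen; rewrite !inE eqxx orbT.
have {k2} kE : k = 3%N.
  by apply/eqP; rewrite eqn_leq k3 ltn_neqAle eq_sym k2.
have b2 : base_face k e2 by rewrite kE; right.
have y2 := subp _ b2.
have y02 := inj orig e2 (fun e => ltac:(discriminate)).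
have y12 := inj e1 e2 (fun e => ltac:(discriminate)).
have [k'E|k'2] := eqVneq k' 2%N.
  by exfalso; move: y0 y1 y2; rewrite k'E; case=> e0 [] e1 [] e2; congruence.
have {k'2} k'E : k' = 3%N.
  by apply/eqP; rewrite eqn_leq k'3 ltn_neqAle eq_sym k'2.
split; first by rewrite kE k'E.
apply: (fact z) => //; rewrite kE.
have [->|[_ x2]] := pact_fix2 x0 x1; first exact: group1.
(* Two distinct vertices of a triangle determine the third, so [y] and [z] also agree on [e2]; a
   reflection moving [e2] to [(1, -1)] is thereby excluded. *)
exfalso.
have z02 : pact z orig <> pact z e2 by move=> /pact_inj.
have z12 : pact z e1 <> pact z e2 by move=> /pact_inj.
have zy : pact z e2 = pact y e2.
  move: y0 y1 y2 z2; rewrite k'E; rewrite -z0 -z1 in y01 y02 y12 *.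
  by move=> [[]|] e0 [[]|] e1 [[]|] e2 [[]|] e3; congruence.
by have := fixp z e2 (esym zy); rewrite x2.
Qed.

Section Iso.
Variable ab : int * int.
Hypothesis tri_lattice : forall v, translation_lattice ab v -> tri_trans a0 a1 a2 v = 1.
Hypothesis tri_kernel : forall x, E x = 1 ->
  x.1 = (false, 0%R) /\ translation_lattice ab x.2.

Lemma tri_elt_eq x y : E x = E y -> exists2 l, translation_lattice ab l &
  forall p, pact x p = (pact y p + l)%R.
Proof.
move=> xy.
have [] := @tri_kernel (wmul (winv y) x).
  by rewrite (tri_elt_mul rel) (tri_elt_inv rel) xy mulVg.
set z := wmul _ _ => z1 z2; exists z.2 => // p.
have -> : pact x p = pact z (pact y p) by rewrite pact_mul pactK.
by rewrite {1}/pact z1.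
Qed.

Variables (U : Type) (A : set U) (le : U -> U -> Prop) (kap : U -> nat)
  (cos : U -> {set gT}).
Hypothesis cosE : forall H, A H -> (kap H <= 4)%N /\
  exists2 a, a \in tri_group a0 a1 a2 & cos H = tri_stab (kap H) :* a.
Hypothesis leE : forall H H', A H -> A H' ->
  (le H H' <-> (kap H <= kap H')%N /\ exists x, x \in cos H /\ x \in cos H').
Hypothesis le_anti : forall H H', A H -> A H' -> le H H' -> le H' H -> H = H'.
Hypothesis cos_surj : forall k a, (k <= 4)%N -> a \in tri_group a0 a1 a2 ->
  exists H, [/\ A H, kap H = k & a \in cos H].

(** A coset is sent to all images of the base face under lifts of its elements. Two lifts of one
    element differ by a lattice translation, and the stabiliser lifts to symmetries of the base
    face, so this is a single translation orbit. *)
Definition torus_map (H : U) : set (set Defs.point) :=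
  [set F | exists x, E x \in cos H /\ F = pact x @` base_face (kap H)].

Lemma torus_map_orbit H x : A H -> E x \in cos H ->
  torus_map H = translation_orbit ab (pact x @` base_face (kap H)).
Proof.
move=> AH xH; have [_ [a aG cosH]] := cosE AH.
apply/seteqP; split=> F /=.
  case=> y [yH ->].
  have : E y * (E x)^-1 \in tri_stab (kap H).
    move: xH yH; rewrite cosH !mem_rcoset => xH yH.
    by rewrite -(mulgKV a (E y)) -mulgA -[a * _]invgK invMg invgK groupM ?groupV.
  case/tri_stabP => z ez zk.
  have [|l ll yl] := @tri_elt_eq y (wmul z x).
    by rewrite (tri_elt_mul rel) ez mulgKV.
  exists l => //; rewrite /translate -[in LHS]zk !image_comp.
  by apply: eq_imagel => p _ /=; rewrite yl pact_mul.
case=> l ll <-; exists (x.1, x.2 + l)%R.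
have -> : E (x.1, x.2 + l)%R = E x.
  by rewrite /tri_elt /= (tri_transD rel) (tri_lattice ll) mulg1.
split=> //; rewrite /translate image_comp; apply: eq_imagel => p _ /=.
by rewrite /pact /= GRing.addrA.
Qed.

(** The order on cosets is kept abstract so that the same statement serves the facets and, with the
    order reversed, the vertex-figures. *)
Lemma torus_iso : order_isomorphic A le (map36_face ab) map36_le.
Proof.
have cos_elt H : A H -> exists x, E x \in cos H.
  move=> AH; have [_ [a /(tri_group_elt rel) [x <-] ->]] := cosE AH.
  by exists x; apply: rcoset_refl.
have le_map H H' : A H -> A H' ->
    (le H H' <-> map36_le (torus_map H) (torus_map H')).
  move=> AH AH'; rewrite leE //; split.
    case=> kk' [a [aH aH']].
    have [k4 [b bG cosH]] := cosE AH; have [k4' _] := cosE AH'.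
    have /(tri_group_elt rel) [x xa] : a \in tri_group a0 a1 a2.
      move: aH; rewrite cosH mem_rcoset => ab'.
      by rewrite -(mulgKV b a) groupM // (fintype.subsetP (tri_stab_sub _) _ ab').
    exists (pact x @` base_face (kap H)), (pact x @` base_face (kap H')).
    split; [by exists x; rewrite xa|by exists x; rewrite xa|].
    apply: image_subset.
    move: (kap H) (kap H') kk' k4 k4' => k k'.
    case: k k' => [|[|[|[|[|//]]]]] [|[|[|[|[|//]]]]] //= _ _ _ p; rewrite /setU /=; tauto.
  case=> _ [_ [[x [xH ->]] [y [yH' ->]] sub]].
  have [k4 [b bG cosH]] := cosE AH; have [k4' [b' b'G cosH']] := cosE AH'.
  have [|kk' ] := @pact_incident (kap H) (kap H') (wmul x (winv y)) k4 k4'.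
    move=> p [q kq <-]; rewrite pact_mul.
    have [r kr <-] : (pact y @` base_face (kap H')) (pact x q) by apply: sub; exists q.
    by rewrite pactK.
  rewrite (tri_elt_mul rel) (tri_elt_inv rel) => /mulsgP [g g' gk g'k e].
  split=> //; exists (g' * E y); split.
    have -> : g' * E y = g^-1 * E x.
      by apply: (mulgI g); rewrite mulKVg mulgA -e mulgKV.
    by rewrite cosH mem_rcoset -mulgA groupM ?groupV // -mem_rcoset -cosH.
  by rewrite cosH' mem_rcoset -mulgA groupM // -mem_rcoset -cosH'.
exists torus_map => //; split.
- move=> H AH /=; have [k4 _] := cosE AH; have [x xH] := cos_elt H AH.
  exists (pact x @` base_face (kap H)); last by rewrite (torus_map_orbit AH xH).
  by apply/tessellation_faceP; exists (kap H), x.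
- move=> H H' /set_mem AH /set_mem AH' e.
  by apply: le_anti => //; apply/le_map => //; rewrite e; apply/(le_map H' H') => //;
    apply/leE => //; split=> //; have [x xH] := cos_elt H' AH'; exists (E x).
- move=> _ [_ /tessellation_faceP [k [x [k4 ->]]] <-].
  have [H [AH kH xH]] := cos_surj k4 (tri_elt_mem a0 a1 a2 x).
  by exists H => //; rewrite (torus_map_orbit AH xH) kH.
Qed.

End Iso.
End TorusFaces.

End TorusIsomorphism.

(** * Polytopes of rank 4 *)

Section SmallGenerated.
Variable gT : finGroupType.
Implicit Types u v w x : gT.

Lemma gen2_comm u v x : u * u = 1 -> v * v = 1 -> commute u v ->
  x \in <<[set u; v]%SET>> -> exists b c : bool, x = u ^+ b * v ^+ c.
Proof.
move=> uu vv uv; elim/gen_ind: x / => [|y x]; first by exists false, false; rewrite mulg1.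
rewrite !inE => /orP [] /eqP -> [b [c ->]].
  by exists (~~ b), c; case: b; rewrite /= ?expg0 ?expg1 ?mul1g ?mulgA ?uu ?mul1g.
exists b, (~~ c); case: b c => [] [] /=; rewrite ?expg0 ?expg1 ?mul1g ?mulg1 //.
by rewrite mulgA -uv -mulgA vv mulg1.
Qed.

Lemma braid3 u v : u * u = 1 -> v * v = 1 -> (u * v) ^+ 3 = 1 -> u * v * u = v * u * v.
Proof.
move=> uu vv; rewrite !expgS expg0 mulg1 => uv3.
apply: (mulIg (v * u * v)); rewrite -!mulgA (mulgA v v) vv mul1g (mulgA u u) uu mul1g vv.
by rewrite -uv3 !mulgA.
Qed.

Lemma gen2_dih3 u v x : u * u = 1 -> v * v = 1 -> (u * v) ^+ 3 = 1 ->
  x \in <<[set u; v]%SET>> ->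
  x \in [:: 1; u; v; u * v; v * u; u * v * u].
Proof.
move=> uu vv uv3; have br := braid3 uu vv uv3.
have U g : u * (u * g) = g by rewrite mulgA uu mul1g.
have V g : v * (v * g) = g by rewrite mulgA vv mul1g.
have br' g : v * (u * (v * g)) = u * (v * (u * g)) by rewrite !mulgA br.
have br0 : v * (u * v) = u * (v * u) by rewrite !mulgA br.
elim/gen_ind: x / => [|y x]; first by rewrite !inE eqxx.
rewrite in_set2 => /orP [] /eqP ->; rewrite !inE => /orP [|/orP [|/orP [|/orP [|/orP []]]]] /eqP ->;
  rewrite -?mulgA ?mulg1 ?U ?V ?br' ?br0 ?U ?uu ?vv ?mulg1 ?eqxx ?orbT //.
Qed.

Lemma gen3_comm u v w x : u * u = 1 -> commute u v -> commute u w ->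
  x \in <<[set u; v; w]%SET>> ->
  exists (b : bool) y, y \in <<[set v; w]%SET>> /\ x = u ^+ b * y.
Proof.
move=> uu uv uw; elim/gen_ind: x / => [|y x].
  by exists false, 1; rewrite group1 mulg1.
rewrite !inE -orbA => /or3P [] /eqP -> [b [z [zv ->]]].
- by exists (~~ b), z; case: b; rewrite /= ?expg0 ?expg1 ?mul1g ?mulgA ?uu ?mul1g.
- exists b, (v * z); split; first by rewrite groupM // mem_gen // !inE eqxx.
  by case: b; rewrite /= ?expg0 ?expg1 ?mul1g ?mulgA // uv.
- exists b, (w * z); split; first by rewrite groupM // mem_gen // !inE eqxx orbT.
  by case: b; rewrite /= ?expg0 ?expg1 ?mul1g ?mulgA // uw.
Qed.

End SmallGenerated.

Lemma zexpg_hom (gT hT : finGroupType) (f : gT -> hT) :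
  (forall x y, f (x * y) = f x * f y) -> forall x m, f (zexpg x m) = zexpg (f x) m.
Proof.
move=> fM; have f1 : f 1 = 1 by apply: (mulgI (f 1)); rewrite -fM !mulg1.
have fX x k : f (x ^+ k) = f x ^+ k.
  by elim: k => [|k IH]; rewrite ?expg0 // !expgS fM IH.
have fV x : f x^-1 = (f x)^-1 by apply: (mulgI (f x)); rewrite -fM !mulgV.
by move=> x [k|k]; rewrite ?NegzE ?zexpgN ?fV !zexpg_nat fX.
Qed.

Lemma face_rankE n (S : stringGroup n) (F : face S) (k : nat) :
  (face_rank F == Posz k) = (face_idx F == k.+1 :> nat).
Proof. by rewrite /face_rank; apply/eqP/eqP; lia. Qed.

Lemma leq_sub2lK n a b : (a <= n)%N -> (b <= n)%N -> (n - a <= n - b)%N -> (b <= a)%N.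
Proof. by lia. Qed.

Definition has_medial_polytope (p q : int * int) (G : sgraph) : Prop :=
  [/\ valent G 3, semisymmetric G
    & exists (d : Order.disp_t) (P : finPOrderType d) (rk : P -> int),
        [/\ abstract_polytope 4 rk, regular_poset P, has_facets rk p,
            has_vertex_figures rk q & sgraph_isomorphic G (medial_layer_graph rk)]].

Section RankFour.
Variables (gT : finGroupType) (r0 r1 r2 r3 : gT).

Hypothesis gens : <<[set r0; r1; r2; r3]%SET>> = [set: gT]%SET.
Hypotheses (i0 : r0 * r0 = 1) (i1 : r1 * r1 = 1) (i2 : r2 * r2 = 1) (i3 : r3 * r3 = 1).
Hypotheses (c02 : commute r0 r2) (c03 : commute r0 r3) (c13 : commute r1 r3).
Hypotheses (o01 : (r0 * r1) ^+ 3 = 1) (o12 : (r1 * r2) ^+ 6 = 1) (o23 : (r2 * r3) ^+ 3 = 1).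

Let relA : triangle_relations r0 r1 r2. Proof. by split. Qed.
Let relB : triangle_relations r3 r2 r1.
Proof. by split=> //; apply: invol_expgC. Qed.

Local Notation A := (tri_group r0 r1 r2).
Local Notation B := (tri_group r3 r2 r1).
Local Notation EA := (tri_elt r0 r1 r2).
Local Notation EB := (tri_elt r3 r2 r1).

Variables (p q : int * int).
Hypothesis latA : forall v, translation_lattice p v -> tri_trans r0 r1 r2 v = 1.
Hypothesis latB : forall v, translation_lattice q v -> tri_trans r3 r2 r1 v = 1.
(** This hypothesis and the next say that an element of one group lying in the other has its
    translation part in the lattice. They make [r1], [r2] generate the intersection of [A] and [B];
    applied to the identity they show that no further translation is trivial. *)
Hypothesis interA : forall x, EA x \in B -> translation_lattice p x.2.
Hypothesis interB : forall x, EB x \in A -> translation_lattice q x.2.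
Hypothesis dihA : forall d, tri_dih r1 r2 d = 1 -> d = (false, 0%R).
Hypothesis dihB : forall d, tri_dih r2 r1 d = 1 -> d = (false, 0%R).
Hypothesis unitA : ~ translation_lattice p (1, 0)%R.
Hypothesis unitB : ~ translation_lattice q (1, 0)%R.

Let interAB x : x \in A -> x \in B -> x \in <<[set r1; r2]%SET>>.
Proof.
move=> /(tri_group_elt relA) [y <-] /interA /latA; rewrite /tri_elt => ->.
rewrite mulg1 /tri_dih groupM // groupX //; first by rewrite mem_gen // !inE eqxx.
by rewrite groupM // mem_gen // !inE eqxx ?orbT.
Qed.

Let r0B : r0 \notin B.
Proof. by apply/negP => h; apply: unitA; apply: (@interA w0); rewrite (tri_elt_w0 relA). Qed.
Let r3A : r3 \notin A.
Proof. by apply/negP => h; apply: unitB; apply: (@interB w0); rewrite (tri_elt_w0 relB). Qed.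

Lemma rank4_neq12 : r1 <> r2.
Proof.
move=> e; have /dihA // : tri_dih r1 r2 (false, inZp 1) = 1.
by rewrite /tri_dih /= e expg0 mul1g expg1 i2.
Qed.
Lemma rank4_neq1 : r1 <> 1.
Proof.
move=> e; have /dihA // : tri_dih r1 r2 (true, inZp 0) = 1.
by rewrite /tri_dih /= e expg0 expg1 mulg1.
Qed.
Lemma rank4_neq2 : r2 <> 1.
Proof.
move=> e; have /dihB // : tri_dih r2 r1 (true, inZp 0) = 1.
by rewrite /tri_dih /= e expg0 expg1 mulg1.
Qed.

Let gen4 (i : 'I_4) : gT := tnth [tuple r0; r1; r2; r3] i.

Let gen4_invol i : gen4 i * gen4 i = 1.
Proof. by case: i => [[|[|[|[|//]]]] ?]; rewrite /gen4 (tnth_nth 1) /=. Qed.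

Let gen4_comm (i j : 'I_4) : (i.+1 < j)%N -> commute (gen4 i) (gen4 j).
Proof.
by case: i j => [[|[|[|[|//]]]] ?] [[|[|[|[|//]]]] ?] // _; rewrite /gen4 !(tnth_nth 1) /=.
Qed.

Let gen4_generated : <<[set gen4 i | i : 'I_4]%SET>> = [set: gT]%SET.
Proof.
rewrite -gens; congr <<_>>; apply/setP => x; rewrite !inE -!orbA.
apply/imsetP/or4P => [[i _ ->]|].
  by case: i => [[|[|[|[|//]]]] ?]; rewrite /gen4 (tnth_nth 1) /= eqxx; [constructor 1|constructor 2|constructor 3|constructor 4].
have h i (i4 : (i < 4)%N) : gen4 (Ordinal i4) = nth 1 [:: r0; r1; r2; r3] i.
  by rewrite /gen4 (tnth_nth 1).
by case=> /eqP ->; [exists (@Ordinal 4 0 isT)|exists (@Ordinal 4 1 isT)|exists (@Ordinal 4 2 isT)|exists (@Ordinal 4 3 isT)]; rewrite ?h.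
Qed.

Definition rank4_group : stringGroup 4 :=
  StringGroup gen4_invol gen4_comm gen4_generated.
Local Notation S := rank4_group.

Let parab4E (I : pred 'I_4) : parab S I =
  <<[set x : gT | [|| (inord 0 \in I) && (x == r0), (inord 1 \in I) && (x == r1),
     (inord 2 \in I) && (x == r2) | (inord 3 \in I) && (x == r3)]]%SET>>.
Proof.
rewrite /parab; congr <<_>>; apply/setP => x; rewrite inE.
have h i : (i < 4)%N -> gen4 (inord i) = nth 1 [:: r0; r1; r2; r3] i.
  by move=> i4; rewrite /gen4 (tnth_nth 1) inordK.
apply/imsetP/or4P => [[i iI ->]|].
  rewrite -(inord_val i) in iI *; case: i iI => [[|[|[|[|//]]]] ?] /= -> ;
   rewrite h //= eqxx; [constructor 1|constructor 2|constructor 3|constructor 4] => //.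
by case=> /andP [iI /eqP ->]; eexists; try exact: iI; rewrite /= h.
Qed.

Let fstab4E k : fstab S k =
  <<[set x : gT | [|| (1%N != k) && (x == r0), (2 != k) && (x == r1),
     (3 != k) && (x == r2) | (4 != k) && (x == r3)]]%SET>>.
Proof. by rewrite /fstab parab4E !inE !inordK. Qed.

Let fstabA : fstab S 4 = A.
Proof.
rewrite fstab4E; congr <<_>>; apply/setP => x; rewrite !inE /=.
by case: (x == r0); case: (x == r1); case: (x == r2).
Qed.
Let fstabB : fstab S 1 = B.
Proof.
rewrite fstab4E; congr <<_>>; apply/setP => x; rewrite !inE /=.
by case: (x == r1); case: (x == r2); case: (x == r3).
Qed.
Let fstab_2 : fstab S 2 = <<[set r0; r2; r3]%SET>>.
Proof.
rewrite fstab4E; congr <<_>>; apply/setP => x; rewrite !inE /=.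
by case: (x == r0); case: (x == r2); case: (x == r3).
Qed.
Let fstab_3 : fstab S 3 = <<[set r3; r0; r1]%SET>>.
Proof.
rewrite fstab4E; congr <<_>>; apply/setP => x; rewrite !inE /=.
by case: (x == r0); case: (x == r1); case: (x == r3).
Qed.

Let o10 : (r1 * r0) ^+ 3 = 1.
Proof. exact: invol_expgC i0 i1 o01. Qed.

Let r0A : r0 \in A. Proof. by rewrite mem_gen // !inE eqxx. Qed.
Let r1A : r1 \in A. Proof. by rewrite mem_gen // !inE eqxx ?orbT. Qed.
Let r2A : r2 \in A. Proof. by rewrite mem_gen // !inE eqxx ?orbT. Qed.
Let r1B : r1 \in B. Proof. by rewrite mem_gen // !inE eqxx ?orbT. Qed.
Let r2B : r2 \in B. Proof. by rewrite mem_gen // !inE eqxx ?orbT. Qed.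
Let r3B : r3 \in B. Proof. by rewrite mem_gen // !inE eqxx ?orbT. Qed.

Let sub2 (u v : gT) (H : {group gT}) : u \in H -> v \in H -> <<[set u; v]%SET>> \subset H.
Proof.
move=> uH vH; rewrite gen_subG; apply/fintype.subsetP => x.
by rewrite in_set2 => /orP [] /eqP ->.
Qed.

(** A group of order 2 is maximal in a dihedral group of order 6: of the six words in [u] and [v],
    all but 1 and [v] would force [u] into [H]. *)
Lemma dih3_inter (u v x : gT) (H : {group gT}) : u * u = 1 -> v * v = 1 -> (u * v) ^+ 3 = 1 ->
  u \notin H -> v \in H -> x \in <<[set u; v]%SET>> -> x \in H -> x = 1 \/ x = v.
Proof.
move=> uu vv uv3 uH vH /(gen2_dih3 uu vv uv3); rewrite !inE.
have br := braid3 uu vv uv3.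
case/orP => [/eqP ->|]; first by left.
case/orP => [/eqP ->|]; first by rewrite (negbTE uH).
case/orP => [/eqP ->|]; first by right.
case/or3P => /eqP ->.
- by rewrite groupMr // (negbTE uH).
- by rewrite groupMl // (negbTE uH).
- by rewrite br groupMr // groupMl // (negbTE uH).
Qed.

Let i01B x : x \in <<[set r0; r1]%SET>> -> x \in B -> x = 1 \/ x = r1.
Proof. exact: (dih3_inter i0 i1 o01 r0B r1B). Qed.
Let o32 : (r3 * r2) ^+ 3 = 1. Proof. exact: tri_ord01 relB. Qed.
Let i23A x : x \in <<[set r2; r3]%SET>> -> x \in A -> x = 1 \/ x = r2.
Proof.
rewrite finset.setUC; exact: (dih3_inter i3 i2 o32 r3A r2A).
Qed.

Let inter_12 x : x \in fstab S 1 -> x \in fstab S 2 -> x \in <<[set r2; r3]%SET>>.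
Proof.
rewrite fstabB fstab_2 => xB /(gen3_comm i0 c02 c03) [b [y [y23 xE]]].
move: xB; rewrite xE groupMr; last exact: (fintype.subsetP (sub2 r2B r3B)).
by case: b {xE}; rewrite ?expg0 ?mul1g // expg1 (negbTE r0B).
Qed.

Let inter_13 x : x \in fstab S 1 -> x \in fstab S 3 -> x \in <<[set r1; r3]%SET>>.
Proof.
rewrite fstabB fstab_3 => xB /(gen3_comm i3 (commute_sym c03) (commute_sym c13)) [b [y [y01 xE]]].
move: xB; rewrite xE groupMl ?groupX // => yB.
have m1 : r1 \in <<[set r1; r3]%SET>> by rewrite mem_gen // !inE eqxx.
have m3 : r3 \in <<[set r1; r3]%SET>> by rewrite mem_gen // !inE eqxx orbT.
by case: (i01B y01 yB) => ->; rewrite groupM ?groupX ?group1.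
Qed.

Let inter_24 x : x \in fstab S 2 -> x \in fstab S 4 -> x \in <<[set r0; r2]%SET>>.
Proof.
rewrite fstabA fstab_2 => /(gen3_comm i0 c02 c03) [b [y [y23 xE]]] xA.
move: xA; rewrite xE groupMl ?groupX // => yA.
have m1 : r0 \in <<[set r0; r2]%SET>> by rewrite mem_gen // !inE eqxx.
have m3 : r2 \in <<[set r0; r2]%SET>> by rewrite mem_gen // !inE eqxx orbT.
by case: (i23A y23 yA) => ->; rewrite groupM ?groupX ?group1.
Qed.

Let inter_34 x : x \in fstab S 3 -> x \in fstab S 4 -> x \in <<[set r0; r1]%SET>>.
Proof.
rewrite fstabA fstab_3 => /(gen3_comm i3 (commute_sym c03) (commute_sym c13)) [b [y [y01 xE]]] xA.
move: xA; rewrite xE groupMr; last exact: (fintype.subsetP (sub2 r0A r1A)).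
by case: b {xE}; rewrite ?expg0 ?mul1g // expg1 (negbTE r3A).
Qed.

Let inter_23 x : x \in fstab S 2 -> x \in fstab S 3 -> x \in <<[set r0; r3]%SET>>.
Proof.
rewrite fstab_2 fstab_3 => /(gen3_comm i0 c02 c03) [b [y [y23 xE]]].
case/(gen3_comm i3 (commute_sym c03) (commute_sym c13)) => [b' [y' [y01 xE']]].
(* Clearing [r0] and [r3] from the two expressions of [x] gives one element lying both in the group
   of [r0], [r1] and in that of [r2], [r3]. It belongs to [A] and to [B], so it is 1 or [r1], and
   also 1 or [r2], hence 1. *)
have e : r0 ^+ b * y' = r3 ^+ b' * y.
  have [yr yr'] : (r0 ^+ b * x = y) /\ (r3 ^+ b' * x = y').
    by rewrite {1}xE {1}xE' !mulgA; case: b b' {xE xE'} => [] [];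
     rewrite ?expg0 ?expg1 ?i0 ?i3 ?mul1g.
  rewrite -yr -yr' !mulgA; congr (_ * _).
  by case: b b' {xE xE' yr yr'} => [] [] /=; rewrite ?expg0 ?expg1 ?mul1g ?mulg1.
have zA : r0 ^+ b * y' \in A.
  by rewrite groupM ?groupX // (fintype.subsetP (sub2 r0A r1A)).
have zB : r0 ^+ b * y' \in B.
  by rewrite e groupM ?groupX // (fintype.subsetP (sub2 r2B r3B)).
have z01 : r0 ^+ b * y' \in <<[set r0; r1]%SET>>.
  by rewrite groupM ?groupX // mem_gen // !inE eqxx.
have z23 : r0 ^+ b * y' \in <<[set r2; r3]%SET>>.
  by rewrite e groupM ?groupX // mem_gen // !inE eqxx orbT.
have z1 : r0 ^+ b * y' = 1.
  case: (i01B z01 zB) (i23A z23 zA) => -> // [] // e'; by case: rank4_neq12.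
have m1 : r0 \in <<[set r0; r3]%SET>> by rewrite mem_gen // !inE eqxx.
have m3 : r3 \in <<[set r0; r3]%SET>> by rewrite mem_gen // !inE eqxx orbT.
have y'E : y' = r0 ^+ b.
  apply: (mulgI (r0 ^+ b)); rewrite z1; case: b {xE e zA zB z01 z23 z1} => /=;
  by rewrite ?expg0 ?expg1 ?mul1g ?i0.
by rewrite xE' y'E groupM ?groupX.
Qed.

Let inter_14 x : x \in fstab S 1 -> x \in fstab S 4 -> x \in <<[set r1; r2]%SET>>.
Proof. by rewrite fstabA fstabB => xB xA; apply: interAB. Qed.

Lemma rank4_gen_notin i : @sg_gen 4 S i \notin fstab S i.+1.
Proof.
case: i => [[|[|[|[|//]]]] ?]; rewrite /= /gen4 (tnth_nth 1) /=.
- by rewrite fstabB r0B.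
- apply/negP => h; have := inter_24 h; rewrite fstabA => /(_ r1A).
  case/(gen2_comm i0 i2 c02) => b [c e].
  have : r0 ^+ b \in B.
    have -> : r0 ^+ b = r1 * r2 ^+ c by rewrite e -mulgA; case: (c); rewrite ?expg0 ?expg1 ?i2 ?mulg1.
    by rewrite groupM ?groupX.
  move: e; case: b; rewrite ?expg1 ?(negbTE r0B) // expg0 mul1g; case: c => /=.
    by rewrite expg1 => /rank4_neq12.
  by rewrite expg0 => /rank4_neq1.
- apply/negP => h; have := inter_13 _ h; rewrite fstabB => /(_ r2B).
  case/(gen2_comm i1 i3 c13) => b [c e].
  have : r3 ^+ c \in A.
    have -> : r3 ^+ c = r1 ^+ b * r2 by rewrite e mulgA; case: (b); rewrite ?expg0 ?expg1 ?i1 ?mul1g.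
    by rewrite groupM ?groupX.
  move: e; case: c; rewrite ?expg1 ?(negbTE r3A) // expg0 mulg1; case: b => /=.
    by rewrite expg1 => /esym/rank4_neq12.
  by rewrite expg0 => /rank4_neq2.
- by rewrite fstabA r3A.
Qed.

(** One case for each of the sixteen sets [J]. The pairwise intersections [inter_12] to [inter_34]
    settle them all; these rest on the intersection of [A] and [B] and on explicit lists of words in
    small dihedral groups. *)
Lemma rank4_inter (J : {set 'I_4}) x :
  (forall j, j \in J -> x \in fstab S j.+1) -> x \in parab S [pred i | i \notin J].
Proof.
move=> hJ.
have h i (i4 : (i < 4)%N) : inord i \in J -> x \in fstab S i.+1.
  by move/hJ; rewrite inordK.
have := h 0%N isT; have := h 1%N isT; have := h 2 isT; have := h 3 isT.
rewrite parab4E !inE => {h hJ}.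
set b0 := inord 0 \in J; set b1 := inord 1 \in J; set b2 := inord 2 \in J; set b3 := inord 3 \in J.
move=> h3 h2 h1 h0.
(* Replacing the target by an arbitrary subgroup containing the generators outside [J] avoids
   describing the sixteen generated subgroups. *)
suff main (T : {group gT}) : (~~ b0 -> r0 \in T) -> (~~ b1 -> r1 \in T) ->
    (~~ b2 -> r2 \in T) -> (~~ b3 -> r3 \in T) -> x \in T.
  by apply: (main <<_>>%G) => h; apply: mem_gen; rewrite inE h eqxx ?orbT.
have gT3 (u v w : gT) : u \in T -> v \in T -> w \in T -> <<[set u; v; w]%SET>> \subset T.
  move=> uT vT wT; rewrite gen_subG; apply/fintype.subsetP => y.
  by rewrite !inE -orbA => /or3P [] /eqP ->.
move=> m0 m1 m2 m3; move: m0 m1 m2 m3 h3 h2 h1 h0.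
have g03 : x \in <<[set r0; r3]%SET>> -> exists b c : bool, x = r0 ^+ b * r3 ^+ c.
  exact: gen2_comm i0 i3 c03.
case: b0; case: b1; case: b2; case: b3 => m0 m1 m2 m3 h3 h2 h1 h0;
  try have {h0} h0 := h0 isT; try have {h1} h1 := h1 isT;
  try have {h2} h2 := h2 isT; try have {h3} h3 := h3 isT;
  try have {m0} m0 := m0 isT; try have {m1} m1 := m1 isT;
  try have {m2} m2 := m2 isT; try have {m3} m3 := m3 isT.
- have x23 := inter_12 h0 h1; have x01 := inter_34 h2 h3.
  rewrite fstabA in h3; rewrite fstabB in h0.
  case: (i23A x23 h3) (i01B x01 h0) => -> // [] // e; first by rewrite e group1.
  by case: rank4_neq12.
- have [b [c e]] := g03 (inter_23 h1 h2); rewrite fstabB in h0.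
  move: h0; rewrite e (groupMr _ (groupX c r3B)); case: b {e}.
    by rewrite expg1 (negbTE r0B).
  by rewrite expg0 mul1g groupX.
- have x23 := inter_12 h0 h1; rewrite fstabA in h3.
  by case: (i23A x23 h3) => -> //; rewrite group1.
- exact: (fintype.subsetP (sub2 m2 m3)) (inter_12 h0 h1).
- have x01 := inter_34 h2 h3; rewrite fstabB in h0.
  by case: (i01B x01 h0) => -> //; rewrite group1.
- exact: (fintype.subsetP (sub2 m1 m3)) (inter_13 h0 h2).
- exact: (fintype.subsetP (sub2 m1 m2)) (inter_14 h0 h3).
- by rewrite fstabB in h0; apply: (fintype.subsetP (gT3 _ _ _ m3 m2 m1)).
- have [b [c e]] := g03 (inter_23 h1 h2); rewrite fstabA in h3.
  move: h3; rewrite e (groupMl _ (groupX b r0A)); case: c {e}.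
    by rewrite expg1 (negbTE r3A).
  by rewrite expg0 mulg1 groupX.
- exact: (fintype.subsetP (sub2 m0 m3)) (inter_23 h1 h2).
- exact: (fintype.subsetP (sub2 m0 m2)) (inter_24 h1 h3).
- by rewrite fstab_2 in h1; apply: (fintype.subsetP (gT3 _ _ _ m0 m2 m3)).
- exact: (fintype.subsetP (sub2 m0 m1)) (inter_34 h2 h3).
- by rewrite fstab_3 in h2; apply: (fintype.subsetP (gT3 _ _ _ m3 m0 m1)).
- by rewrite fstabA in h3; apply: (fintype.subsetP (gT3 _ _ _ m0 m1 m2)).
have : x \in [set: gT]%SET by [].
rewrite -gens; apply: fintype.subsetP; rewrite gen_subG; apply/fintype.subsetP => y.
by rewrite !inE -!orbA => /or4P [] /eqP ->.
Qed.

Let fstab4_0 : fstab S 0 = [set: gT]%SET. Proof. exact: fstab0. Qed.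
Let fstab4_5 : fstab S 5 = [set: gT]%SET. Proof. exact: (@fstabn 4 S). Qed.

Let tri_stabA k z : (k <= 4)%N ->
  (z \in tri_stab r0 r1 r2 k) = (z \in A) && (z \in fstab S k).
Proof.
case: k => [|[|[|[|[|//]]]]] _; rewrite ?fstab4_0 ?fstabA ?inE ?andbT ?andbb //=.
- apply/idP/andP => [h|[zA zB]]; last by apply: inter_14; rewrite ?fstabA.
  by rewrite fstabB (fintype.subsetP (sub2 r1A r2A) _ h) (fintype.subsetP (sub2 r1B r2B) _ h).
- apply/idP/andP => [h|[zA z2]]; last by apply: inter_24; rewrite ?fstabA.
  rewrite (fintype.subsetP (sub2 r0A r2A) _ h) fstab_2; split=> //.
  by apply: fintype.subsetP h; apply: sub2; apply: mem_gen; rewrite !inE eqxx ?orbT.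
- apply/idP/andP => [h|[zA z2]]; last by apply: inter_34; rewrite ?fstabA.
  rewrite (fintype.subsetP (sub2 r0A r1A) _ h) fstab_3; split=> //.
  by apply: fintype.subsetP h; apply: sub2; apply: mem_gen; rewrite !inE eqxx ?orbT.
Qed.

Let tri_stabB k z : (k <= 4)%N ->
  (z \in tri_stab r3 r2 r1 k) = (z \in B) && (z \in fstab S (5 - k)).
Proof.
case: k => [|[|[|[|[|//]]]]] _; rewrite ?subn0 ?fstab4_5 ?fstabB ?inE ?andbT //=.
- apply/idP/andP => [h|[zB zA]].
    by rewrite (fintype.subsetP (sub2 r2B r1B) _ h) fstabA (fintype.subsetP (sub2 r2A r1A) _ h).
  by rewrite finset.setUC; apply: inter_14; rewrite ?fstabB.
- apply/idP/andP => [h|[zB z3]].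
    rewrite (fintype.subsetP (sub2 r3B r1B) _ h) fstab_3; split=> //.
    by apply: fintype.subsetP h; apply: sub2; apply: mem_gen; rewrite !inE eqxx ?orbT.
  by rewrite finset.setUC; apply: inter_13; rewrite ?fstabB.
- apply/idP/andP => [h|[zB z3]].
    rewrite (fintype.subsetP (sub2 r3B r2B) _ h) fstab_2; split=> //.
    by apply: fintype.subsetP h; apply: sub2; apply: mem_gen; rewrite !inE eqxx ?orbT.
  by rewrite finset.setUC; apply: inter_12; rewrite ?fstabB.
- by rewrite andbb.
Qed.

Let kernelA x : EA x = 1 -> x.1 = (false, 0%R) /\ translation_lattice p x.2.
Proof.
move=> e; have l : translation_lattice p x.2 by apply: interA; rewrite e group1.
by split=> //; apply: dihA; move: e; rewrite /tri_elt latA // mulg1.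
Qed.

Let kernelB x : EB x = 1 -> x.1 = (false, 0%R) /\ translation_lattice q x.2.
Proof.
move=> e; have l : translation_lattice q x.2 by apply: interB; rewrite e group1.
by split=> //; apply: dihB; move: e; rewrite /tri_elt latB // mulg1.
Qed.

Let chain3 (F1 F2 F3 : face S) : (F1 <= F2)%O -> (F2 <= F3)%O ->
  exists x, [/\ x \in face_set F1, x \in face_set F2 & x \in face_set F3].
Proof.
move=> le12 le23; have le13 := le_trans le12 le23.
have [x sub] : exists x, [set F1; F2; F3]%SET \subset flag_of x.
  apply: chain_common; apply/forall_inP => F FC; apply/forall_inP => F' F'C.
  by move: FC F'C; rewrite !inE -!orbA => /or3P [] /eqP -> /or3P [] /eqP ->;
    rewrite /Order.comparable ?lexx ?le12 ?le23 ?le13 ?orbT.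
exists x; have h := fintype.subsetP sub; split;
  [have := h F1|have := h F2|have := h F3]; by rewrite !inE eqxx ?orbT => /(_ isT).
Qed.

Lemma rank4_facets : has_facets (@face_rank 4 S) p.
Proof.
move=> F rkF.
have idF : face_idx F = 4 :> nat by apply/eqP; rewrite -face_rankE; apply/eqP.
have [g gF] := face_ex F.
have stF x : x \in face_set F -> x * g^-1 \in A.
  by move=> xF; have := face_set_mul gF xF; rewrite idF fstabA.
apply: (torus_iso relA latA kernelA (A := [set H : face S | (H <= F)%O])
  (le := fun x y => (x <= y)%O) (kap := fun H => nat_of_ord (face_idx H))
  (cos := fun H => [set y in A | y * g \in face_set H]%SET)).
- move=> H /= HF; have /face_leP [le [x [xH xF]]] := HF.
  have k4 : (face_idx H <= 4)%N by move: le; rewrite idF.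
  split=> //; exists (x * g^-1); first exact: stF.
  apply/setP => y; rewrite mem_rcoset (tri_stabA _ k4) inE invMg invgK mulgA.
  case: (boolP (y \in A)) => yA.
    have yxA : y * g * x^-1 \in A.
      by have := groupM yA (groupVr (stF x xF)); rewrite invMg invgK mulgA.
    rewrite yxA /=; apply/idP/idP => h; first exact: (face_set_mul xH h).
    by have := face_set_mull xH h; rewrite mulgKV.
  apply/esym/negbTE/negP => /andP [h _]; case/negP: yA.
  by have := groupM h (stF x xF); rewrite !mulgA mulgKV mulgK.
- move=> H H' /= HF H'F; split.
    move=> HH'; have [x [xH xH' xF]] := chain3 HH' H'F.
    split; first by case/face_leP: HH'.
    by exists (x * g^-1); rewrite !inE stF // mulgKV xH xH'.
  case=> le [x []]; rewrite !inE => /andP [_ xH] /andP [_ xH'].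
  by apply/face_leP; split=> //; exists (x * g).
- by move=> H H' _ _ HH' H'H; apply/le_anti; rewrite HH' H'H.
move=> k x k4 xA; have k6 : (k < 6)%N by rewrite ltnS (leq_trans k4).
exists (@mkface 4 S (Ordinal k6) (x * g)); split=> //; last by apply/setIdP; split; last exact: mem_mkface_id.
apply/face_leP; split; first by rewrite /= idF.
exists (x * g); split; first exact: mem_mkface_id.
by apply: face_set_mull => //; rewrite idF fstabA.
Qed.

(** The facet argument for the generators read backwards, [r3], [r2], [r1]: reversing the order
    replaces the index [k] by [5 - k]. *)
Lemma rank4_vertex_figures : has_vertex_figures (@face_rank 4 S) q.
Proof.
move=> F rkF.
have idF : face_idx F = 1%N :> nat by apply/eqP; rewrite -face_rankE; apply/eqP.
have [g gF] := face_ex F.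
have stF x : x \in face_set F -> x * g^-1 \in B.
  by move=> xF; have := face_set_mul gF xF; rewrite idF fstabB.
have [] := torus_iso relB latB kernelB (A := [set H : face S | (F <= H)%O])
  (le := fun x y => (y <= x)%O) (kap := fun H => (5 - nat_of_ord (face_idx H))%N)
  (cos := fun H => [set y in B | y * g \in face_set H]%SET).
- move=> H /= HF; have /face_leP [le [x [xF xH]]] := HF.
  have k4 : (5 - face_idx H <= 4)%N.
    by rewrite idF in le; rewrite leq_subLR -[5]/(1 + 4)%N leq_add2r.
  have k5 : (5 - (5 - face_idx H) = face_idx H)%N by rewrite subKn // -ltnS.
  split=> //; exists (x * g^-1); first exact: stF.
  apply/setP => y; rewrite mem_rcoset (tri_stabB _ k4) k5 inE invMg invgK mulgA.
  case: (boolP (y \in B)) => yA.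
    have yxA : y * g * x^-1 \in B.
      by have := groupM yA (groupVr (stF x xF)); rewrite invMg invgK mulgA.
    rewrite yxA /=; apply/idP/idP => h; first exact: (face_set_mul xH h).
    by have := face_set_mull xH h; rewrite mulgKV.
  apply/esym/negbTE/negP => /andP [h _]; case/negP: yA.
  by have := groupM h (stF x xF); rewrite !mulgA mulgKV mulgK.
- move=> H H' /= HF H'F; split.
    move=> HH'; have [x [xF xH' xH]] := chain3 H'F HH'.
    split; first by case/face_leP: HH' => ? _; apply: leq_sub2l.
    by exists (x * g^-1); rewrite !inE stF // mulgKV xH xH'.
  case=> le [x []]; rewrite !inE => /andP [_ xH] /andP [_ xH'].
  apply/face_leP; split; last by exists (x * g).
  by move: le; apply: leq_sub2lK; rewrite -ltnS.
- by move=> H H' _ _ HH' H'H; apply/le_anti; rewrite HH' H'H.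
- move=> k x k4 xA; have k6 : (5 - k < 6)%N by rewrite ltnS leq_subr.
  exists (@mkface 4 S (Ordinal k6) (x * g)); split; last by apply/setIdP; split; last exact: mem_mkface_id.
    apply/face_leP; split; first by rewrite idF /= subn_gt0 ltnS.
    exists (x * g); split; last exact: mem_mkface_id.
    by apply: face_set_mull => //; rewrite idF fstabB.
  by rewrite /= subKn // (leq_trans k4).
by move=> f fbij fle; exists f => // x y xF yF; apply: fle.
Qed.

(** * The medial layer graph of the coset polytope *)

Local Notation P := (face S).
Local Notation rk := (@face_rank 4 S).
Local Notation G := (medial_layer_graph rk).

Let k2 : 'I_6 := @Ordinal 6 2 isT.
Let k3 : 'I_6 := @Ordinal 6 3 isT.

Let mv_subproof (b : bool) x :
  (rk (mkface (if b then k3 else k2) x : P) == 1%R) ||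
  (rk (mkface (if b then k3 else k2) x : P) == 2%R).
Proof. by case: b. Qed.

Definition medial_vertex (b : bool) (x : gT) : G :=
  exist (fun F : P => (rk F == 1%R) || (rk F == 2%R)) _ (mv_subproof b x).
Local Notation mv := medial_vertex.

Let mv_surj (v : G) : exists b x, v = mv b x.
Proof.
case: v => F hF; have [x xF] := face_ex F.
have hid : face_idx F = 2 :> nat \/ face_idx F = 3 :> nat.
  by by case/orP: (hF); rewrite face_rankE => /eqP; [left|right].
case: hid => hid; [exists false, x|exists true, x]; apply: val_inj => /=;
  by rewrite (faceE xF); congr mkface; apply: val_inj.
Qed.

Let mv_eq b x y : (mv b x == mv b y) = (x * y^-1 \in fstab S (b + 2)).
Proof. by rewrite -(inj_eq val_inj) /= mkface_eq; case: b. Qed.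

Let mv_neq x y : mv false x <> mv true y.
Proof. by move=> /(congr1 val) /= /(congr1 (@face_idx 4 S)). Qed.

Let edge_mv b x y : @edge G (mv b x) (mv (~~ b) y) ->
  exists2 z, mv b x = mv b z & mv (~~ b) y = mv (~~ b) z.
Proof.
case/andP => _ cmp.
have [z [zx zy]] : exists z, z \in face_set (val (mv b x)) /\ z \in face_set (val (mv (~~ b) y)).
  by case/orP: cmp => /face_leP [_ [z [h h']]]; exists z.
exists z; apply: val_inj => /=.
  exact: (faceE zx).
exact: (faceE zy).
Qed.

Let mv_edge b z : @edge G (mv b z) (mv (~~ b) z).
Proof.
apply/andP; split.
  by case: b; apply/eqP => // /esym; apply: mv_neq.
case: b; apply/orP; [right|left]; apply/face_leP;
 by split=> //; exists z; rewrite !mem_mkface_id.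
Qed.

Let edge_same b x y : @edge G (mv b x) (mv b y) = false.
Proof.
apply/negbTE/negP => /andP [/eqP ne cmp]; apply: ne; apply: val_inj.
by case/orP: cmp => h; [|symmetry]; apply/eqP; rewrite eq_le h;
  apply: comparable_le => //; rewrite /Order.comparable h orbT.
Qed.

Let mact_subproof g (v : G) :
  (rk (face_mul g (val v)) == 1%R) || (rk (face_mul g (val v)) == 2%R).
Proof. exact: (valP v). Qed.

Definition medial_mul g (v : G) : G :=
  exist (fun F : P => (rk F == 1%R) || (rk F == 2%R)) _ (mact_subproof g v).

Let medial_mul_mv g b x : medial_mul g (mv b x) = mv b (x * g).
Proof. by apply: val_inj; rewrite /= face_mul_mk. Qed.

Let medial_mul_inj g : injective (medial_mul g).
Proof. by move=> u v /(congr1 val) /= /face_mul_inj /val_inj. Qed.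

Definition medial_perm g : {perm G} := perm (@medial_mul_inj g).
Local Notation a := medial_perm.

Let a_mv g b x : a g (mv b x) = mv b (x * g).
Proof. by rewrite permE medial_mul_mv. Qed.

Let aM g h : a (g * h) = a g * a h.
Proof.
by apply/permP => v; have [b [x ->]] := mv_surj v; rewrite permM !a_mv mulgA.
Qed.

Let a_aut g : a g \in graph_aut G.
Proof.
apply/graph_autP => u v; rewrite /edge /= /incident (inj_eq perm_inj) !permE /=.
by rewrite /Order.comparable !face_mul_le.
Qed.

Let r0_2 : r0 \in fstab S 2. Proof. by rewrite fstab_2 mem_gen // !inE eqxx ?orbT. Qed.
Let r2_2 : r2 \in fstab S 2. Proof. by rewrite fstab_2 mem_gen // !inE eqxx ?orbT. Qed.
Let r3_2 : r3 \in fstab S 2. Proof. by rewrite fstab_2 mem_gen // !inE eqxx ?orbT. Qed.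
Let r0_3 : r0 \in fstab S 3. Proof. by rewrite fstab_3 mem_gen // !inE eqxx ?orbT. Qed.
Let r1_3 : r1 \in fstab S 3. Proof. by rewrite fstab_3 mem_gen // !inE eqxx ?orbT. Qed.
Let r3_3 : r3 \in fstab S 3. Proof. by rewrite fstab_3 mem_gen // !inE eqxx ?orbT. Qed.

Let fstab2_dih y : y \in <<[set r2; r3]%SET>> ->
  [\/ mv true y = mv true 1, mv true y = mv true r2 | mv true y = mv true (r2 * r3)].
Proof.
have l x : mv true (r3 * x) = mv true x by apply/eqP; rewrite mv_eq mulgK.
have br := braid3 i2 i3 o23.
move/(gen2_dih3 i2 i3 o23); rewrite !inE => /orP [|/orP [|/orP [|/orP [|/orP []]]]] /eqP ->.
- by constructor 1.
- by constructor 2.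
- by constructor 1; rewrite -[r3]mulg1 l.
- by constructor 3.
- by constructor 2; rewrite l.
- by constructor 3; rewrite br -mulgA l.
Qed.

Let fstab3_dih y : y \in <<[set r0; r1]%SET>> ->
  [\/ mv false y = mv false 1, mv false y = mv false r1 | mv false y = mv false (r1 * r0)].
Proof.
have l x : mv false (r0 * x) = mv false x by apply/eqP; rewrite mv_eq mulgK.
have br := braid3 i0 i1 o01.
move/(gen2_dih3 i0 i1 o01); rewrite !inE => /orP [|/orP [|/orP [|/orP [|/orP []]]]] /eqP ->.
- by constructor 1.
- by constructor 1; rewrite -[r0]mulg1 l.
- by constructor 2.
- by constructor 2; rewrite l.
- by constructor 3.
- by constructor 3; rewrite -mulgA l.
Qed.

Let nbr0 : [set w | @edge G (mv false 1) w]%SET =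
  [set mv true 1; a r2 (mv true 1); a (r2 * r3) (mv true 1)]%SET.
Proof.
apply/setP => w; rewrite !a_mv !mul1g !inE -orbA; apply/idP/or3P.
  have [[] [x ->]] := mv_surj w; last by rewrite edge_same.
  case/edge_mv => z e ->; move/eqP: e; rewrite eq_sym mv_eq invg1 mulg1 fstab_2.
  case/(gen3_comm i0 c02 c03) => b [y [/fstab2_dih y23 ->]].
  have -> : mv true (r0 ^+ b * y) = mv true y by apply/eqP; rewrite mv_eq mulgK groupX.
  by case: y23 => ->; [constructor 1|constructor 2|constructor 3].
have e x : x \in fstab S 2 -> @edge G (mv false 1) (mv true x).
  move=> h; have -> : mv false 1 = mv false x by apply/eqP; rewrite eq_sym mv_eq invg1 mulg1.
  exact: (mv_edge false).
by case=> /eqP ->; apply: e; rewrite ?groupM ?group1.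
Qed.

Let nbr1 : [set w | @edge G (mv true 1) w]%SET =
  [set mv false 1; a r1 (mv false 1); a (r1 * r0) (mv false 1)]%SET.
Proof.
apply/setP => w; rewrite !a_mv !mul1g !inE -orbA; apply/idP/or3P.
  have [[] [x ->]] := mv_surj w; first by rewrite edge_same.
  case/edge_mv => z e ->; move/eqP: e; rewrite eq_sym mv_eq invg1 mulg1 fstab_3.
  case/(gen3_comm i3 (commute_sym c03) (commute_sym c13)) => b [y [/fstab3_dih y23 ->]].
  have -> : mv false (r3 ^+ b * y) = mv false y by apply/eqP; rewrite mv_eq mulgK groupX.
  by case: y23 => ->; [constructor 1|constructor 2|constructor 3].
have e x : x \in fstab S 3 -> @edge G (mv true 1) (mv false x).
  move=> h; have -> : mv true 1 = mv true x by apply/eqP; rewrite eq_sym mv_eq invg1 mulg1.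
  exact: (mv_edge true).
by case=> /eqP ->; apply: e; rewrite ?groupM ?group1.
Qed.

Let r1_2 : r1 \notin fstab S 2.
Proof. by have := rank4_gen_notin (@Ordinal 4 1 isT). Qed.
Let r2_3 : r2 \notin fstab S 3.
Proof. by have := rank4_gen_notin (@Ordinal 4 2 isT). Qed.

Let n0 : #|[set mv true 1; a r2 (mv true 1); a (r2 * r3) (mv true 1)]%SET| = 3.
Proof.
have v2 : r2^-1 = r2 := invg_invol i2.
have e1 : (mv true 1 == mv true r2) = false.
  by rewrite mv_eq mul1g groupV; apply: negbTE.
have e2 : (mv true (r2 * r3) == mv true 1) = false.
  by rewrite mv_eq invg1 mulg1 groupMr //; apply: negbTE.
have e3 : (mv true (r2 * r3) == mv true r2) = false.
  rewrite mv_eq v2 (braid3 i2 i3 o23) groupMr // groupMl //; exact: negbTE.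
by rewrite !a_mv !mul1g finset.setUC cardsU1 cards2 in_set2 e1 e2 e3.
Qed.

Let n1 : #|[set mv false 1; a r1 (mv false 1); a (r1 * r0) (mv false 1)]%SET| = 3.
Proof.
have v1 : r1^-1 = r1 := invg_invol i1.
have e1 : (mv false 1 == mv false r1) = false.
  by rewrite mv_eq mul1g groupV; apply: negbTE.
have e2 : (mv false (r1 * r0) == mv false 1) = false.
  by rewrite mv_eq invg1 mulg1 groupMr //; apply: negbTE.
have e3 : (mv false (r1 * r0) == mv false r1) = false.
  rewrite mv_eq v1 (braid3 i1 i0 o10) groupMr // groupMl //; exact: negbTE.
by rewrite !a_mv !mul1g finset.setUC cardsU1 cards2 in_set2 e1 e2 e3.
Qed.

(** Origin of the constant 12: [fstab S 2] consists of a power of [r0] times one of six words in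
    [r2], [r3]. An element is recovered from its coset and its offset from the chosen
    representative. *)
Lemma card_le_medial : (#|gT| <= 12 * #|G|)%N.
Proof.
have c12 : (#|fstab S 2| <= 12)%N.
  pose l := [seq r0 ^+ (b : bool) * y | b <- [:: false; true], y <- [:: 1; r2; r3; r2 * r3; r3 * r2; r2 * r3 * r2]].
  apply: leq_trans (card_size l); apply: subset_leq_card; apply/fintype.subsetP => x.
  rewrite fstab_2 => /(gen3_comm i0 c02 c03) [b [y [/(gen2_dih3 i2 i3 o23) y23 ->]]].
  by apply: (allpairs_f (fun (b : bool) (y : gT) => r0 ^+ b * y) _ y23); case: b.
pose h x := (mv false x, x * (repr (face_set (@mkface 4 S k2 x)))^-1).
have hinj : injective h.
  move=> x y; rewrite /h => -[e1 e2].
  have e : @mkface 4 S k2 x = @mkface 4 S k2 y by apply: val_inj => /=; rewrite e1.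
  by rewrite e in e2; apply: mulIg e2.
have sub : [set h x | x : gT]%SET \subset finset.setX [set: G]%SET (fstab S 2).
  apply/fintype.subsetP => _ /imsetP [x _ ->]; rewrite inE finset.in_setT andTb.
  have m := @mem_mkface_id 4 S k2 x.
  exact: (face_set_mul (mem_repr _ m) m).
have := subset_leq_card sub; rewrite card_imset // cardsX cardsT => le.
by apply: leq_trans le _; rewrite mulnC leq_mul2r c12 orbT.
Qed.

Let a1 : a 1 = 1.
Proof. by apply: (mulgI (a 1)); rewrite -aM !mulg1. Qed.
Let aV x : a x^-1 = (a x)^-1.
Proof. by apply: (mulgI (a x)); rewrite -aM !mulgV. Qed.
Let aX x k : a (x ^+ k) = a x ^+ k.
Proof. by elim: k => [|k IH]; rewrite ?expg0 // !expgS aM IH. Qed.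

(** An element acting trivially fixes both base vertices, so it is [r0 ^+ b * r3 ^+ c]. Fixing also
    the neighbour moved by [r1] excludes [r0], and the one moved by [r2] excludes [r3]. *)
Let a_faithful x : a x = 1 -> x = 1.
Proof.
move=> e.
have fixx (b : bool) y : y * x * y^-1 \in fstab S (b + 2).
  by rewrite -mv_eq -a_mv e perm1.
have x2 : x \in fstab S 2 by have := fixx false 1; rewrite mul1g invg1 mulg1.
have x3 : x \in fstab S 3 by have := fixx true 1; rewrite mul1g invg1 mulg1.
have v1 : r1^-1 = r1 := invg_invol i1.
have v2 : r2^-1 = r2 := invg_invol i2.
have [b [c xE]] := gen2_comm i0 i3 c03 (inter_23 x2 x3).
have h1 := fixx false r1; have h2 := fixx true r2.
rewrite xE v1 -!mulgA in h1; rewrite xE v2 in h2.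
have c31 : r3 ^+ c * r1 = r1 * r3 ^+ c by apply/esym/commuteX.
have c20 : r2 * r0 ^+ b = r0 ^+ b * r2 by apply/commuteX/commute_sym.
rewrite c31 !mulgA (groupMr _ (groupX c r3_2)) in h1.
rewrite mulgA c20 -!mulgA (groupMl _ (groupX b r0_3)) in h2.
have b0 : b = false.
  apply: contraNF r1_2 => bT; move: h1; rewrite bT expg1 (braid3 i1 i0 o10).
  by rewrite groupMr // groupMl.
have c0 : c = false.
  apply: contraNF r2_3 => cT; move: h2; rewrite cT expg1 mulgA (braid3 i2 i3 o23).
  by rewrite groupMr // groupMl.
by rewrite xE b0 c0 !expg0 mulg1.
Qed.

Hypothesis lattice_neq : ~ (forall v, translation_lattice p v <-> translation_lattice q v).

(** Such a [g] carries the translations of the facets to those of the vertex-figures with the same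
    coordinates, so the same vectors would act trivially in both and the two lattices would
    coincide. *)
Lemma rank4_no_duality (g : {perm G}) :
  ~ [/\ a r0 ^ g = a r3, a r1 ^ g = a r2, a r2 ^ g = a r1 & a r3 ^ g = a r0].
Proof.
case=> g0 g1 g2 g3; apply: lattice_neq.
have t1 : a (tr1 r0 r1 r2) ^ g = a (tr1 r3 r2 r1).
  have e x y z : a (x * (y * x) ^+ 3 * z) = a x * (a y * a x) ^+ 3 * a z.
    by rewrite 2!aM aX aM.
  by rewrite /tr1 !e 2!conjMg conjXg conjMg g0 g1 g2.
have t2 : a (tr2 r0 r1 r2) ^ g = a (tr2 r3 r2 r1).
  have aJ x y : a (x ^ y) = a x ^ a y by rewrite !conjgE !aM aV.
  by rewrite /tr2 !aJ conjJg t1 g1.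
have tE v : a (tri_trans r0 r1 r2 v) ^ g = a (tri_trans r3 r2 r1 v).
  by rewrite /tri_trans [a (_ * _)]aM [X in _ = X]aM !(zexpg_hom aM) conjMg !zexpgJ t1 t2.
move=> v; split=> h.
  suff e : tri_trans r3 r2 r1 v = 1.
    by have [] := @kernelB (false, 0%R, v); rewrite // tri_elt_trans.
  by apply: a_faithful; rewrite -tE (latA h) a1 conj1g.
suff e : tri_trans r0 r1 r2 v = 1.
  by have [] := @kernelA (false, 0%R, v); rewrite // tri_elt_trans.
apply: a_faithful; apply: (@conjg_inj _ g).
by rewrite tE (latB h) a1 conj1g.
Qed.

Hypothesis big : (12 * 4 ^ 6 < #|gT|)%N.

Let orbG v : exists x, v = a x (mv false 1) \/ v = a x (mv true 1).
Proof.
have [b [x ->]] := mv_surj v; exists x.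
by rewrite !a_mv !mul1g; case: b; [right|left].
Qed.

Let typesG x : a x (mv false 1) <> mv true 1.
Proof. by rewrite a_mv; apply: mv_neq. Qed.

Lemma rank4_graph : valent G 3 /\ semisymmetric G.
Proof.
have fixE (b : bool) r : r \in fstab S (b + 2) -> a r (mv b 1) = mv b 1.
  by move=> h; rewrite a_mv mul1g; apply/eqP; rewrite mv_eq invg1 mulg1.
have bigG : (4 ^ 6 < #|G|)%N.
  by rewrite -(ltn_pmul2l (isT : 0 < 12)%N) (leq_trans big) // card_le_medial.
split.
  exact: (action_valent aM a_aut orbG nbr0 nbr1 n0 n1).
apply: (action_semisymmetric aM a_aut gens i0 i1 i2 i3 c02 c03 c13 o01 o12 o23
  orbG typesG _ _ _ _ _ _ nbr0 nbr1 n0 n1 bigG rank4_no_duality); exact: fixE.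
Qed.

Lemma rank4_medial_polytope : has_medial_polytope p q G.
Proof.
have [h1 h2] := rank4_graph; split=> //.
exists face_display, P, rk; split.
- exact: (coset_poset_polytope rank4_inter rank4_gen_notin).
- exact: coset_poset_regular.
- exact: rank4_facets.
- exact: rank4_vertex_figures.
- by exists id => //; exists id.
Qed.

End RankFour.

(** * Extension by the symmetric group *)

Section Hom.
Variables (gT hT : finGroupType) (f : gT -> hT).
Hypothesis fM : forall x y, f (x * y) = f x * f y.

Let hom1 : f 1 = 1.
Proof. by apply: (mulgI (f 1)); rewrite -fM !mulg1. Qed.

Let homX x k : f (x ^+ k) = f x ^+ k.
Proof. by elim: k => [|k IH]; rewrite ?expg0 ?hom1 // !expgS fM IH. Qed.

Lemma hom_tr1 a0 a1 a2 : f (tr1 a0 a1 a2) = tr1 (f a0) (f a1) (f a2).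
Proof. by rewrite /tr1 2!fM homX fM. Qed.

Lemma hom_tr2 a0 a1 a2 : f (tr2 a0 a1 a2) = tr2 (f a0) (f a1) (f a2).
Proof.
have fJ x y : f (x ^ y) = f x ^ f y.
  have fV z : f z^-1 = (f z)^-1 by apply: (mulgI (f z)); rewrite -fM !mulgV hom1.
  by rewrite !conjgE !fM fV.
by rewrite /tr2 fJ hom_tr1.
Qed.

Lemma hom_trans a0 a1 a2 v : f (tri_trans a0 a1 a2 v) = tri_trans (f a0) (f a1) (f a2) v.
Proof. by rewrite /tri_trans fM !(zexpg_hom fM) hom_tr1 hom_tr2. Qed.

Lemma hom_dih a1 a2 d : f (tri_dih a1 a2 d) = tri_dih (f a1) (f a2) d.
Proof. by rewrite /tri_dih fM !homX fM. Qed.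

Lemma hom_elt a0 a1 a2 x : f (tri_elt a0 a1 a2 x) = tri_elt (f a0) (f a1) (f a2) x.
Proof. by rewrite /tri_elt fM hom_dih hom_trans. Qed.

End Hom.

Section TransMul.
Variables (gT : finGroupType) (a0 a1 a2 : gT).
Hypothesis rel : triangle_relations a0 a1 a2.

Lemma tri_trans_mulz v (k : int) : tri_trans a0 a1 a2 (v *~ k)%R = zexpg (tri_trans a0 a1 a2 v) k.
Proof.
have E n : tri_trans a0 a1 a2 (v *+ n)%R = zexpg (tri_trans a0 a1 a2 v) n.
  elim: n => [|n IH]; first by rewrite zexpg0 tri_trans0.
  by rewrite GRing.mulrS (tri_transD rel) IH intS zexpgD zexpg1.
case: k => n; first exact: E.
by rewrite NegzE mulrNz (tri_transN rel) zexpgN -E.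
Qed.
End TransMul.

Section Wreath.
Variable Q : finGroupType.

(* [wr h c] represents the element [(h, c)] of the wreath product of [Q] by ['S_3]
   as a permutation of [Q * 'S_3]. *)
Definition wr_fun (h : 'S_3 -> Q) (c : 'S_3) (x : Q * 'S_3) : Q * 'S_3 :=
  (x.1 * h x.2, c * x.2).

Lemma wr_inj h c : injective (wr_fun h c).
Proof. by move=> [x u] [y v] [e /mulgI uv]; move: e; rewrite uv => /mulIg ->. Qed.

Definition wr h c : {perm Q * 'S_3} := perm (@wr_inj h c).

Lemma wrE h c x u : wr h c (x, u) = (x * h u, c * u).
Proof. by rewrite permE. Qed.

Lemma wrM h c h' c' : wr h c * wr h' c' = wr (fun u => h u * h' (c * u)) (c' * c).
Proof. by apply/permP => -[x u]; rewrite permM !wrE !mulgA. Qed.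

Lemma eq_wr h h' c c' : h =1 h' -> c = c' -> wr h c = wr h' c'.
Proof. by move=> e ->; apply/permP => -[x u]; rewrite !wrE e. Qed.

Lemma wr1 : wr (fun=> 1) 1 = 1.
Proof. by apply/permP => -[x u]; rewrite wrE perm1 mulg1 mul1g. Qed.

Lemma wrX h k : wr h 1 ^+ k = wr (fun u => h u ^+ k) 1.
Proof.
elim: k => [|k IH]; first by rewrite expg0 -wr1; apply: eq_wr => // u; rewrite expg0.
by rewrite expgS IH wrM; apply: eq_wr => [u|]; rewrite ?mulg1 // mul1g expgS.
Qed.

Lemma wrV h : (wr h 1)^-1 = wr (fun u => (h u)^-1) 1.
Proof.
apply/eqP; rewrite eq_invg_mul wrM -wr1; apply/eqP/eq_wr => [u|]; last by rewrite mulg1.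
by rewrite mul1g mulgV.
Qed.

Lemma wr_zexpg h m : zexpg (wr h 1) m = wr (fun u => zexpg (h u) m) 1.
Proof.
case: m => k; first by rewrite zexpg_nat wrX; apply: eq_wr => // u; rewrite zexpg_nat.
rewrite NegzE zexpgN zexpg_nat wrX wrV; apply: eq_wr => // u.
by rewrite zexpgN zexpg_nat.
Qed.

Lemma wr_eq1 h c : wr h c = 1 -> (forall u, h u = 1) /\ c = 1.
Proof.
move=> /permP e; split=> [u|].
  by have := e (1, u); rewrite wrE perm1 mul1g => -[].
by have := e (1, 1); rewrite wrE perm1 mulg1 => -[].
Qed.

Lemma wr_eq h c h' c' : wr h c = wr h' c' -> h =1 h' /\ c = c'.
Proof.
move=> /permP e; split=> [u|].
  by have := e (1, u); rewrite !wrE !mul1g => -[].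
by have := e (1, 1); rewrite !wrE !mulg1 => -[].
Qed.

Variables (s : 'I_3 -> Q) (t0 : Q).
Let j0 : 'I_3 := @Ordinal 3 0 isT.
Let j1 : 'I_3 := @Ordinal 3 1 isT.
Let j2 : 'I_3 := @Ordinal 3 2 isT.

Hypothesis s_invol : forall i, s i * s i = 1.
Hypothesis t_invol : t0 * t0 = 1.
Hypothesis ss3 : forall i j, i != j -> (s i * s j) ^+ 3 = 1.
Hypothesis st3 : forall i, (s i * t0) ^+ 3 = 1.
Variables (sn tn : int).
Hypothesis sss : forall i j k, i != j -> i != k -> j != k ->
  zexpg (s i * s j * s i * s k) sn = 1.
Hypothesis sst : forall i j, i != j -> zexpg (s i * s j * s i * t0) tn = 1.

Definition wX := s j0 * s j1 * s j0 * s j2.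
Definition wY := s j0 * s j1 * s j0 * t0.

Hypothesis indepX : forall m n : int,
  zexpg wX m * zexpg (wX ^ s j0) n \in <<[set s j0; s j1; t0]%SET>> ->
  (sn %| m)%Z /\ (sn %| n)%Z.
Hypothesis indepY : forall m n : int,
  zexpg wY m * zexpg (wY ^ s j0) n \in <<[set s j0; s j1; s j2]%SET>> ->
  (tn %| m)%Z /\ (tn %| n)%Z.
Hypotheses (s0_nt : s j0 <> 1) (s1_nt : s j1 <> 1) (s01 : s j0 <> s j1).

(** A permutation of the generators [s] need not extend to an automorphism of [Q]. So all six
    relabellings are used at once, one per coordinate [u] in ['S_3], and ['S_3] permutes the
    coordinates. Relations symmetric in the indices of [s] can then be checked coordinatewise. *)
Definition wr_s i : {perm Q * 'S_3} := wr (fun u => s (u i)) 1.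
Definition wr_t : {perm Q * 'S_3} := wr (fun=> t0) 1.
Definition wr_c c : {perm Q * 'S_3} := wr (fun=> 1) c.
Local Notation r0 := (wr_c (tperm j1 j2)).
Local Notation r1 := (wr_c (tperm j0 j1)).
Local Notation r2 := (wr_s j0).
Local Notation r3 := wr_t.

Lemma wr_sJ c i : wr_c c * wr_s i = wr_s (c i) * wr_c c.
Proof.
rewrite /wr_c /wr_s !wrM; apply: eq_wr => [u|]; last by rewrite mul1g mulg1.
by rewrite mul1g mulg1 permM.
Qed.

Lemma wr_tJ c : wr_c c * wr_t = wr_t * wr_c c.
Proof. by rewrite /wr_c /wr_t !wrM; apply: eq_wr => [u|]; rewrite !mul1g !mulg1. Qed.

Lemma wr_cM c d : wr_c c * wr_c d = wr_c (d * c).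
Proof. by rewrite /wr_c wrM; apply: eq_wr => // u; rewrite mul1g. Qed.

Lemma wr_s_invol i : wr_s i * wr_s i = 1.
Proof.
rewrite /wr_s wrM -wr1; apply: eq_wr => [u|]; last by rewrite mul1g.
by rewrite mul1g s_invol.
Qed.

Lemma wr_t_invol : wr_t * wr_t = 1.
Proof. by rewrite /wr_t wrM -wr1; apply: eq_wr => [u|]; rewrite ?t_invol ?mul1g. Qed.

Lemma wr_c_invol i j : wr_c (tperm i j) * wr_c (tperm i j) = 1.
Proof. by rewrite wr_cM tperm2 /wr_c wr1. Qed.

Lemma wr_ss3 i j : i != j -> (wr_s i * wr_s j) ^+ 3 = 1.
Proof.
move=> ij; rewrite /wr_s wrM mul1g wrX -wr1; apply: eq_wr => // u.
by rewrite mul1g ss3 // (inj_eq perm_inj).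
Qed.

Lemma wr_st3 i : (wr_s i * wr_t) ^+ 3 = 1.
Proof.
by rewrite /wr_s /wr_t wrM mul1g wrX -wr1; apply: eq_wr => // u.
Qed.

Let r1s0 : r1 * wr_s j0 = wr_s j1 * r1. Proof. by rewrite wr_sJ tpermL. Qed.
Let r1s1 : r1 * wr_s j1 = wr_s j0 * r1. Proof. by rewrite wr_sJ tpermR. Qed.
Let r0s0 : r0 * wr_s j0 = wr_s j0 * r0. Proof. by rewrite wr_sJ tpermD. Qed.
Let r0s1 : r0 * wr_s j1 = wr_s j2 * r0. Proof. by rewrite wr_sJ tpermL. Qed.

Let braid01 : wr_s j0 * wr_s j1 * wr_s j0 = wr_s j1 * wr_s j0 * wr_s j1.
Proof. by apply: braid3; rewrite ?wr_s_invol ?wr_ss3. Qed.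

Let rr1 := wr_c_invol j0 j1.
Let rr0 := wr_c_invol j1 j2.
Let ss := wr_s_invol.

Let c2E : (r1 * r2) ^+ 2 = wr_s j1 * wr_s j0.
Proof. by rewrite expgS expg1 {1}r1s0 -!mulgA (mulgA r1) rr1 mul1g. Qed.

Let c3E : (r1 * r2) ^+ 3 = r1 * (wr_s j0 * wr_s j1 * wr_s j0).
Proof. by rewrite expgS c2E !mulgA. Qed.

Let s01_2 : wr_s j0 * wr_s j1 * (wr_s j0 * wr_s j1) = wr_s j1 * wr_s j0.
Proof. by rewrite !mulgA braid01 -!mulgA ss mulg1. Qed.

Let tr1A : tr1 r0 r1 r2 = wr_s j1 * wr_s j0 * (r1 * r0).
Proof.
rewrite /tr1 c3E !mulgA -(mulgA (wr_s j0) r1) r1s0 !mulgA.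
rewrite -(mulgA _ r1 (wr_s j1)) r1s1 !mulgA -(mulgA _ r1 (wr_s j0)) r1s0 !mulgA.
by rewrite -(mulgA _ (wr_s j0) (wr_s j1)) s01_2.
Qed.

Let tr2A : tr2 r0 r1 r2 = wr_s j0 * wr_s j1 * (r0 * r1).
Proof.
rewrite /tr2 conjgE; have -> : r1^-1 = r1 by exact: invg_invol rr1.
rewrite tr1A !mulgA r1s1 -(mulgA (wr_s j0) r1) r1s0 !mulgA.
by rewrite -(mulgA _ r1 r1) rr1 mulg1.
Qed.

(** The unit translations of the facet carry a 3-cycle of ['S_3]; [(1, 1)] lies in the sublattice of
    index 3 on which the permutation part is trivial, and its order is read in [Q]. *)
Lemma wr_trans11 : tri_trans r0 r1 r2 (1, 1)%R = wr_s j0 * wr_s j1 * wr_s j0 * wr_s j2.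
Proof.
rewrite /tri_trans !zexpg1 tr1A tr2A !mulgA -(mulgA _ r0 (wr_s j0)) r0s0 !mulgA.
rewrite -(mulgA _ r0 (wr_s j1)) r0s1 !mulgA -(mulgA _ r0 r0) rr0 mulg1.
rewrite -(mulgA _ r1 (wr_s j0)) r1s0 !mulgA -(mulgA _ r1 (wr_s j2)) wr_sJ tpermD // !mulgA.
by rewrite -(mulgA _ r1 r1) rr1 mulg1 braid01.
Qed.

Let tr1B : tr1 r3 r2 r1 = wr_s j0 * wr_s j1 * wr_s j0 * wr_t.
Proof.
have e : (r2 * r1) ^+ 3 = wr_s j0 * wr_s j1 * wr_s j0 * r1.
  by rewrite !expgS expg0 mulg1 !mulgA -!(mulgA _ r1 (wr_s j0)) r1s0 !mulgA
     -(mulgA _ r1 r1) rr1 mulg1 -(mulgA _ r1 (wr_s j1)) r1s1 !mulgA.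
rewrite /tr1 e !mulgA r1s0 -(mulgA _ r1 (wr_s j1)) r1s1 !mulgA.
by rewrite -(mulgA _ r1 (wr_s j0)) r1s0 !mulgA -(mulgA _ r1 r1) rr1 mulg1 braid01.
Qed.

Let tr2B : tr2 r3 r2 r1 = (wr_s j0 * wr_s j1 * wr_s j0 * wr_t) ^ wr_s j0.
Proof. by rewrite /tr2 tr1B. Qed.

Let c01_3 : (r0 * r1) ^+ 3 = 1.
Proof.
rewrite wr_cM !expgS expg0 mulg1 !wr_cM -[RHS]wr1 /wr_c; congr wr.
have aba : tperm j0 j1 * tperm j1 j2 * tperm j0 j1 = tperm j0 j2.
  by rewrite -{1}(tpermV j0 j1) -mulgA -conjgE tpermJ tpermR tpermD.
have bab : tperm j1 j2 * tperm j0 j1 * tperm j1 j2 = tperm j0 j2.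
  by rewrite -{1}(tpermV j1 j2) -mulgA -conjgE tpermJ tpermL tpermD.
rewrite -!mulgA (mulgA (tperm j1 j2) (tperm j0 j1) (tperm j1 j2)).
rewrite bab -aba !mulgA -(mulgA _ (tperm j0 j1) (tperm j0 j1)) tperm2 mulg1.
by rewrite -(mulgA _ (tperm j1 j2) (tperm j1 j2)) tperm2 mulg1 tperm2.
Qed.

Lemma wr_relA : triangle_relations r0 r1 r2.
Proof.
split; [exact: rr0|exact: rr1|exact: ss|exact: r0s0|exact: c01_3|].
by rewrite (_ : 6 = 2 * 3)%N // expgM c2E wr_ss3.
Qed.

Lemma wr_relB : triangle_relations r3 r2 r1.
Proof.
split; [exact: wr_t_invol|exact: ss|exact: rr1|by rewrite /commute wr_tJ| |].
  by apply: invol_expgC; [exact: ss|exact: wr_t_invol|exact: wr_st3].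
exact: invol_expgC rr1 (ss j0) (tri_ord12 wr_relA).
Qed.

Lemma wr_trans11E (n : int) :
  zexpg (tri_trans r0 r1 r2 (1, 1)%R) n =
  wr (fun u => zexpg (s (u j0) * s (u j1) * s (u j0) * s (u j2)) n) 1.
Proof.
by rewrite wr_trans11 /wr_s !wrM -wr_zexpg; congr zexpg; apply: eq_wr => [u|]; rewrite !mul1g.
Qed.

Lemma wr_trans21E (n : int) :
  zexpg (tri_trans r0 r1 r2 (2, -1)%R) n =
  wr (fun u => zexpg ((s (u j0) * s (u j1) * s (u j0) * s (u j2)) ^ s (u j0)) n) 1.
Proof.
have -> : (2, -1)%R = plin (true, inZp 1) (1, 1)%R by [].
have -> : tri_trans r0 r1 r2 (plin (true, inZp 1) (1, 1)%R) = tri_trans r0 r1 r2 (1, 1)%R ^ r2.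
  rewrite -(tri_trans_lin wr_relA) /tri_dih /= !expg1 mulgA rr1 mul1g //.
rewrite -zexpgJ wr_trans11E conjgE /wr_s wrV !wrM; apply: eq_wr => [u|]; last by rewrite !mul1g.
by rewrite !mul1g -zexpgJ conjgE.
Qed.

(** The second generator of the lattice is a rotation of the first, so its translation is a
    conjugate of that of the first. *)
Lemma wr_latA v : translation_lattice (sn, sn) v -> tri_trans r0 r1 r2 v = 1.
Proof.
case=> m [n ->]; rewrite (tri_transD wr_relA) !(tri_trans_mulz wr_relA).
have X1 : tri_trans r0 r1 r2 (sn, sn)%R = 1.
  have -> : ((sn, sn) = (1, 1) *~ sn)%R by apply: pointP; rewrite /= raddfMz /= intz.
  rewrite (tri_trans_mulz wr_relA) wr_trans11E -wr1; apply: eq_wr => // u.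
  by apply: sss; rewrite (inj_eq perm_inj).
have X2 : tri_trans r0 r1 r2 (- sn, sn + sn)%R = 1.
  have -> : (- sn, sn + sn)%R = plin (false, inZp 5) (sn, sn) by apply: pointP; rewrite /=; lia.
  by rewrite -(tri_trans_lin wr_relA) X1 conj1g.
by rewrite X1 X2 /zexpg !expg1n mulg1.
Qed.

Let YE : wr_s j0 * wr_s j1 * wr_s j0 * wr_t = wr (fun u => s (u j0) * s (u j1) * s (u j0) * t0) 1.
Proof. by rewrite /wr_s /wr_t !wrM; apply: eq_wr => [u|]; rewrite !mul1g. Qed.

Lemma wr_transBE (v : Defs.point) : tri_trans r3 r2 r1 v =
  wr (fun u => zexpg (s (u j0) * s (u j1) * s (u j0) * t0) v.1 *
    zexpg ((s (u j0) * s (u j1) * s (u j0) * t0) ^ s (u j0)) v.2) 1.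
Proof.
rewrite /tri_trans tr2B tr1B -zexpgJ YE !wr_zexpg conjgE /wr_s wrV !wrM.
apply: eq_wr => [u|]; last by rewrite !mul1g.
by rewrite !mul1g -zexpgJ conjgE.
Qed.

Lemma wr_latB v : translation_lattice (tn, 0%R) v -> tri_trans r3 r2 r1 v = 1.
Proof.
case=> m [n ->]; rewrite (tri_transD wr_relB) !(tri_trans_mulz wr_relB).
have X1 : tri_trans r3 r2 r1 (tn, 0)%R = 1.
  rewrite wr_transBE -wr1; apply: eq_wr => // u /=.
  by rewrite zexpg0 mulg1; apply: sst; rewrite (inj_eq perm_inj).
have X2 : tri_trans r3 r2 r1 (- 0, tn + 0)%R = 1.
  have -> : (- 0, tn + 0)%R = plin (true, inZp 0) (tn, 0)%R by apply: pointP; rewrite /=; lia.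
  by rewrite -(tri_trans_lin wr_relB) X1 conj1g.
by rewrite X1 X2 /zexpg !expg1n mulg1.
Qed.

Let shuffle : 'S_3 := tperm j1 j2 * tperm j0 j1.

Let r10 : r1 * r0 = wr_c shuffle. Proof. exact: wr_cM. Qed.

Let tr1A_X k : exists h, tr1 r0 r1 r2 ^+ k = wr h (shuffle ^+ k).
Proof.
have [h0 e0] : exists h0, tr1 r0 r1 r2 = wr h0 shuffle.
  by rewrite tr1A r10 /wr_s /wr_c !wrM !mulg1; eexists.
elim: k => [|k [h e]]; first by exists (fun=> 1); rewrite !expg0 wr1.
by rewrite expgS e e0 wrM -expgSr; eexists.
Qed.

Let groupB x : x \in tri_group r3 r2 r1 -> exists h c,
  [/\ x = wr h c, c j2 = j2 & forall u : 'S_3, u j2 = j2 -> h u \in <<[set s j0; s j1; t0]%SET>>].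
Proof.
have fix2 (u : 'S_3) : u j2 = j2 -> s (u j0) \in <<[set s j0; s j1; t0]%SET>>.
  move=> u2; have : u j0 != j2 by rewrite -u2 (inj_eq perm_inj).
  case: (u j0) => -[|[|[|//]]] i3 // _; apply: mem_gen; rewrite 2!finset.in_setU !finset.in_set1.
    by rewrite (_ : Ordinal i3 = j0) ?eqxx //; apply: val_inj.
  by rewrite (_ : Ordinal i3 = j1) ?eqxx ?orbT //; apply: val_inj.
move: x; apply: gen_ind; first by exists (fun=> 1), 1; rewrite wr1 perm1; split.
move=> a x aB [h [c [-> c2 hH]]].
have [h' [c' [-> c'2 h'H]]] : exists h' c', [/\ a = wr h' c', c' j2 = j2
  & forall u : 'S_3, u j2 = j2 -> h' u \in <<[set s j0; s j1; t0]%SET>>].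
  move: aB; rewrite 2!finset.in_setU !finset.in_set1 => /orP [/orP [] | ] /eqP ->.
  - exists (fun=> t0), 1; rewrite perm1; split=> // u _.
    by rewrite mem_gen // 2!finset.in_setU !finset.in_set1 eqxx orbT.
  - by exists (fun u => s (u j0)), 1; rewrite perm1; split.
  - by exists (fun=> 1), (tperm j0 j1); rewrite tpermD.
exists (fun u => h' u * h (c' * u)), (c * c'); split; first by rewrite wrM.
  by rewrite permM c2.
by move=> u u2; rewrite groupM ?h'H ?hH // permM c'2.
Qed.

(** Permutations occurring in the vertex-figure group fix [j2], which rules out a nontrivial 3-cycle
    part. In the coordinate [u = 1] the rest is a product of powers of [wX] and its conjugate lying
    in the group without [s j2], so [indepX] applies. *)
Lemma wr_interA x : tri_elt r0 r1 r2 x \in tri_group r3 r2 r1 -> translation_lattice (sn, sn) x.2.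
Proof.
case: x => d [x y] /=; rewrite /tri_elt groupMl; last first.
  rewrite /tri_dih groupM // groupX //; first by rewrite mem_gen // !inE eqxx ?orbT.
  by rewrite groupM // mem_gen // !inE eqxx ?orbT.
(* [(1, 1)] and [(2, -1)] span the sublattice of index 3; [r] is the class modulo it, and also the
   exponent of the 3-cycle. *)
have [m [n [r [r3 ex ey]]]] : exists m n (r : nat),
  [/\ (r < 3)%N, x = m + n + n + r%:Z & y = m - n]%R.
  by exists (y + ((x - y) %/ 3)%Z)%R, ((x - y) %/ 3)%Z, `|((x - y) %% 3)%Z|%N; split; lia.
have -> /= : ((x, y) = (1, 1) *~ m + (2, -1) *~ n + (1, 0) *~ r :> Defs.point)%R.
  by rewrite ex ey; apply: pointP; rewrite /= !raddfMz /=; lia.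
rewrite !(tri_transD wr_relA) !(tri_trans_mulz wr_relA) wr_trans11E wr_trans21E.
rewrite zexpg_nat /tri_trans /= zexpg1 zexpg0 mulg1.
have [h hE] := tr1A_X r.
rewrite hE !wrM => /groupB [h' [c' [/wr_eq [eh ec] c2 h'H]]].
have r0 : r = 0.
  move: c2; rewrite -ec !mulg1 /shuffle; case: r r3 {ex hE ec} => [|[|[|//]]] _ //.
    by rewrite expg1 permM tpermR tpermR => /(congr1 val).
  by rewrite expgS expg1 !permM tpermR tpermR (@tpermD _ j1 j2) // tpermL => /(congr1 val).
have h1 : h 1 = 1 by move: hE; rewrite r0 !expg0 -wr1 => /wr_eq [<-].
have := h'H 1; rewrite -eh !mulg1 h1 mulg1 !perm1 => /(_ erefl).
rewrite -/wX => /indepX [/dvdzP [m' ->] /dvdzP [n' ->]].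
exists (m' + n')%R, (- n')%R.
by apply: pointP; rewrite /= !raddfMz /= -!mulrzz; lia.
Qed.

Let groupA x : x \in tri_group r0 r1 r2 -> exists h c,
  x = wr h c /\ forall u, h u \in <<[set s j0; s j1; s j2]%SET>>.
Proof.
have m3 i : s i \in <<[set s j0; s j1; s j2]%SET>>.
  apply: mem_gen; rewrite 2!finset.in_setU !finset.in_set1; case: i => -[|[|[|//]]] i3.
  - by rewrite (_ : Ordinal i3 = j0) ?eqxx //; apply: val_inj.
  - by rewrite (_ : Ordinal i3 = j1) ?eqxx ?orbT //; apply: val_inj.
  - by rewrite (_ : Ordinal i3 = j2) ?eqxx ?orbT //; apply: val_inj.
move: x; apply: gen_ind; first by exists (fun=> 1), 1; rewrite wr1; split.
move=> a x aA [h [c [-> hH]]].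
have [h' [c' [-> h'H]]] : exists h' c',
    a = wr h' c' /\ forall u, h' u \in <<[set s j0; s j1; s j2]%SET>>.
  move: aA; rewrite 2!finset.in_setU !finset.in_set1 => /orP [/orP [] | ] /eqP ->.
  - by exists (fun=> 1), (tperm j1 j2).
  - by exists (fun=> 1), (tperm j0 j1).
  - by exists (fun u => s (u j0)), 1.
exists (fun u => h' u * h (c' * u)), (c * c'); split; first by rewrite wrM.
by move=> u; rewrite groupM.
Qed.

Lemma wr_interB x : tri_elt r3 r2 r1 x \in tri_group r0 r1 r2 -> translation_lattice (tn, 0%R) x.2.
Proof.
case: x => d [x y] /=; rewrite /tri_elt groupMl; last first.
  rewrite /tri_dih groupM // groupX //; first by rewrite mem_gen // !inE eqxx ?orbT.
  by rewrite groupM // mem_gen // !inE eqxx ?orbT.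
rewrite wr_transBE /= => /groupA [h [c [/wr_eq [eh _] hH]]].
have := hH 1; rewrite -eh !perm1 -/wY => /indepY [/dvdzP [m ->] /dvdzP [n ->]].
by exists m, n; apply: pointP; rewrite /= !raddfMz /= -!mulrzz; lia.
Qed.

Lemma wr_dihA d : tri_dih r1 r2 d = 1 -> d = (false, 0%R).
Proof.
have c1E : r1 * r2 = wr (fun u => s (u j1)) (tperm j0 j1).
  by rewrite /wr_c /wr_s wrM; apply: eq_wr => [u|]; rewrite ?mul1g // permM tpermL.
have cX k : exists h, (r1 * r2) ^+ k = wr h (tperm j0 j1 ^+ k).
  elim: k => [|k [h e]]; first by exists (fun=> 1); rewrite !expg0 wr1.
  by rewrite expgS e c1E wrM -expgSr; eexists.
(* Both [r1] and [r1 * r2] have the transposition of [j0], [j1] as permutation part, so a trivial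
   word has [b + k] even. Three reflections and two rotations remain, each excluded by [s0_nt],
   [s1_nt] or [s01]. *)
have even (b : bool) k : r1 ^+ b * (r1 * r2) ^+ k = 1 -> odd (b + k) = false.
  have [h ->] := cX k; have [h' ->] : exists h', r1 ^+ b = wr h' (tperm j0 j1 ^+ b).
    by case: b; exists (fun=> 1); rewrite ?expg0 ?wr1 ?expg1.
  rewrite wrM => /wr_eq1 [_]; rewrite -expgD addnC => e; apply: contraTF (isT) => bk.
  have t2 : tperm j0 j1 ^+ 2 = 1 by rewrite expgS expg1 tperm2.
  move: e; rewrite -[(b + k)%N]odd_double_half bk -muln2 mulnC expgD expgM t2 expg1n mulg1 expg1.
  by move/permP/(_ j0); rewrite tpermL perm1 => /(congr1 val).
have s_inj i j : wr_s i = wr_s j -> s i = s j.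
  by move=> /wr_eq [/(_ 1)]; rewrite !perm1.
have s_1 i : wr_s i = 1 -> s i = 1 by move=> /wr_eq1 [/(_ 1)]; rewrite perm1.
have i1 := rr1; have i2 := ss j0; have i3 := ss j1.
have c6 := tri_ord12 wr_relA.
case: d => [b [k k6]]; rewrite /tri_dih /= => e.
have := even _ _ e; case: b e => /=; case: k k6 => [|[|[|[|[|[|//]]]]]] k6 //= e _.
- by case: s0_nt; apply: s_1; rewrite -e !expg1 mulgA i1 mul1g.
- case: s1_nt; apply: s_1; move: e; rewrite c3E expg1 mulgA i1 mul1g => e.
  have := congr1 (fun z => wr_s j0 * z * wr_s j0) e.
  by rewrite mulg1 i2 !mulgA i2 mul1g -mulgA i2 mulg1.
- case: s0_nt; apply: s_1; rewrite -[RHS]c6 expgSr.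
  suff -> : (r1 * r2) ^+ 5 = r1 by rewrite mulgA i1 mul1g.
  by rewrite -[LHS]mul1g -i1 -mulgA -[X in _ = X]mulg1; congr (_ * _).
- by congr pair; apply: val_inj.
- case: s01; apply: s_inj; move: e; rewrite c2E expg0 mul1g => e.
  by rewrite -[LHS]mul1g -e -mulgA i2 mulg1.
- case: s01; apply: s_inj; move: e; rewrite expg0 mul1g => e.
  have : (r1 * r2) ^+ 2 = 1 by rewrite -[LHS]mul1g -e -expgD c6.
  by rewrite c2E => e'; rewrite -[LHS]mul1g -e' -mulgA i2 mulg1.
Qed.

Lemma wr_dihB d : tri_dih r2 r1 d = 1 -> d = (false, 0%R).
Proof.
have i1 := rr1; have i2 := ss j0; have c6 := tri_ord12 wr_relA.
have cV : r2 * r1 = (r1 * r2) ^+ 5.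
  apply: (mulIg (r1 * r2)); rewrite -expgSr c6 -mulgA (mulgA r1 r1) i1 mul1g.
  by rewrite i2.
have cX n : (r1 * r2) ^+ (n %% 6) = (r1 * r2) ^+ n by rewrite expg_mod.
case: d => [[] k]; rewrite /tri_dih /= cV -expgM => e.
  suff /wr_dihA : tri_dih r1 r2 (true, inZp (5 * k).+1) = 1 by [].
  by rewrite /tri_dih /= cX expg1 expgS !mulgA i1 mul1g -e expg1.
have /wr_dihA : tri_dih r1 r2 (false, inZp (5 * k)) = 1 by rewrite /tri_dih /= cX.
by case: k {e} => -[|[|[|[|[|[|//]]]]]] k6 // _; congr pair; apply: val_inj.
Qed.

Local Notation W := (<<[set r0; r1; r2; r3]%SET>>)%G.
Local Notation sub := (subg W).

Let r_mem : [/\ r0 \in W, r1 \in W, r2 \in W & r3 \in W].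
Proof. by split; rewrite mem_gen // !inE eqxx ?orbT. Qed.

Let valM : {morph (sgval : subg_of W -> _) : x y / x * y}. Proof. by []. Qed.

Let sub_val i : i \in W -> sgval (sub i) = i. Proof. exact: subgK. Qed.

Lemma wr_subg_gens : <<[set sub r0; sub r1; sub r2; sub r3]%SET>> = [set: subg_of W]%SET.
Proof.
have [m0 m1 m2 m3] := r_mem.
apply/eqP; rewrite finset.eqEsubset finset.subsetT /=; apply/fintype.subsetP => x _.
have h y : y \in W -> y \in W /\ sub y \in <<[set sub r0; sub r1; sub r2; sub r3]%SET>>.
  move: y; apply: gen_ind; first by rewrite group1 morph1.
  move=> a y aA [yW sy]; have aW : a \in W := mem_gen aA.
  split; first exact: groupM.
  rewrite morphM // groupM // mem_gen //.
  move: aA; rewrite !finset.in_setU !finset.in_set1.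
  by move=> /orP [/orP [/orP [] | ] | ] /eqP ->; rewrite eqxx ?orbT.
by rewrite -[x]sgvalK; have [] := h _ (valP x).
Qed.

Lemma wr_subg_tri a0 a1 a2 x : a0 \in W -> a1 \in W -> a2 \in W ->
  x \in tri_group (sub a0) (sub a1) (sub a2) -> sgval x \in tri_group a0 a1 a2.
Proof.
move=> m0 m1 m2; move: x; apply: gen_ind; first exact: group1.
move=> a x aA xH; rewrite valM groupM //; apply: mem_gen.
move: aA; rewrite !finset.in_setU !finset.in_set1.
by move=> /orP [/orP [] | ] /eqP ->; rewrite sub_val // eqxx ?orbT.
Qed.

(** The coordinate [u = 1] of the elements with trivial permutation part takes every value in the
    group generated by the [s] and [t0]. *)
Lemma wr_card_ge : (#|<<[set s j0; s j1; s j2; t0]%SET>>| <= #|[set: subg_of W]%SET|)%N.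
Proof.
have [m0 m1 m2 m3] := r_mem.
have ms i : wr_s i \in W.
  have e1 : wr_s j1 \in W.
    have -> : wr_s j1 = r1 * wr_s j0 * r1 by rewrite r1s0 -mulgA rr1 mulg1.
    by rewrite groupM // groupM.
  have e2 : wr_s j2 \in W.
    have -> : wr_s j2 = r0 * wr_s j1 * r0 by rewrite r0s1 -mulgA rr0 mulg1.
    by rewrite groupM // groupM.
  case: i => -[|[|[|//]]] i3.
  - by rewrite (_ : Ordinal i3 = j0) //; apply: val_inj.
  - by rewrite (_ : Ordinal i3 = j1) //; apply: val_inj.
  - by rewrite (_ : Ordinal i3 = j2) //; apply: val_inj.
have sur y : y \in <<[set s j0; s j1; s j2; t0]%SET>> -> exists h, wr h 1 \in W /\ h 1 = y.
  move: y; apply: gen_ind; first by exists (fun=> 1); rewrite wr1 group1.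
  move=> a y aA [h [hW hy]].
  have [h' [h'W <-]] : exists h', wr h' 1 \in W /\ h' 1 = a.
    move: aA; rewrite !finset.in_setU !finset.in_set1.
    move=> /orP [/orP [/orP [] | ] | ] /eqP ->.
    - by exists (fun u => s (u j0)); rewrite perm1; split=> //; apply: (ms j0).
    - by exists (fun u => s (u j1)); rewrite perm1; split=> //; apply: (ms j1).
    - by exists (fun u => s (u j2)); rewrite perm1; split=> //; apply: (ms j2).
    - by exists (fun=> t0).
  exists (fun u => h' u * h (1 * u)); split; last by rewrite mulg1 hy.
  by have := groupM h'W hW; rewrite wrM mulg1.
have -> : #|[set: subg_of W]%SET| = #|W| by rewrite cardsT card_sub; apply: eq_card.
apply: leq_trans (leq_imset_card (fun g : {perm Q * 'S_3} => (g (1, 1)).1) _).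
apply: subset_leq_card; apply/fintype.subsetP => y /sur [h [hW <-]].
by apply/imsetP; exists (wr h 1); rewrite ?wrE ?mul1g.
Qed.

Hypothesis unitA : ~ translation_lattice (sn, sn) (1, 0)%R.
Hypothesis unitB : ~ translation_lattice (tn, 0%R) (1, 0)%R.
Hypothesis lattice_neq :
  ~ (forall v, translation_lattice (sn, sn) v <-> translation_lattice (tn, 0%R) v).
Hypothesis big : (12 * 4 ^ 6 < #|<<[set s j0; s j1; s j2; t0]%SET>>|)%N.

Lemma wreath_medial_polytope : exists G : sgraph,
  (#|<<[set s j0; s j1; s j2; t0]%SET>>| <= 12 * #|G|)%N /\
  has_medial_polytope (sn, sn) (tn, 0%R) G.
Proof.
have [m0 m1 m2 m3] := r_mem.
have subM x y : x \in W -> y \in W -> sub x * sub y = sub (x * y).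
  by move=> xW yW; rewrite morphM.
have subX x k : x \in W -> sub x ^+ k = sub (x ^+ k) by move=> xW; rewrite morphX.
have i0 : sub r0 * sub r0 = 1 by rewrite subM // rr0 morph1.
have i1 : sub r1 * sub r1 = 1 by rewrite subM // rr1 morph1.
have i2 : sub r2 * sub r2 = 1 by rewrite subM // ss morph1.
have i3 : sub r3 * sub r3 = 1 by rewrite subM // wr_t_invol morph1.
have c02 : commute (sub r0) (sub r2) by rewrite /commute !subM // r0s0.
have c03 : commute (sub r0) (sub r3) by rewrite /commute !subM // wr_tJ.
have c13 : commute (sub r1) (sub r3) by rewrite /commute !subM // wr_tJ.
have o01 : (sub r0 * sub r1) ^+ 3 = 1 by rewrite subM // subX ?groupM // c01_3 morph1.
have o12 : (sub r1 * sub r2) ^+ 6 = 1.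
  by rewrite subM // subX ?groupM // (tri_ord12 wr_relA) morph1.
have o23 : (sub r2 * sub r3) ^+ 3 = 1 by rewrite subM // subX ?groupM // wr_st3 morph1.
have inj1 (x : subg_of W) : sgval x = 1 -> x = 1 by move=> e; apply: val_inj.
have := @rank4_medial_polytope _ _ _ _ _ wr_subg_gens i0 i1 i2 i3 c02 c03 c13 o01 o12 o23 (sn, sn) (tn, 0%R).
have := @card_le_medial _ _ _ _ _ wr_subg_gens i0 i1 i2 i3 c02 c03 c13 o23.
set G := medial_layer_graph _ => le concl.
exists G; split.
  by apply: leq_trans wr_card_ge _; rewrite cardsT.
apply: concl => //.
- by move=> v /wr_latA e; apply: inj1; rewrite (hom_trans valM) !sub_val.
- by move=> v /wr_latB e; apply: inj1; rewrite (hom_trans valM) !sub_val.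
- by move=> x /(wr_subg_tri m3 m2 m1); rewrite (hom_elt valM) !sub_val // => /wr_interA.
- by move=> x /(wr_subg_tri m0 m1 m2); rewrite (hom_elt valM) !sub_val // => /wr_interB.
- by move=> d /(congr1 sgval); rewrite (hom_dih valM) !sub_val // => /wr_dihA.
- by move=> d /(congr1 sgval); rewrite (hom_dih valM) !sub_val // => /wr_dihB.
- by apply: leq_trans big _; apply: leq_trans wr_card_ge _; rewrite cardsT.
Qed.

End Wreath.

Import GRing.Theory Num.Theory.
Local Open Scope ring_scope.

(** * Reflection groups over block matrices *)

Lemma addmxE (F : nmodType) m n (A B : 'M[F]_(m, n)) i j : (A + B) i j = A i j + B i j.
Proof. exact: mxE. Qed.
Lemma oppmxE (F : zmodType) m n (A : 'M[F]_(m, n)) i j : (- A) i j = - A i j.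
Proof. exact: mxE. Qed.
Lemma zeromxE (F : nmodType) m n i j : (0 : 'M[F]_(m, n)) i j = 0.
Proof. exact: mxE. Qed.

Ltac mxzmod :=
  rewrite ?(mulmxDl, mulmxDr, mulmxN, mulNmx, mul1mx, mulmx1, mul0mx, mulmx0, mulmxA);
  apply/matrixP => ? ?; rewrite ?(addmxE, oppmxE, zeromxE); ring.

Section Reflection.
Variables (F : comNzRingType) (k n : nat).
Implicit Types (a b : 'M[F]_(k, n)) (f : 'M[F]_(n, k)).

(** A reflection of rank [k]: it is the identity where [a] vanishes and, when [a *m f] is twice the
    identity, -1 on the image of [f]. For [k = 1] it is an ordinary reflection. *)
Definition refl f a : 'M[F]_n := 1%:M - f *m a.

Lemma mul_refl p (x : 'M_(p, n)) f a : x *m refl f a = x - x *m f *m a.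
Proof. by rewrite /refl mulmxBr mulmx1 mulmxA. Qed.

Lemma refl_mul p f a (x : 'M_(n, p)) : refl f a *m x = x - f *m (a *m x).
Proof. by rewrite /refl mulmxBl mul1mx mulmxA. Qed.

Lemma refl_scale f a (l l' : 'M_k) : l' *m l = 1%:M -> refl (f *m l') (l *m a) = refl f a.
Proof. by move=> e; rewrite /refl -mulmxA (mulmxA l') e mul1mx. Qed.

Lemma refl_invol f a : a *m f = 1%:M + 1%:M -> refl f a *m refl f a = 1%:M.
Proof. by move=> e; rewrite mul_refl refl_mul e /refl; mxzmod. Qed.

Lemma refl_conj fa a fb b :
  a *m fa = 1%:M + 1%:M -> a *m fb = - 1%:M -> b *m fa = - 1%:M ->
  refl fa a *m refl fb b *m refl fa a = refl (fa + fb) (a + b).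
Proof.
move=> aa ab ba; rewrite (mul_refl (refl fa a)) mulmxBl refl_invol //.
rewrite -(mulmxA (refl fa a *m fb)) refl_mul ab mul_refl ba /refl; mxzmod.
Qed.

Lemma refl_braid fa a fb b :
  a *m fa = 1%:M + 1%:M -> b *m fb = 1%:M + 1%:M -> a *m fb = - 1%:M -> b *m fa = - 1%:M ->
  refl fa a *m refl fb b *m refl fa a = refl fb b *m refl fa a *m refl fb b.
Proof. by move=> aa bb ab ba; rewrite !refl_conj // addrC (addrC b). Qed.
End Reflection.

(** * The product of block reflections attached to a triangle *)

Section Triangle.
Variables (F : fieldType) (k n : nat).
Variables (a b c : 'M[F]_(k.+1, n.+1)) (fa fb fc : 'M[F]_(n.+1, k.+1)) (w w' : 'M[F]_k.+1).
Hypotheses (aa : a *m fa = 1%:M + 1%:M) (bb : b *m fb = 1%:M + 1%:M) (cc : c *m fc = 1%:M + 1%:M).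
Hypotheses (ab : a *m fb = - 1%:M) (ba : b *m fa = - 1%:M).
Hypotheses (bc : b *m fc = - 1%:M) (cb : c *m fb = - 1%:M).
Hypotheses (ac : a *m fc = - w') (ca : c *m fa = - w).
Hypotheses (ww' : w *m w' = 1%:M) (w'w : w' *m w = 1%:M).

Local Notation Ta := (refl fa a).
Local Notation Tb := (refl fb b).
Local Notation Tc := (refl fc c).

(** The product of the reflections in the root sum of [a] and [b] and in [c]. For [w = 1] it would
    be a translation of the affine Weyl group of type A2; a twist [w] without eigenvalue 1 makes it
    of finite order. *)
Definition coxeter : 'M[F]_n.+1 := Ta *m Tb *m Ta *m Tc.
Local Notation X := coxeter.

Let XE : X = refl (fa + fb) (a + b) *m Tc.
Proof. by rewrite /X refl_conj. Qed.

Let ag : a *m (fa + fb) = 1%:M. Proof. by rewrite mulmxDr aa ab addrK. Qed.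
Let bg : b *m (fa + fb) = 1%:M. Proof. by rewrite mulmxDr ba bb addKr. Qed.
Let cg : c *m (fa + fb) = - (w + 1%:M). Proof. by rewrite mulmxDr ca cb opprD. Qed.

Let aX : a *m X = - b - c.
Proof.
rewrite XE mulmxA (mul_refl a) ag.
have -> : a - 1%:M *m (a + b) = - b by mxzmod.
by rewrite mul_refl mulNmx bc; mxzmod.
Qed.

Let gX : (a + b) *m X = - (a + b) - c - w' *m c.
Proof.
rewrite XE mulmxA (mul_refl (a + b)) (mulmxDl a b) ag bg.
have -> : a + b - (1%:M + 1%:M) *m (a + b) = - (a + b) by mxzmod.
by rewrite mul_refl mulNmx mulmxDl ac bc; mxzmod.
Qed.

Let cX : c *m X = (1%:M + w) *m (a + b) + c + w *m c + w' *m c.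
Proof.
rewrite XE mulmxA (mul_refl c) cg.
have -> : c - (- (w + 1%:M)) *m (a + b) = c + (1%:M + w) *m (a + b) by mxzmod.
rewrite mul_refl (mulmxDl c) cc -(mulmxA (1%:M + w)) (mulmxDl a b) ac bc.
have -> : 1%:M + 1%:M + (1%:M + w) *m (- w' - 1%:M) = - w' - w.
  by rewrite mulmxDr !mulmxDl !mul1mx !mulmxN ww'; mxzmod.
by mxzmod.
Qed.

(* [h1] and [h2] span the plane moved by [X], on which it acts through [w] and
   its inverse; right multiplication by [Ta] exchanges [h1] and the fixed row [k2]. *)
Let h1 := a + b + c.
Let h2 := a + b + w' *m c.
Let k2 := w *m a + b + c.

Let h1X : h1 *m X = w *m h1.
Proof. by rewrite /h1 mulmxDl gX cX; mxzmod. Qed.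

Let h2X : h2 *m X = w' *m h2.
Proof.
rewrite /h2 mulmxDl gX -mulmxA cX !mulmxDr !mulmxA mulmxDr mulmx1 w'w; mxzmod.
Qed.

Let k2X : k2 *m X = k2.
Proof.
have -> : k2 = h1 - (1%:M - w) *m a by rewrite /k2 /h1; mxzmod.
by rewrite mulmxBl h1X -mulmxA aX; rewrite /h1; mxzmod.
Qed.

Let h1T : h1 *m Ta = k2.
Proof. by rewrite mul_refl /h1 !mulmxDl aa ba ca; rewrite /k2; mxzmod. Qed.

Let k2T : k2 *m Ta = h1.
Proof. by rewrite -h1T -mulmxA refl_invol // mulmx1. Qed.

Let eigen p (x : 'M[F]_(k.+1, n.+1)) (y : 'M_n.+1) (z : 'M_k.+1) :
  x *m y = z *m x -> x *m (y ^+ p) = (z ^+ p) *m x.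
Proof.
move=> e; elim: p => [|p IH]; first by rewrite !expr0 mulmx1 mul1mx.
by rewrite exprSr -mulmxE mulmxA IH -mulmxA e mulmxA mulmxE -exprSr.
Qed.

(** Powers of [X] are expressed by the geometric sums of [w] and of [w'] along the rows [h1] and
    [h2]. Both sums vanish at [m], because [w - 1] and [w' - 1] are invertible. *)
Lemma coxeter_order m : w ^+ m = 1 -> w - 1 \is a GRing.unit -> X ^+ m = 1.
Proof.
move=> wm wu.
have w'u : w' - 1 \is a GRing.unit.
  have -> : w' - 1 = - w' * (w - 1) by rewrite mulrBr mulr1 mulNr -mulmxE w'w addrC opprK.
  by rewrite unitrMr // unitrN; apply/unitrP; exists w; rewrite -mulmxE ww' w'w.
have w'm : w' ^+ m = 1.
  have : w ^+ m * w' ^+ m = 1 by rewrite -exprMn_comm /GRing.comm -mulmxE ?ww' ?w'w ?expr1n.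
  by rewrite wm mul1r.
pose s (z : 'M[F]_k.+1) p := \sum_(i < p) z ^+ i.
have s0 z : z ^+ m = 1 -> z - 1 \is a GRing.unit -> s z m = 0.
  by move=> zm zu; apply: (mulrI zu); rewrite mulr0 -subrX1 zm subrr.
pose d := (1 - w')^-1.
have cE : c = d *m (h1 - h2).
  have -> : h1 - h2 = (1 - w') *m c by rewrite /h1 /h2; mxzmod.
  by rewrite mulmxA mulmxE mulVr ?mul1mx // -opprB unitrN.
pose B := (fc + (fa + fb) *m w') *m d.
have X1 : X = 1 + (- (fa + fb) - B) *m h1 + B *m h2.
  have -> : 1 + (- (fa + fb) - B) *m h1 + B *m h2 = 1%:M - (fa + fb) *m h1 - (fc + (fa + fb) *m w') *m (d *m (h1 - h2)).
    by rewrite /B; mxzmod.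
  by rewrite -cE XE mul_refl /refl mulmxBl mul1mx -(mulmxA (fa + fb)) (mulmxDl a) ac bc /h1; mxzmod.
have Xp p : X ^+ p = 1 + (- (fa + fb) - B) *m s w p *m h1 + B *m s w' p *m h2.
  elim: p => [|p IH]; first by rewrite /s !big_ord0 !mulmx0 !mul0mx !addr0.
  have sS z : s z p.+1 = 1 + s z p * z.
    rewrite /s big_ord_recl expr0 mulr_suml; congr (_ + _); apply: eq_bigr => i _.
    by rewrite -exprSr.
  rewrite exprSr IH -mulmxE !mulmxDl mul1mx -!(mulmxA _ h1) -!(mulmxA _ h2) h1X h2X {1}X1.
  by rewrite !sS -!mulmxE; mxzmod.
by rewrite Xp !s0 // !mulmx0 !mul0mx !addr0.
Qed.

(** Two test rows separate the exponents: [h1] is multiplied by [w] under [X] and fixed by its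
    conjugate under [Ta], and [k2] behaves the other way round. Both take the invertible value
    [c *m v] on [v]. *)
Lemma coxeter_indep (p q : nat) (v : 'M[F]_(n.+1, k.+1)) :
  a *m v = 0 -> b *m v = 0 -> c *m v \is a GRing.unit ->
  X ^+ p *m (Ta *m X *m Ta) ^+ q *m v = v -> w ^+ p = 1 /\ w ^+ q = 1.
Proof.
move=> av bv cv e.
have h1v : h1 *m v = c *m v by rewrite /h1 !mulmxDl av bv !add0r.
have k2v : k2 *m v = c *m v by rewrite /k2 !mulmxDl -mulmxA av bv mulmx0 !add0r.
have h1X' : h1 *m (Ta *m X *m Ta) = 1%:M *m h1 by rewrite (mulmxA h1) (mulmxA h1) h1T k2X k2T mul1mx.
have k2X' : k2 *m (Ta *m X *m Ta) = w *m k2 by rewrite (mulmxA k2) (mulmxA k2) k2T h1X -mulmxA h1T.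
have k2X1 : k2 *m X = 1%:M *m k2 by rewrite k2X mul1mx.
have one r : (1%:M : 'M[F]_k.+1) ^+ r = 1%:M by apply: expr1n.
move: (Ta *m X *m Ta) e h1X' k2X' => Y e h1Y k2Y.
split; apply: (mulIr cv); rewrite mul1r -mulmxE.
  by rewrite -{1}h1v -{1}h1v -[in RHS]e !mulmxA (eigen p h1X) -(mulmxA (w ^+ p)) (eigen q h1Y) one mul1mx -!mulmxA.
by rewrite -{1}k2v -{1}k2v -[in RHS]e !mulmxA (eigen p k2X1) one mul1mx (eigen q k2Y) -!mulmxA.
Qed.

End Triangle.

Section Cartan.
Variables (F : fieldType) (k n : nat) (C : 'I_4 -> 'I_4 -> 'M[F]_k.+1) (e : 'I_4 -> 'M[F]_(k.+1, n.+1)).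
Hypothesis eK : forall i j, e i *m (e j)^T = (i == j)%:R%:M.
Hypothesis Cdiag : forall i, C i i = 1%:M + 1%:M.
Hypothesis CK : forall i j, i != j -> C i j *m C j i = 1%:M.

Definition coroot i : 'M[F]_(n.+1, k.+1) := \sum_j (e j)^T *m C j i.
Definition cartan_refl i := refl (coroot i) (e i).
Local Notation T := cartan_refl.
(** With this sign the affine case, in which all off-diagonal entries are -1, has holonomy 1. *)
Definition holonomy i j l := - (C i j *m C j l *m C l i).

Lemma root_coroot i j : e j *m coroot i = C j i.
Proof.
rewrite /coroot mulmx_sumr (bigD1 j) //= mulmxA eK eqxx mul1mx big1 ?addr0 // => l jl.
by rewrite mulmxA eK eq_sym (negbTE jl) -scalemx1 scale0r mul0mx.
Qed.

Lemma cartan_refl_invol i : T i *m T i = 1%:M.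
Proof. by apply: refl_invol; rewrite root_coroot. Qed.

Lemma cartan_refl_fix i l : i != l -> T i *m (e l)^T = (e l)^T.
Proof.
by move=> il; rewrite refl_mul eK (negbTE il) -scalemx1 scale0r mulmx0 subr0.
Qed.

Section Distinct.
Variables i j l : 'I_4.
Hypotheses (ij : i != j) (il : i != l) (jl : j != l).

Let ji : j != i. Proof. by rewrite eq_sym. Qed.
Let li : l != i. Proof. by rewrite eq_sym. Qed.
Let lj : l != j. Proof. by rewrite eq_sym. Qed.

(* Rescaling the roots normalizes every entry of the 3 x 3 Cartan matrix except
   the one between i and l, which becomes minus the holonomy. *)
Let b := - C i j *m e j.
Let fb := coroot j *m - C j i.
Let c := (C i j *m C j l) *m e l.
Let fc := coroot l *m (C l j *m C j i).
Let w' := - (C i l *m C l j *m C j i).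

Let Tj : refl fb b = T j.
Proof. by apply: refl_scale; rewrite mulmxN mulNmx opprK CK. Qed.
Let Tl : refl fc c = T l.
Proof.
apply: refl_scale; rewrite -mulmxA (mulmxA (C j i)) CK // mul1mx CK //.
Qed.

Let cox : coxeter (e i) b c (coroot i) fb fc = T i *m T j *m T i *m T l.
Proof. by rewrite /coxeter Tj Tl. Qed.

Let ba : b *m coroot i = - 1%:M.
Proof. by rewrite /b -mulmxA root_coroot mulNmx CK. Qed.
Let bb : b *m fb = 1%:M + 1%:M.
Proof.
rewrite /b /fb -mulmxA (mulmxA (e j)) root_coroot Cdiag mulmxDl mul1mx mulmxDr.
by rewrite mulmxN mulNmx opprK CK.
Qed.
Let ab : e i *m fb = - 1%:M.
Proof. by rewrite /fb mulmxA root_coroot mulmxN CK. Qed.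
Let cc : c *m fc = 1%:M + 1%:M.
Proof.
rewrite /c /fc -mulmxA (mulmxA (e l)) root_coroot Cdiag mulmxDl mul1mx mulmxDr.
by rewrite -mulmxA (mulmxA (C j l)) CK // mul1mx CK.
Qed.
Let bc : b *m fc = - 1%:M.
Proof.
by rewrite /b /fc -mulmxA (mulmxA (e j)) root_coroot (mulmxA (C j l)) CK // mul1mx mulNmx CK.
Qed.
Let cb : c *m fb = - 1%:M.
Proof.
by rewrite /c /fb -mulmxA (mulmxA (e l)) root_coroot -mulmxA (mulmxA (C j l)) CK // mul1mx mulmxN CK.
Qed.
Let ac : e i *m fc = - w'.
Proof. by rewrite /fc mulmxA root_coroot /w' opprK mulmxA. Qed.
Let ca : c *m coroot i = - holonomy i j l.
Proof. by rewrite /c -mulmxA root_coroot /holonomy opprK. Qed.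
Let ww' : holonomy i j l *m w' = 1%:M.
Proof.
rewrite /holonomy /w' mulmxN mulNmx opprK -!mulmxA (mulmxA (C l i)) CK // mul1mx.
by rewrite (mulmxA (C j l)) CK // mul1mx CK.
Qed.
Let w'w : w' *m holonomy i j l = 1%:M.
Proof.
rewrite /holonomy /w' mulmxN mulNmx opprK -!mulmxA (mulmxA (C j i)) CK // mul1mx.
by rewrite (mulmxA (C l j)) CK // mul1mx CK.
Qed.
Let aa : e i *m coroot i = 1%:M + 1%:M. Proof. by rewrite root_coroot. Qed.

Lemma cartan_refl_order m : holonomy i j l ^+ m = 1 -> holonomy i j l - 1 \is a GRing.unit ->
  (T i *m T j *m T i *m T l) ^+ m = 1.
Proof. by rewrite -cox; apply: (@coxeter_order _ _ _ _ _ _ _ _ _ _ w'). Qed.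

Lemma cartan_refl_indep p q :
  let X := T i *m T j *m T i *m T l in
  X ^+ p *m (T i *m X *m T i) ^+ q *m (e l)^T = (e l)^T ->
  holonomy i j l ^+ p = 1 /\ holonomy i j l ^+ q = 1.
Proof.
rewrite /= -cox; apply: (coxeter_indep aa bb cc ab ba bc cb ac ca ww').
- by rewrite eK (negbTE il) -scalemx1 scale0r.
- by rewrite /b -mulmxA eK (negbTE jl) -scalemx1 scale0r mulmx0.
- rewrite /c -mulmxA eK eqxx mulmx1; apply/unitrP; exists (C l j *m C j i).
  rewrite -!mulmxE -!mulmxA (mulmxA (C j i)) (mulmxA (C j l)) !CK // !mul1mx !CK //.
Qed.

Lemma cartan_refl_braid : T i *m T j *m T i = T j *m T i *m T j.
Proof. by rewrite -Tj; apply: refl_braid. Qed.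
End Distinct.
End Cartan.

(** The middle condition, absence of the eigenvalue 1, is what makes the geometric sums in
    [coxeter_order] vanish. *)
Definition exact_order k (F : fieldType) (m : nat) (x : 'M[F]_k.+1) : Prop :=
  [/\ x ^+ m = 1, x - 1 \is a GRing.unit & forall p, x ^+ p = 1 -> (m %| p)%N].

Lemma zexpg_order_dvd (gT : finGroupType) (x : gT) (d : nat) (m : int) :
  (d %| #[x]%g)%N -> (d %| `|(m %% #[x]%g)%Z|)%N -> (d %| m)%Z.
Proof.
move=> dx dm; by rewrite (divz_eq m #[x]%g) rpredD ?dvdz_mull ?dvdzE.
Qed.

Section CartanGroup.
Variables (F : finFieldType) (k n : nat) (C : 'I_4 -> 'I_4 -> 'M[F]_k.+1) (e : 'I_4 -> 'M[F]_(k.+1, n.+1)).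
Hypothesis eK : forall i j, e i *m (e j)^T = (i == j)%:R%:M.
Hypothesis Cdiag : forall i, C i i = 1%:M + 1%:M.
Hypothesis CK : forall i j, i != j -> C i j *m C j i = 1%:M.
Variables (s t : nat).
Local Notation up := (widen_ord (leqnSn 3)).
Local Notation T := (cartan_refl C e).
Local Notation hol := (holonomy C).
Hypothesis hol_s : forall i j l : 'I_3, i != j -> i != l -> j != l ->
  exact_order s (hol (up i) (up j) (up l)).
Hypothesis hol_t : forall i j : 'I_3, i != j -> exact_order t (hol (up i) (up j) ord_max).

Variables (Q : finGroupType) (rho : Q -> 'M[F]_n.+1) (g : 'I_4 -> Q).
Hypothesis rhoM : forall x y, rho (x * y)%g = rho x *m rho y.
Hypothesis rho_inj : injective rho.
Hypothesis rho1 : rho 1%g = 1%:M.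
Hypothesis rho_g : forall i, rho (g i) = T i.

Let rhoX x p : rho (x ^+ p)%g = rho x ^+ p.
Proof. by elim: p => [|p IH]; rewrite ?expg0 // expgS rhoM IH exprS. Qed.

Let gens i := g (up i).
Let gent := g ord_max.

Let up_max i : up i != ord_max. Proof. by rewrite -val_eqE /= neq_ltn ltn_ord. Qed.

Lemma cartan_gen_invol i : (g i * g i = 1)%g.
Proof. by apply: rho_inj; rewrite rhoM rho_g rho1 (cartan_refl_invol eK Cdiag). Qed.

Lemma cartan_gen_ord3 i j : i != j -> ((g i * g j) ^+ 3 = 1)%g.
Proof.
move=> ij; have b : (g i * g j * g i = g j * g i * g j)%g.
  by apply: rho_inj; rewrite !rhoM !rho_g (cartan_refl_braid eK).
rewrite !expgS expg0 mulg1 !mulgA b -!mulgA.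
rewrite (mulgA (g j) (g j)) cartan_gen_invol mul1g (mulgA (g i) (g i)) cartan_gen_invol mul1g.
by rewrite cartan_gen_invol.
Qed.

Lemma cartan_gen_cox i j l m : i != j -> i != l -> j != l -> exact_order m (hol i j l) ->
  (zexpg (g i * g j * g i * g l) m = 1)%g.
Proof.
move=> ij il jl [hm hu _]; rewrite zexpg_nat; apply: rho_inj; rewrite rhoX !rhoM !rho_g rho1.
exact: (cartan_refl_order eK).
Qed.

(** The reflections other than the one of index [l] fix the columns of [(e l)^T], hence so does the
    group they generate; on these columns the exponents are detected by [cartan_refl_indep]. *)
Lemma cartan_gen_indep i j l (A : {set Q}) d (p q : int) :
  i != j -> i != l -> j != l -> exact_order d (hol i j l) ->
  (forall x, x \in A -> exists2 h, h != l & x = g h) ->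
  let X := (g i * g j * g i * g l)%g in
  (zexpg X p * zexpg (X ^ g i) q)%g \in <<A>>%g -> (d %| p)%Z /\ (d %| q)%Z.
Proof.
move=> ij il jl [_ _ hd] Agen X.
have fixA x : x \in <<A>>%g -> rho x *m (e l)^T = (e l)^T.
  move: x; apply: gen_ind => [|a x /Agen [h hl ->] IH]; first by rewrite rho1 mul1mx.
  by rewrite rhoM -mulmxA IH rho_g cartan_refl_fix.
have XE : rho X = T i *m T j *m T i *m T l by rewrite !rhoM !rho_g.
have conjE : rho (X ^ g i)%g = T i *m (T i *m T j *m T i *m T l) *m T i.
  by rewrite conjgE (invg_invol (cartan_gen_invol i)) ?mulgA !rhoM !rho_g !mulmxA.
(* [zexpg] reduces exponents modulo the order of the element; as [d] divides that order,
   divisibility of the residues passes to the integers. *)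
have dX : (d %| #[X]%g)%N.
  apply: hd; have [] // := @cartan_refl_indep _ _ _ _ _ eK Cdiag CK i j l ij il jl #[X]%g 0 _.
  by rewrite expr0 mulmx1 -XE -rhoX expg_order rho1 mul1mx.
have dX' : (d %| #[(X ^ g i)%g]%g)%N by rewrite orderJ.
move=> /fixA; rewrite rhoM /zexpg !rhoX conjE XE.
move=> /(cartan_refl_indep eK Cdiag CK ij il jl) [/hd d1 /hd d2].
by split; [apply: (zexpg_order_dvd dX d1)|apply: (zexpg_order_dvd dX' d2)].
Qed.

Let Cnz i j : i != j -> C i j != 0.
Proof.
move=> ij; apply/eqP => c0; have := CK ij; rewrite c0 mul0mx => /eqP.
by rewrite eq_sym oner_eq0.
Qed.

Lemma cartan_entry i j : j != i -> e j *m T i *m (e i)^T = - C j i.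
Proof.
move=> ji; rewrite mul_refl mulmxBl (root_coroot _ eK) eK (negbTE ji) -mulmxA eK eqxx.
by rewrite -scalemx1 scale0r mulmx1 sub0r.
Qed.

Lemma cartan_entry0 i j l : j != l -> i != l -> e j *m T i *m (e l)^T = 0.
Proof.
move=> jl il; rewrite -mulmxA cartan_refl_fix // eK (negbTE jl).
by rewrite -scalemx1 scale0r.
Qed.

Lemma cartan_gen_nt i j : i != j -> g i <> 1%g.
Proof.
move=> ij /(congr1 rho); rewrite rho_g rho1 => T1; have ji : j != i by rewrite eq_sym.
have := cartan_entry ji; rewrite T1 mulmx1 eK (negbTE ji) -scalemx1 scale0r.
by move=> /esym /eqP; rewrite oppr_eq0 (negbTE (Cnz ji)).
Qed.

Lemma cartan_gen_neq i j l : i != j -> i != l -> g i <> g j.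
Proof.
move=> ij il /(congr1 rho); rewrite !rho_g => Tij; have li : l != i by rewrite eq_sym.
have := cartan_entry li; rewrite Tij cartan_entry0 ?(eq_sym j) //.
by move=> /esym /eqP; rewrite oppr_eq0 (negbTE (Cnz li)).
Qed.

Local Notation o0 := (@Ordinal 3 0 isT).
Local Notation o1 := (@Ordinal 3 1 isT).
Local Notation o2 := (@Ordinal 3 2 isT).

Definition cartan_group : {set Q} := <<[set gens o0; gens o1; gens o2; gent]>>%g.

Hypothesis unitA : ~ translation_lattice (s%:Z, s%:Z) (1, 0).
Hypothesis unitB : ~ translation_lattice (t%:Z, 0) (1, 0).
Hypothesis lattice_neq :
  ~ (forall v, translation_lattice (s%:Z, s%:Z) v <-> translation_lattice (t%:Z, 0) v).
Hypothesis big : (12 * 4 ^ 6 < #|cartan_group|)%N.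

Lemma cartan_medial_polytope : exists G : sgraph,
  (#|cartan_group| <= 12 * #|G|)%N /\
  has_medial_polytope (s%:Z, s%:Z) (t%:Z, 0) G.
Proof.
apply: (@wreath_medial_polytope _ gens gent) => //.
- by move=> i; apply: cartan_gen_invol.
- exact: cartan_gen_invol.
- by move=> i j ij; apply: cartan_gen_ord3.
- by move=> i; apply: cartan_gen_ord3.
- by move=> i j l ij il jl; apply: cartan_gen_cox => //; apply: hol_s.
- by move=> i j ij; apply: cartan_gen_cox => //; apply: hol_t.
- move=> p q; apply: (@cartan_gen_indep (up o0) (up o1) (up o2)) => //; first exact: hol_s.
  move=> x; rewrite !inE => /orP [/orP [] | ] /eqP ->.
  + by exists (up o0).
  + by exists (up o1).
  + by exists ord_max.
- move=> p q; apply: (@cartan_gen_indep (up o0) (up o1) ord_max) => //; first exact: hol_t.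
  move=> x; rewrite !inE => /orP [/orP [] | ] /eqP ->.
  + by exists (up o0).
  + by exists (up o1).
  + by exists (up o2).
- exact: (@cartan_gen_nt _ (up o1)).
- exact: (@cartan_gen_nt _ (up o0)).
- exact: (@cartan_gen_neq _ _ (up o2)).
Qed.

End CartanGroup.

Lemma ord2P (i : 'I_2) : i = ord0 \/ i = ord_max.
Proof. by case: i => -[|[|//]] hi; [left|right]; apply: val_inj. Qed.

Lemma mx2P (R : Type) (A B : 'M[R]_2) :
  A ord0 ord0 = B ord0 ord0 -> A ord0 ord_max = B ord0 ord_max ->
  A ord_max ord0 = B ord_max ord0 -> A ord_max ord_max = B ord_max ord_max -> A = B.
Proof.
move=> h1 h2 h3 h4; apply/matrixP => i j.
by case: (ord2P i) => ->; case: (ord2P j) => ->.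
Qed.

Lemma mul2E (R : pzSemiRingType) (A B : 'M[R]_2) i j :
  (A *m B) i j = A i ord0 * B ord0 j + A i ord_max * B ord_max j.
Proof.
rewrite mxE !big_ord_recl big_ord0 addr0.
by have -> : lift ord0 ord0 = ord_max :> 'I_2 by apply: val_inj.
Qed.

(** * The characteristic divides the order of the reflection group *)

Section Average.
Variables (F : finFieldType) (n : nat) (C : 'I_4 -> 'I_4 -> 'M[F]_2) (e : 'I_4 -> 'M[F]_(2, n.+1)).
Hypothesis eK : forall i j, e i *m (e j)^T = (i == j)%:R%:M.
Hypothesis Cdiag : forall i, C i i = 1%:M + 1%:M.
Hypothesis Ctriang : forall i j, C i j ord_max ord0 = 0.
Hypothesis two_nz : (2%:R : F) != 0.
Hypothesis Clast : forall i : 'I_4, i != ord_max -> C i ord_max = - 1%:M.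
Variables i1 i2 i3 i4 : 'I_4.
Hypothesis C_diag : C i1 i2 ord0 ord_max = 0 /\ C i1 i2 ord0 ord0 != C i1 i2 ord_max ord_max.
Hypothesis C_nondiag : C i3 i4 ord0 ord_max != 0.

Local Notation T := (cartan_refl C e).
Variables (Q : finGroupType) (rho : Q -> 'M[F]_n.+1) (g : 'I_4 -> Q).
Hypothesis rhoM : forall x y, rho (x * y)%g = rho x *m rho y.
Hypothesis rho1 : rho 1%g = 1%:M.
Hypothesis rho_g : forall i, rho (g i) = T i.
Local Notation G := (cartan_group g).

(* Triangularity of the entries makes [D] satisfy [D g D = D g] on the group, so
   that the average [S] of the conjugates of [D] satisfies [S D = S] and
   [D S = #|G| D]; since [S] commutes with the group it is a scalar, hence 0. *)
Let E : 'M[F]_2 := delta_mx ord_max ord_max.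
Let D : 'M[F]_n.+1 := \sum_i (e i)^T *m E *m e i.

Let EE i j : E i j = ((i == ord_max) && (j == ord_max))%:R.
Proof. by rewrite mxE. Qed.

Let EC i j : E *m C i j *m E = E *m C i j.
Proof. by apply: mx2P; rewrite !mul2E !EE /= ?Ctriang; ring. Qed.

Let eD i : e i *m D = E *m e i.
Proof.
rewrite /D mulmx_sumr (bigD1 i) //= !mulmxA eK eqxx mul1mx big1 ?addr0 // => j ji.
by rewrite !mulmxA eK eq_sym (negbTE ji) -scalemx1 scale0r !mul0mx.
Qed.

Let De i : D *m (e i)^T = (e i)^T *m E.
Proof.
rewrite /D mulmx_suml (bigD1 i) //= -!mulmxA eK eqxx mulmx1 big1 ?addr0 // => j ji.
by rewrite -!mulmxA eK (negbTE ji) -scalemx1 scale0r !mulmx0.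
Qed.

Let E2 : E *m E = E.
Proof. by apply: mx2P; rewrite !mul2E !EE /=; ring. Qed.

Let DD : D *m D = D.
Proof.
rewrite {1}/D mulmx_suml; apply: eq_bigr => i _.
by rewrite -mulmxA eD -!mulmxA (mulmxA E) E2.
Qed.

Let DT i : D *m T i *m D = D *m T i.
Proof.
rewrite /cartan_refl mul_refl mulmxBl DD -!mulmxA; congr (_ - _).
rewrite eD; rewrite /coroot !mulmxA; congr (_ *m _).
rewrite mulmx_sumr mulmx_suml; apply: eq_bigr => j _.
by rewrite !mulmxA De -!mulmxA (mulmxA E (C j i)) EC.
Qed.

Let group_gen a : a \in [set g (widen_ord (leqnSn 3) (@Ordinal 3 0 isT));
    g (widen_ord (leqnSn 3) (@Ordinal 3 1 isT)); g (widen_ord (leqnSn 3) (@Ordinal 3 2 isT));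
    g ord_max] -> exists i, a = g i.
Proof. by rewrite !inE => /orP [/orP [/orP [] | ] | ] /eqP ->; eexists. Qed.

Let gen_D x : x \in G -> D *m rho x *m D = D *m rho x.
Proof.
move: x; apply: gen_ind => [|a x /group_gen [i ->] IH]; first by rewrite rho1 mulmx1 DD.
by rewrite rhoM rho_g mulmxA -DT -!mulmxA (mulmxA D (rho x)) IH.
Qed.

Lemma card_cartan_group_eq0 : (#|G|%:R : F) = 0.
Proof.
have GV x : rho x^-1%g *m rho x = 1%:M by rewrite -rhoM mulVg.
pose S : 'M[F]_n.+1 := \sum_(x in G) rho x^-1%g *m D *m rho x.
have SD : S *m D = S.
  by rewrite mulmx_suml; apply: eq_bigr => x xG; rewrite -!mulmxA (mulmxA D) gen_D.
have DS : D *m S = D *+ #|G|.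
  rewrite mulmx_sumr -sumr_const; apply: eq_bigr => x xG.
  by rewrite !mulmxA gen_D ?groupV // -mulmxA GV mulmx1.
have ST i : S *m T i = T i *m S.
  have hG : g i \in G.
    apply: mem_gen; rewrite !inE; case: i => -[|[|[|[|//]]]] hi.
    - by rewrite (_ : Ordinal hi = widen_ord (leqnSn 3) (@Ordinal 3 0 isT)) ?eqxx //; apply: val_inj.
    - by rewrite (_ : Ordinal hi = widen_ord (leqnSn 3) (@Ordinal 3 1 isT)) ?eqxx ?orbT //; apply: val_inj.
    - by rewrite (_ : Ordinal hi = widen_ord (leqnSn 3) (@Ordinal 3 2 isT)) ?eqxx ?orbT //; apply: val_inj.
    - by rewrite (_ : Ordinal hi = ord_max) ?eqxx ?orbT //; apply: val_inj.
  rewrite -rho_g.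
  rewrite mulmx_suml mulmx_sumr (reindex_inj (mulIg (g i)^-1)%g) /=.
  apply: eq_big => [x|x xG]; first by rewrite groupMr ?groupV.
  by rewrite invMg invgK !rhoM -!mulmxA GV mulmx1.
pose f i := coroot C e i.
have Sf i : S *m f i *m e i = f i *m (e i *m S).
  have := ST i; rewrite /cartan_refl mul_refl refl_mul => /addrI /oppr_inj; exact.
(* Since [S] commutes with each reflection, it acts on the row block [e i] through a 2 x 2 matrix
   [sg i]. The entries -1 of the last column make all [sg i] equal to one matrix [z], which then
   commutes with every Cartan entry. *)
pose sg i := (2%:R^-1 : F) *: (e i *m S *m f i).
have eS_ i : e i *m S = sg i *m e i.
  rewrite /sg -scalemxAl -(mulmxA (e i)) -(mulmxA (e i)) Sf mulmxA (root_coroot C eK) Cdiag.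
  by rewrite mulmxDl !mul1mx -mulr2n -scaler_nat scalerA mulVf // scale1r.
have sgC j i : sg j *m C j i = C j i *m sg i.
  have := congr1 (fun M => e j *m M *m (e i)^T) (Sf i).
  rewrite eS_ !mulmxA (root_coroot C eK) eS_ -!mulmxA eK eqxx !mulmx1 (root_coroot C eK).
  exact.
have sg_max i : sg i = sg ord_max.
  have [-> //|im] := eqVneq i ord_max.
  by have := sgC i ord_max; rewrite Clast // mulmxN mulNmx mulmx1 mul1mx => /oppr_inj.
pose z := sg ord_max.
have zC i j : z *m C i j = C i j *m z by have := sgC i j; rewrite sg_max (sg_max j).
have zE : z *m E = z.
  have := congr1 (fun M => M *m (e ord_max)^T) (congr1 (mulmx (e ord_max)) SD).
  by rewrite /= mulmxA eS_ -!mulmxA De (mulmxA (e _)) eK eqxx mul1mx mulmx1.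
(* [z *m E = z] kills the first column, commutation with a diagonal block of distinct entries kills
   the corner, and commutation with a nondiagonal block kills what is left. *)
have z0 : z = 0.
  have [c0 cne] := C_diag; have nd := C_nondiag; have ct := Ctriang.
  have zEe i j := congr1 (fun M : 'M_2 => M i j) zE.
  have z00 : z ord0 ord0 = 0 by rewrite -zEe mul2E !EE /=; ring.
  have z10 : z ord_max ord0 = 0 by rewrite -zEe mul2E !EE /=; ring.
  have z01 : z ord0 ord_max = 0.
    have := congr1 (fun M : 'M_2 => M ord0 ord_max) (zC i1 i2).
    rewrite !mul2E c0 z00 mul0r add0r mul0r addr0 => h; apply/eqP; move: h => /eqP.
    rewrite mulrC -subr_eq0 -mulrBl mulf_eq0 subr_eq0 eq_sym (negbTE cne) //.
  have z11 : z ord_max ord_max = 0.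
    have := congr1 (fun M : 'M_2 => M ord0 ord_max) (zC i3 i4).
    rewrite !mul2E z00 z01 !mul0r !mulr0 !add0r => /esym /eqP.
    by rewrite mulf_eq0 (negbTE nd) => /eqP.
  by apply: mx2P; rewrite zeromxE.
(* Compressed to one block, the identity relating [D *m S] and [D] reads [E *m z = #|G| E]; its left
   side is zero and [E] is not. *)
have := congr1 (fun M => e ord0 *m M *m (e ord0)^T) DS.
rewrite /= !mulmxA eD -(mulmxA E) eS_ sg_max -/z z0 mul0mx mulmx0 mul0mx.
rewrite -scaler_nat -scalemxAr -scalemxAl eD -mulmxA eK eqxx mulmx1.
by move=> /matrixP /(_ ord_max ord_max); rewrite !mxE /= mulr1 => <-.
Qed.

End Average.

Section ExactOrder.
Variables (F : fieldType) (k : nat).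
Implicit Types x y : 'M[F]_k.+1.

Lemma exact_order_conj m x y y' : y * y' = 1 -> y' * y = 1 ->
  exact_order m x -> exact_order m (y * x * y').
Proof.
move=> yy y'y [xm xu xd].
have E p : (y * x * y') ^+ p = y * x ^+ p * y'.
  elim: p => [|p IH]; first by rewrite !expr0 mulr1 yy.
  by rewrite !exprSr IH !mulrA -(mulrA _ y' y) y'y mulr1.
have yU : y \is a GRing.unit by apply/unitrP; exists y'.
have y'U : y' \is a GRing.unit by apply/unitrP; exists y.
split; first by rewrite E xm mulr1.
  have -> : y * x * y' - 1 = y * (x - 1) * y' by rewrite mulrBr mulrBl mulr1 yy.
  by rewrite unitrMr // unitrMr.
move=> p; rewrite E => e; apply: xd; apply: (mulrI yU); apply: (mulIr y'U).
by rewrite e mulr1.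
Qed.

Lemma exact_order_inv m x y : x * y = 1 -> y * x = 1 -> exact_order m x -> exact_order m y.
Proof.
move=> xy yx [xm xu xd].
have E p : x ^+ p * y ^+ p = 1 by rewrite -exprMn_comm ?xy ?expr1n // /GRing.comm yx.
split; first by rewrite -(E m) xm mul1r.
  have -> : y - 1 = - y * (x - 1) by rewrite mulrBr mulr1 mulNr yx addrC opprK.
  by rewrite unitrMr // unitrN; apply/unitrP; exists x.
by move=> p yp; apply: xd; rewrite -(E p) yp mulr1.
Qed.
End ExactOrder.

Section UpperTriangular.
Variable F : fieldType.

Definition upper (x y b : F) : 'M[F]_2 :=
  \matrix_(i, j) (if i == ord0 then (if j == ord0 then x else b) else (if j == ord0 then 0 else y)).

Lemma upperM x y b x' y' b' :
  upper x y b *m upper x' y' b' = upper (x * x') (y * y') (x * b' + b * y').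
Proof. by apply: mx2P; rewrite mul2E !mxE /=; ring. Qed.

Lemma upper1 : upper 1 1 0 = 1%:M.
Proof. by apply: mx2P; rewrite !mxE. Qed.

Lemma upperB1 x y b : upper x y b - 1 = upper (x - 1) (y - 1) b.
Proof. by apply: mx2P; rewrite !mxE /= ?subr0. Qed.

Lemma upper_inv x y b : x != 0 -> y != 0 ->
  upper x y b * upper x^-1 y^-1 (- (b * x^-1 * y^-1)) = 1 /\
  upper x^-1 y^-1 (- (b * x^-1 * y^-1)) * upper x y b = 1.
Proof. move=> x0 y0; rewrite -!mulmxE !upperM ?mulfV ?mulVf //.
have -> : x * - (b * x^-1 * y^-1) + b * y^-1 = 0 by field; rewrite x0 y0.
have -> : x^-1 * b + - (b * x^-1 * y^-1) * y = 0 by field; rewrite x0 y0.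
by rewrite upper1. Qed.

(** The corner of the [p]-th power is [b] times the divided difference of [x ^+ p] and [y ^+ p],
    which vanishes at [m] when [x] and [y] are distinct roots of unity. *)
Lemma exact_order_upper m x y b :
  x != y \/ b = 0 -> x ^+ m = 1 -> y ^+ m = 1 -> x != 1 -> y != 1 ->
  (forall p, x ^+ p = 1 -> (m %| p)%N) -> exact_order m (upper x y b).
Proof.
move=> xyb xm ym x1 y1 xd.
have E p : exists2 q, (x - y) * q = x ^+ p - y ^+ p & upper x y b ^+ p = upper (x ^+ p) (y ^+ p) (b * q).
  elim: p => [|p [q qE e]]; first by exists 0; rewrite ?expr0 ?subrr ?mulr0 // upper1.
  exists (x ^+ p + q * y); last by rewrite !exprSr e -mulmxE upperM; congr upper; ring.
  rewrite mulrDr mulrA qE !exprSr; ring.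
split.
- have [q qE ->] := E m; rewrite xm ym.
  suff -> : b * q = 0 by rewrite upper1.
  case: xyb => [xy|->]; last by rewrite mul0r.
  by move: qE; rewrite xm ym subrr => /eqP; rewrite mulf_eq0 subr_eq0 (negbTE xy) => /eqP ->; rewrite mulr0.
- rewrite upperB1; have [] := @upper_inv (x - 1) (y - 1) b; rewrite ?subr_eq0 // => e e'.
  by apply/unitrP; eexists; split; [exact: e'|exact: e].
- move=> p; have [q _ ->] := E p => /matrixP /(_ ord0 ord0); rewrite !mxE /= => /xd; exact.
Qed.
End UpperTriangular.

(** Only one holonomy has to be computed: rotating the triangle conjugates it and reversing the
    triangle inverts it, and both preserve the exact order. *)
Lemma triple_ind (P : 'I_4 -> 'I_4 -> 'I_4 -> Prop) :
  (forall a b c, a != b -> a != c -> b != c -> P a b c -> P b c a) ->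
  (forall a b c, a != b -> a != c -> b != c -> P a b c -> P a c b) ->
  P (@Ordinal 4 0 isT) (@Ordinal 4 1 isT) (@Ordinal 4 2 isT) ->
  forall i j l : 'I_3, i != j -> i != l -> j != l ->
  P (widen_ord (leqnSn 3) i) (widen_ord (leqnSn 3) j) (widen_ord (leqnSn 3) l).
Proof.
set q0 := Ordinal _; set q1 := Ordinal _; set q2 := Ordinal _ => rot swap h.
have h1 := rot q0 q1 q2 isT isT isT h; have h2 := rot q1 q2 q0 isT isT isT h1.
have g0 := swap q0 q1 q2 isT isT isT h; have g1 := swap q1 q2 q0 isT isT isT h1.
have g2 := swap q2 q0 q1 isT isT isT h2.
have E (i : 'I_3) : [\/ widen_ord (leqnSn 3) i = q0, widen_ord (leqnSn 3) i = q1
    | widen_ord (leqnSn 3) i = q2].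
  by case: i => -[|[|[|//]]] hi; [apply: Or31|apply: Or32|apply: Or33]; apply: val_inj.
have upI : injective (widen_ord (leqnSn 3)).
  by move=> x y /(congr1 val) e; apply: val_inj.
move=> i j l; rewrite -!(inj_eq upI).
by case: (E i) => ->; case: (E j) => ->; case: (E l) => ->.
Qed.

Section ToroidalCartan.
Variables (F : finFieldType) (s t : nat) (eta zeta : F).
Hypothesis eta_prim : t.-primitive_root eta.
Hypothesis kappa_prim : s.-primitive_root (eta ^+ 2 * zeta).
Hypotheses (t3 : (2 < t)%N) (s2 : (1 < s)%N).
Hypothesis zetaE : zeta = eta \/ zeta = eta^-1.
Hypothesis two_nz : (2%:R : F) != 0.

Let eta0 : eta != 0.
Proof.
apply/eqP => e; have /eqP := prim_expr_order eta_prim.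
by rewrite e expr0n; case: t t3 => [|m] //= _; rewrite eq_sym oner_eq0.
Qed.
Let zeta0 : zeta != 0. Proof. by case: zetaE => ->; rewrite ?invr_eq0. Qed.

Let alpha := upper eta eta^-1 0.
Let alpha' := upper eta^-1 eta 0.
Let beta := upper eta eta^-1 1.
Let beta' := upper eta^-1 eta (-1).
(* [gamma] is chosen to make the holonomy [alpha *m beta *m gamma] the diagonal
   matrix with entry [eta ^+ 2 * zeta] and its inverse. *)
Let gamma := upper zeta zeta^-1 (- (eta^-1 * zeta^-1)).
Let gamma' := upper zeta^-1 zeta (eta^-1 * zeta^-1).

(** Opposite entries are mutually inverse, and the last index has only entries -1, so a holonomy
    through it is just the opposite of the entry between the other two indices. *)
Definition cartan (i j : 'I_4) : 'M[F]_2 :=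
  match val i, val j with
  | 0%N, 1%N => - alpha | 1%N, 0%N => - alpha'
  | 1%N, 2%N => - beta  | 2%N, 1%N => - beta'
  | 2%N, 0%N => - gamma | 0%N, 2%N => - gamma'
  | i', j' => if i' == j' then 1%:M + 1%:M else - 1%:M
  end.
Local Notation C := cartan.

Let upper_eq1 x y b : x = 1 -> y = 1 -> b = 0 -> upper x y b = 1%:M :> 'M[F]_2.
Proof. by move=> -> -> ->; rewrite upper1. Qed.

Lemma cartan_diag i : C i i = 1%:M + 1%:M.
Proof. by case: i => -[|[|[|[|//]]]] hi. Qed.

Lemma cartan_opp i j : i != j -> C i j *m C j i = 1%:M.
Proof.
have N (A B : 'M[F]_2) : A *m B = 1%:M -> - A *m - B = 1%:M.
  by rewrite mulmxN mulNmx opprK.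
have h (x b : F) : x != 0 -> upper x x^-1 b *m upper x^-1 x (- b) = 1%:M.
  by move=> x0; rewrite upperM; apply: upper_eq1; rewrite ?mulfV ?mulVf //; ring.
have h' (x b : F) : x != 0 -> upper x^-1 x (- b) *m upper x x^-1 b = 1%:M.
  by move=> x0; rewrite upperM; apply: upper_eq1; rewrite ?mulfV ?mulVf //; ring.
have one : (1%:M : 'M[F]_2) *m 1%:M = 1%:M by rewrite mul1mx.
have ha := h eta 0 eta0; have ha' := h' eta 0 eta0; rewrite oppr0 in ha ha'.
have hg := h zeta (- (eta^-1 * zeta^-1)) zeta0.
have hg' := h' zeta (- (eta^-1 * zeta^-1)) zeta0; rewrite opprK in hg hg'.
case: i j => [[|[|[|[|//]]]] hi] [[|[|[|[|//]]]] hj] //= _; rewrite /cartan /=; apply: N => //;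
  by [apply: h|apply: h'].
Qed.

Lemma cartan_triang i j : C i j ord_max ord0 = 0.
Proof.
by case: i j => [[|[|[|[|//]]]] hi] [[|[|[|[|//]]]] hj]; rewrite /cartan /= !mxE /= ?oppr0 ?addr0.
Qed.

Lemma cartan_last i : i != ord_max -> C i ord_max = - 1%:M.
Proof. by case: i => -[|[|[|[|//]]]]. Qed.

Let pow (x : F) m : x ^+ m = 1 -> x^-1 ^+ m = 1.
Proof. by rewrite exprVn => ->; rewrite invr1. Qed.

Let eta1 : eta != 1.
Proof.
by have := prim_order_dvd eta_prim 1; rewrite expr1 dvdn1 => <-; case: t t3 => [|[|]].
Qed.

Let eta_neqV : eta != eta^-1.
Proof.
apply/negP => /eqP e; have := prim_order_dvd eta_prim 2.
rewrite expr2 {2}e mulfV // eqxx => /dvdn_leq; lia.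
Qed.

Let eta_t := prim_expr_order eta_prim.
Let eta_dvd p : eta ^+ p = 1 -> (t %| p)%N.
Proof. by rewrite (prim_order_dvd eta_prim) => ->. Qed.

Let exact_eta b : exact_order t (upper eta eta^-1 b).
Proof.
by apply: exact_order_upper; rewrite ?pow ?invr_eq1 //; left.
Qed.

Let exact_gamma b : exact_order t (upper zeta zeta^-1 b).
Proof.
case: zetaE => ->; first exact: exact_eta.
rewrite invrK; apply: exact_order_upper; rewrite ?pow ?invr_eq1 //; first by left; rewrite eq_sym.
move=> p e; apply: eta_dvd; rewrite -[eta]invrK; exact: pow.
Qed.

Local Notation up := (widen_ord (leqnSn 3)).
Let q0 : 'I_4 := @Ordinal 4 0 isT.
Let q1 : 'I_4 := @Ordinal 4 1 isT.
Let q2 : 'I_4 := @Ordinal 4 2 isT.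

Let hol_last (i j : 'I_3) : holonomy C (up i) (up j) ord_max = - C (up i) (up j).
Proof.
have e (l : 'I_3) : C (up l) ord_max = - 1%:M /\ C ord_max (up l) = - 1%:M.
  by case: l => -[|[|[|//]]].
by rewrite /holonomy (proj1 (e j)) (proj2 (e i)) !(mulmxN, mulNmx, mulmx1) opprK.
Qed.

Lemma cartan_exact_t (i j : 'I_3) : i != j -> exact_order t (holonomy C (up i) (up j) ord_max).
Proof.
rewrite hol_last => ij.
have inv (a b : 'I_4) : a != b -> exact_order t (- C a b) -> exact_order t (- C b a).
  move=> ab; apply: exact_order_inv; rewrite mulrNN -mulmxE cartan_opp //.
  by rewrite eq_sym.
have a1 : exact_order t (- C q0 q1).
  by rewrite /cartan /= opprK; apply: exact_eta.
have a2 : exact_order t (- C q1 q2).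
  by rewrite /cartan /= opprK; apply: exact_eta.
have a3 : exact_order t (- C q2 q0).
  by rewrite /cartan /= opprK; apply: exact_gamma.
have b1 := inv q0 q1 isT a1; have b2 := inv q1 q2 isT a2; have b3 := inv q2 q0 isT a3.
by case: i j ij => [[|[|[|//]]] hi] [[|[|[|//]]] hj].
Qed.

Lemma cartan_exact_s (i j l : 'I_3) : i != j -> i != l -> j != l ->
  exact_order s (holonomy C (up i) (up j) (up l)).
Proof.
have rot (a b c : 'I_4) : a != b -> a != c -> b != c ->
    exact_order s (holonomy C a b c) -> exact_order s (holonomy C b c a).
  move=> ab ac bc; have ba : b != a by rewrite eq_sym.
  have -> : holonomy C b c a = C b a * holonomy C a b c * C a b.
    by rewrite /holonomy mulrN mulNr -!mulmxE !mulmxA cartan_opp // mul1mx.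
  by apply: exact_order_conj; rewrite -mulmxE cartan_opp.
have swap (a b c : 'I_4) : a != b -> a != c -> b != c ->
    exact_order s (holonomy C a b c) -> exact_order s (holonomy C a c b).
  move=> ab ac bc; have ba : b != a by rewrite eq_sym.
  have ca : c != a by rewrite eq_sym.
  have cb : c != b by rewrite eq_sym.
  apply: exact_order_inv; rewrite /holonomy mulrNN -!mulmxE.
    by rewrite -!mulmxA (mulmxA (C c a)) cartan_opp // mul1mx (mulmxA (C b c)) cartan_opp // mul1mx cartan_opp.
  by rewrite -!mulmxA (mulmxA (C b a)) cartan_opp // mul1mx (mulmxA (C c b)) cartan_opp // mul1mx cartan_opp.
have h : exact_order s (holonomy C q0 q1 q2).
  have -> : holonomy C q0 q1 q2 =
      upper (eta ^+ 2 * zeta) (eta ^+ 2 * zeta)^-1 0.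
    rewrite /holonomy /cartan /= !(mulmxN, mulNmx) !opprK !upperM.
    by congr upper; field; rewrite ?eta0 ?zeta0.
  apply: exact_order_upper; first by right.
  - exact: prim_expr_order.
  - by apply: pow; apply: prim_expr_order.
  - by have := prim_order_dvd kappa_prim 1; rewrite expr1 dvdn1 => <-; case: s s2 => [|[|]].
  - by rewrite invr_eq1; have := prim_order_dvd kappa_prim 1; rewrite expr1 dvdn1 => <-; case: s s2 => [|[|]].
  - by move=> p; rewrite (prim_order_dvd kappa_prim) => ->.
exact: triple_ind rot swap h i j l.
Qed.

Let pos_lt (i : 'I_4) (x : 'I_2) : (i * 2 + x < 8)%N.
Proof. by have := ltn_ord i; have := ltn_ord x; lia. Qed.
Let pos i x : 'I_8 := Ordinal (pos_lt i x).

Definition block_row (i : 'I_4) : 'M[F]_(2, 8) := \matrix_(x, y) (y == pos i x)%:R.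

Lemma block_row_ortho i j : block_row i *m (block_row j)^T = (i == j)%:R%:M.
Proof.
apply/matrixP => x z; rewrite !mxE (bigD1 (pos i x)) //= big1 => [|y yi]; last first.
  by rewrite !mxE (negbTE yi) mul0r.
rewrite !mxE eqxx mul1r addr0.
have -> : (pos i x == pos j z) = (i == j) && (x == z).
  apply/eqP/andP => [/(congr1 val) /= e|[/eqP -> /eqP ->] //].
  have hx := ltn_ord x; have hz := ltn_ord z.
  by split; apply/eqP/val_inj; move: e; rewrite /=; lia.
by case: (i == j); case: (x == z).
Qed.

Local Notation T := (cartan_refl C block_row).

Let T_unit i : T i \is a GRing.unit.
Proof.
by have [] := mulmx1_unit (cartan_refl_invol block_row_ortho cartan_diag i).
Qed.

Definition cartan_unit i : {unit 'M[F]_8} := FinRing.unit _ (T_unit i).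
Definition unit_mx (x : {unit 'M[F]_8}) : 'M[F]_8 := val x.
Local Notation W := (cartan_group cartan_unit).

Lemma unit_mxM x y : unit_mx (x * y)%g = unit_mx x *m unit_mx y. Proof. by []. Qed.
Lemma unit_mx1 : unit_mx 1%g = 1%:M. Proof. by []. Qed.
Lemma unit_mx_gen i : unit_mx (cartan_unit i) = T i. Proof. by []. Qed.

(** The averaging argument is fed with the entry [- alpha], diagonal with distinct eigenvalues
    because [t > 2], and with [- beta], whose corner is not zero. *)
Lemma cartan_unit_card p : p \in [pchar F] -> (p <= #|W|)%N.
Proof.
move=> pF; apply: dvdn_leq; first exact: cardG_gt0.
rewrite (dvdn_pcharf pF); apply/eqP.
apply: (@card_cartan_group_eq0 _ _ C block_row block_row_ortho cartan_diag cartan_triang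
  two_nz cartan_last q0 q1 q1 q2 _ _ _ unit_mx _ unit_mxM unit_mx1 unit_mx_gen).
  rewrite /cartan /= !mxE /= oppr0; split=> //.
  by rewrite (inj_eq oppr_inj).
by rewrite /cartan /= !mxE /= oppr_eq0 oner_eq0.
Qed.

Hypothesis unitA : ~ translation_lattice (s%:Z, s%:Z) (1, 0).
Hypothesis unitB : ~ translation_lattice (t%:Z, 0) (1, 0).
Hypothesis lattice_neq :
  ~ (forall v, translation_lattice (s%:Z, s%:Z) v <-> translation_lattice (t%:Z, 0) v).

Lemma toroidal_medial_polytope p : p \in [pchar F] -> (12 * 4 ^ 6 < p)%N ->
  exists G : sgraph, (p <= 12 * #|G|)%N /\
  has_medial_polytope (s%:Z, s%:Z) (t%:Z, 0) G.
Proof.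
move=> /cartan_unit_card pW big.
have [|G [le GP]] := @cartan_medial_polytope _ _ _ C block_row block_row_ortho cartan_diag cartan_opp
  s t cartan_exact_s cartan_exact_t _ unit_mx cartan_unit unit_mxM val_inj unit_mx1 unit_mx_gen
  unitA unitB lattice_neq; first exact: leq_trans big pW.
by exists G; split=> //; apply: leq_trans pW le.
Qed.

End ToroidalCartan.

(** * Infinitely many graphs *)

Lemma finField_prim_root (F : finFieldType) (t : nat) :
  (t %| #|F|.-1)%N -> exists eta : F, t.-primitive_root eta.
Proof.
move=> tF; have F1 : (1 < #|F|)%N := finNzRing_gt1 F.
have q0 : (0 < #|F|.-1)%N by lia.
have : has (#|F|.-1).-primitive_root (enum (predC1 (0 : F))).
  apply: has_prim_root; rewrite ?enum_uniq -?cardE ?cardC1 //.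
  apply/allP => x; rewrite mem_enum => x0; apply/unity_rootP; apply: (mulfI x0).
  by rewrite -exprS prednK ?expf_card ?mulr1 //; lia.
case/hasP=> z _ zP; exists (z ^+ (#|F|.-1 %/ t)); exact: dvdn_prim_root.
Qed.

(** By Euler's theorem [t] divides [p ^ totient t - 1] for a prime [p] not dividing [t], so the
    field of order [p ^ totient t] contains the required roots of unity. *)
Lemma exists_prim_root_field (t N : nat) : (0 < t)%N -> exists (F : finFieldType) (p : nat) (eta : F),
  [/\ (N < p)%N, p \in [pchar F], (2%:R : F) != 0 & t.-primitive_root eta].
Proof.
move=> t0; have [p pN pp] := prime_above (N + t + 2).
have cpt : coprime p t by rewrite prime_coprime // gtnNdvd //; lia.
have [F pF cF] := PrimePowerField pp (etrans (totient_gt0 t) t0).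
have [|eta etaP] := @finField_prim_root F t.
  have p0 : (0 < p ^ totient t)%N by rewrite expn_gt0 prime_gt0.
  rewrite cF -subn1 -eqn_mod_dvd //; apply/eqP; exact: Euler_exp_totient.
exists F, p, eta; split=> //; first lia.
by rewrite -(dvdn_pcharf pF) gtnNdvd //; lia.
Qed.

Lemma translation_latticeE (ab : int * int) (v : Defs.point) : translation_lattice ab v <->
  exists m n : int, v.1 = ab.1 * m - ab.2 * n /\ v.2 = ab.2 * m + (ab.1 + ab.2) * n.
Proof.
split=> -[m [n]].
  by move=> ->; exists m, n; rewrite /= !raddfMz /= -!mulrzz mulNrz.
by case=> e1 e2; exists m, n; apply: pointP; rewrite ?e1 ?e2 /= !raddfMz /= !mulrzz ?mulNr.
Qed.

Lemma large_medial_polytope (s : int) (t : int * int) :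
  2 <= s -> t = (s, 0) \/ t = (3 * s, 0) -> ~ (s = 2 /\ t = (2, 0)) ->
  forall N : nat, exists2 G : sgraph, (N < #|G|)%N & has_medial_polytope (s, s) t G.
Proof.
case: s => // s s2 tE ne N; pose t' := if t == (s%:Z, 0) then s else (3 * s)%N.
have tE' : t = (t'%:Z, 0) by rewrite /t'; case: eqP => [//|]; case: tE => // -> _; rewrite PoszM.
have t3 : (2 < t')%N.
  rewrite /t'; case: eqP => [e|_]; last lia.
  rewrite ltn_neqAle; apply/andP; split; last lia.
  by apply/eqP => s2'; apply: ne; rewrite e -s2'.
(* The group has order at least [p] and at most 12 times the number of vertices: the first summand
   yields more than [N] vertices, the second passes the bound of the arc argument. *)
have [F [p [eta [pN pF two_nz etaP]]]] := exists_prim_root_field (12 * N + 12 * 4 ^ 6) (ltn_trans (isT : 0 < 2)%N t3).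
(* For [t = (s, 0)] the choice [zeta = eta^-1] leaves [eta], of order [s]; for [t = (3 * s, 0)] the
   choice [zeta = eta] gives [eta ^+ 3], again of order [s]. *)
have [zeta zetaE kP] : exists2 zeta, zeta = eta \/ zeta = eta^-1 & s.-primitive_root (eta ^+ 2 * zeta).
  move: etaP; rewrite /t'; case: eqP => [_|_] etaP.
    exists eta^-1; first by right.
    rewrite expr2 -mulrA mulfV ?mulr1 //; apply/eqP => e0.
    have := prim_expr_order etaP; rewrite e0 expr0n; case: (s) s2 => // m _ /=.
    by move=> /esym /eqP; rewrite oner_eq0.
  exists eta; first by left.
  have -> : eta ^+ 2 * eta = eta ^+ (3 * s %/ s) by rewrite mulnK -?exprSr //; lia.
  by apply: dvdn_prim_root => //; apply: dvdn_mull.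
have unit (r : nat) (k : int) : (1 < r)%N -> 1 <> r%:Z * k by move=> r1; case: (lerP k 0) => k0; nia.
have unitA : ~ translation_lattice (s%:Z, s%:Z) (1, 0).
  by rewrite translation_latticeE => -[m [n [/= e _]]]; apply: (unit s (m - n)) => //; lia.
have unitB : ~ translation_lattice (t'%:Z, 0) (1, 0).
  by rewrite translation_latticeE => -[m [n [/= e _]]]; apply: (unit t' m); lia.
have cancel (k : int) : s%:Z * k = 0 -> k = 0 by move=> e; nia.
(* When [t'] equals [s], the vector [(s, 0)] lies only in the second lattice; when it is [3 * s],
   the vector [(s, s)] lies only in the first. *)
have neq : ~ (forall v, translation_lattice (s%:Z, s%:Z) v <-> translation_lattice (t'%:Z, 0) v).
  move=> h; case: (eqVneq t' s) => [e|ts].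
    have /h : translation_lattice (t'%:Z, 0) (t'%:Z, 0).
      by rewrite translation_latticeE; exists 1, 0 => /=; lia.
    rewrite e translation_latticeE => -[m [n [/= e1 e2]]].
    have := cancel (m - n - 1); have := cancel (m + n + n); lia.
  have t3s : t' = (3 * s)%N by move: ts; rewrite /t'; case: ifP => //; rewrite eqxx.
  have /h : translation_lattice (s%:Z, s%:Z) (s%:Z, s%:Z).
    by rewrite translation_latticeE; exists 1, 0 => /=; lia.
  rewrite t3s translation_latticeE => -[m [n [/= e1 e2]]].
  have := cancel (3 * m - 1); lia.
have big : (12 * 4 ^ 6 < p)%N := leq_ltn_trans (leq_addl _ _) pN.
have Np : (12 * N < p)%N := leq_ltn_trans (leq_addr _ _) pN.
have [G [Gp GP]] := toroidal_medial_polytope etaP kP t3 s2 zetaE two_nz unitA unitB neq pF big.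
exists G; last by rewrite /has_medial_polytope tE'.
by rewrite -(ltn_pmul2l (isT : 0 < 12)%N) (leq_trans Np Gp).
Qed.

Theorem theorem4 (s : int) (t : int * int) :
  2 <= s ->
  t = (s, 0) \/ t = (3 * s, 0) ->
  ~ (s = 2 /\ t = (2, 0)) ->
  exists G : nat -> sgraph,
    (forall i j : nat, i <> j -> ~ sgraph_isomorphic (G i) (G j)) /\
    (forall i : nat,
       [/\ valent (G i) 3,
           semisymmetric (G i)
         & exists (d : Order.disp_t) (P : finPOrderType d) (rk : P -> int),
             [/\ abstract_polytope 4 rk,
                 regular_poset P,
                 has_facets rk (s, s),
                 has_vertex_figures rk t
               & sgraph_isomorphic (G i) (medial_layer_graph rk)]]).
Proof.
move=> s2 tE ne.
have /choice [f fP] : forall N : nat, exists G : sgraph, (N < #|G|)%N /\ has_medial_polytope (s, s) t G.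
  by move=> N; have [G] := large_medial_polytope s2 tE ne N; exists G.
(* Each graph is chosen with more vertices than its predecessor, so the numbers of vertices increase
   strictly and no two graphs are isomorphic. *)
pose G i := f (iter i (fun N => #|f N|) 0%N).
have mono : {homo (fun i => #|G i|) : i j / (i < j)%N}.
  by apply: homo_ltn => [? ? ?|i]; [exact: ltn_trans|exact: (fP #|G i|).1].
exists G; split=> [i j ij [h /bij_eq_card e _]|i]; last exact: (fP _).2.
by case: (ltngtP i j) ij => // /mono; rewrite e ltnn.
Qed.
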